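(* Let $\rho\in\mathbb R$ and let $\eta^{\rho,z_0}$ denote the $\mathrm{SLE}_0(\rho)$ in $\mathbb H$ starting at $0$, with reference point $\infty$ and force point $z_0\in\overline{\mathbb H}\setminus\{0\}$, re-parametrized by arc-length. If $z_0\in\mathbb R\setminus\{0\}$, let $h_{\rho,z_0}:\mathbb H\to\mathbb R$ be the field $$h_{\rho,z_0}(z)=\begin{cases}\pi(1+\tfrac\rho2)-\arg(z)-\tfrac\rho2\arg(z-z_0),&z_0>0,\\ \pi-\arg(z)-\tfrac\rho2\arg(z-z_0),&z_0<0,\end{cases}$$ where the branches of $\arg(z)$ and $\arg(z-z_0)$ take values in $(0,\pi)$. Then $\eta^{\rho,z_0}$ is a flow-line of $h_{\rho,z_0}$. If $z_0=re^{i\theta}\in\mathbb H$, $\theta\in(0,\pi)$, let $h_{\rho,z_0}:\mathbb H_{z_0}\to\mathbb R$, where $\mathbb H_{z_0}:=\pi_{z_0}^{-1}(\mathbb H)\subset M_{z_0}$, be the field $$h_{\rho,z_0}(z)=\pi-\arg(z)-\tfrac\rho4\big(\arg(z-z_0)+\arg(z-\bar z_0)\big),$$ where the branches of $\arg(z)$ and $\arg(z-\bar z_0)$ take values in $(0,\pi)$. Then the lift of $\eta^{\rho,z_0}$ by $\pi_{z_0}$, starting at $(r,\theta-\pi)$, is a flow-line of $h_{\rho,z_0}$.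
   Context: $\mathbb H$ is the upper half-plane. The $\mathrm{SLE}_0(\rho)$ in $\mathbb H$ starting at $0$ with reference point $\infty$ and force point $z_0$ is the curve whose (half-plane capacity) driving function solves $\dot W_t=\mathrm{Re}\frac{\rho}{W_t-z_t}$, $W_0=0$, where $z_t=g_t(z_0)$ and $\partial_tg_t(z)=\frac2{g_t(z)-W_t}$, $g_0(z)=z$, $\gamma(t)=\lim_{y\to0+}g_t^{-1}(W_t+iy)$, run up to $\tau_{0+}=\lim_{\varepsilon\to0+}\inf\{t:|W_t-z_t|=\varepsilon\}$. For $z_0\in\mathbb C$, $M_{z_0}=\{(r,\theta):r>0,\theta\in\mathbb R\}$ is the logarithmic Riemann surface centered at $z_0$, with the complex structure induced by $\pi_{z_0}:M_{z_0}\to\mathbb C$, $(r,\theta)\mapsto z_0+re^{i\theta}$. A point $(r,\theta)\in M_{z_0}$ is written as $z=z_0+re^{i\theta}$, so $M_{z_0}$ is locally identified with $\mathbb C$ and $\arg(\cdot-z_0):M_{z_0}\to\mathbb R$, $(r,\theta)\mapsto\theta$, is single-valued; other functions of $z$ such as $\arg(z)$ and $\arg(z-\bar z_0)$ are evaluated at the projection $\pi_{z_0}(z)$. A $C^1$ curve $\eta$, parametrized by arc-length, is a flow-line of a field $h$ if $\eta'(t)=e^{ih(\eta(t))}$ (on $M_{z_0}$, using the local identification with $\mathbb C$). *)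

(* Defs.v *)
From Stdlib Require Import Reals Lra.
From Coquelicot Require Export Coquelicot.
Open Scope R_scope.

(** * Differentiation along an interval *)

Definition segment (t : R) : R -> Prop := fun s => 0 <= s <= t.

Definition half_open (T : Rbar) : R -> Prop := fun s => 0 <= s /\ Rbar_lt s T.

(** One-sided at an end point of [I] that belongs to [I], ordinary at interior
    points of [I]. *)
Definition is_derive_on {V : NormedModule R_AbsRing}
  (I : R -> Prop) (f : R -> V) (t : R) (l : V) : Prop :=
  filterdiff f (within I (locally t)) (fun h : R => scal h l).

(** * Loewner flow and SLE_0(rho) *)

Definition solves_loewner (W : R -> R) (I : R -> Prop) (x : C) (u : R -> C)
  : Prop :=
  u 0 = x /\
  forall t, I t ->
    u t <> RtoC (W t) /\
    is_derive_on (V := C_R_NormedModule) I u t (2 / (u t - W t))%C.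

(** [g_t(x) = w]; in particular the flow started at [x] lives up to time [t]. *)
Definition loewner_map (W : R -> R) (t : R) (x w : C) : Prop :=
  exists u : R -> C, solves_loewner W (segment t) x u /\ u t = w.

(** [gamma(t) = lim_(y -> 0+) g_t^(-1)(W_t + i y)]; here [ginv y] is the point
    [g_t^(-1)(W_t + i y)] of the upper half-plane. *)
Definition is_trace (W : R -> R) (T : Rbar) (gamma : R -> C) : Prop :=
  forall t, half_open T t ->
    exists ginv : R -> C,
      (forall y, 0 < y ->
         0 < Im (ginv y) /\ loewner_map W t (ginv y) (W t, y)) /\
      filterlim ginv (at_right 0) (locally (gamma t)).

(** Infimum of the empty set is [p_infty]. *)
Definition hitting_time (W : R -> R) (z : R -> C) (T : Rbar) (eps : R) : Rbar :=
  Glb_Rbar (fun t => half_open T t /\ Cmod (W t - z t)%C = eps).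

(** Limit at [0+] of an extended-real-valued function, for the order topology
    of [Rbar]. *)
Definition Rbar_lim_right0 (f : R -> Rbar) (l : Rbar) : Prop :=
  (forall a, Rbar_lt a l -> at_right 0 (fun e => Rbar_lt a (f e))) /\
  (forall b, Rbar_lt l b -> at_right 0 (fun e => Rbar_lt (f e) b)).

(** [W] is the driving function, [z t = g_t(z0)], [gamma] the curve
    parametrized by half-plane capacity, all considered on [0, tau), with
    [tau = tau_(0+)].  [SLE0_time] also says that [W] and [z] are
    not restricted to a shorter time interval: on a shorter one [W - z] stays
    away from 0 and the hitting times of small levels are [p_infty]. *)
Record is_SLE0 (rho : R) (z0 : C) (tau : Rbar)
  (W : R -> R) (z : R -> C) (gamma : R -> C) : Prop := {
  SLE0_start : W 0 = 0;
  SLE0_force : solves_loewner W (half_open tau) z0 z;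
  SLE0_drive : forall t, half_open tau t ->
    is_derive_on (V := R_NormedModule) (half_open tau) W t
      (Re (rho / (W t - z t))%C);
  SLE0_time : Rbar_lim_right0 (hitting_time W z tau) tau;
  SLE0_trace : is_trace W tau gamma
}.

(** * Arc-length *)

(** [l] is the supremum of the lengths of the polygonal lines inscribed in
    [gamma] over [[a, b]] (so [gamma] is rectifiable there). *)
Definition is_curve_length (gamma : R -> C) (a b l : R) : Prop :=
  is_lub
    (fun S => exists (n : nat) (t : nat -> R),
       t 0%nat = a /\ t (Datatypes.S n) = b /\
       (forall i, (i <= n)%nat -> t i <= t (Datatypes.S i)) /\
       S = sum_f_R0
             (fun i => Cmod (gamma (t (Datatypes.S i)) - gamma (t i))%C) n)
    l.

(** [eta] on [0, L) is [gamma] on [0, T) re-parametrized by arc-length: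
    [sigma t] is the length of [gamma] over [[0, t]] and
    [eta (sigma t) = gamma t]. *)
Definition is_arclength_reparam (T : Rbar) (gamma : R -> C)
  (L : Rbar) (eta : R -> C) : Prop :=
  exists sigma : R -> R,
    (forall t, half_open T t ->
       is_curve_length gamma 0 t (sigma t) /\ eta (sigma t) = gamma t) /\
    (forall s, half_open L s <-> exists t, half_open T t /\ sigma t = s).

(** A [C^1] curve on [0, L) parametrized by arc-length. *)
Definition C1_arclength (L : Rbar) (eta : R -> C) : Prop :=
  exists d : R -> C,
    (forall s, half_open L s ->
       is_derive_on (V := C_R_NormedModule) (half_open L) eta s (d s) /\
       Cmod (d s) = 1) /\
    continuous_on (T := R_UniformSpace) (U := C_UniformSpace)
      (half_open L) d.

(** * Fields and flow-lines *)

(** [e^(i t)] *)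
Definition cis (t : R) : C := (cos t, sin t).

(** The branch of the argument with values in [(0, PI)] on the upper
    half-plane; see [argH_spec]. *)
Definition argH (z : C) : R := acos (Re z / Cmod z).

Lemma argH_spec (z : C) : 0 < Im z ->
  0 < argH z < PI /\ z = (Cmod z * cis (argH z))%C.
Proof.
destruct z as [x y]; unfold argH; simpl; intros Hy.
assert (Hm : 0 < Cmod (x, y)).
{ apply Cmod_gt_0; intros E; injection E; lra. }
assert (Hsq : Cmod (x, y) * Cmod (x, y) = x * x + y * y).
{ unfold Cmod; simpl; rewrite sqrt_sqrt; nra. }
set (m := Cmod (x, y)) in *.
assert (Hq : x / m * m = x) by (field; lra).
assert (Hx : - m < x < m) by (split; nra).
assert (Hb : -1 < x / m < 1).
{ split; apply Rmult_lt_reg_r with m; lra. }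
split; [now apply acos_bound_lt|].
assert (Hs : sqrt (1 - (x / m)²) = y / m).
{ apply sqrt_lem_1.
  - unfold Rsqr; nra.
  - apply Rlt_le, Rdiv_lt_0_compat; lra.
  - replace (y / m * (y / m)) with (y * y / (m * m)) by (field; lra).
    replace (y * y) with (m * m - x * x) by lra.
    unfold Rsqr; field; lra. }
unfold cis; rewrite cos_acos, sin_acos by lra; rewrite Hs.
unfold Cmult, RtoC; simpl; apply f_equal2; field; lra.
Qed.

(** [h] is a field on the upper half-plane (its values elsewhere are
    irrelevant).  The curve starts on the boundary, where [h] is not defined,
    so the flow equation is required for positive times. *)
Definition flow_line (h : C -> R) (L : Rbar) (eta : R -> C) : Prop :=
  C1_arclength L eta /\
  forall s, 0 < s -> Rbar_lt s L ->
    0 < Im (eta s) /\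
    is_derive (V := C_R_NormedModule) eta s (cis (h (eta s))).

Definition field_real (rho x0 : R) (z : C) : R :=
  if Rlt_dec 0 x0
  then PI * (1 + rho / 2) - argH z - rho / 2 * argH (z - x0)%C
  else PI - argH z - rho / 2 * argH (z - x0)%C.

(** The logarithmic Riemann surface centered at [z0]. *)
Record log_surface (z0 : C) : Type := LogPoint {
  rad : R;
  ang : R;
  rad_pos : 0 < rad
}.
Arguments LogPoint {z0}.
Arguments rad {z0}.
Arguments ang {z0}.

Definition log_proj {z0 : C} (p : log_surface z0) : C :=
  (z0 + rad p * cis (ang p))%C.

Definition log_continuous {z0 : C} (L : Rbar) (e : R -> log_surface z0) : Prop :=
  continuous_on (T := R_UniformSpace) (U := R_UniformSpace)
    (half_open L) (fun s => rad (e s)) /\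
  continuous_on (T := R_UniformSpace) (U := R_UniformSpace)
    (half_open L) (fun s => ang (e s)).

(** [e] is the lift of [eta] on [0, L) by [log_proj] starting at [(r, a)]. *)
Definition is_log_lift {z0 : C} (L : Rbar) (eta : R -> C) (r a : R)
  (e : R -> log_surface z0) : Prop :=
  log_continuous L e /\
  (forall s, half_open L s -> log_proj (e s) = eta s) /\
  rad (e 0) = r /\ ang (e 0) = a.

(** Flow-line of a field [h] on the preimage of the upper half-plane.  The
    projection restricts to charts of the surface, so smoothness and velocity
    of a continuous curve are those of its projection. *)
Definition log_flow_line {z0 : C} (h : log_surface z0 -> R) (L : Rbar)
  (e : R -> log_surface z0) : Prop :=
  log_continuous L e /\
  C1_arclength L (fun s => log_proj (e s)) /\
  forall s, 0 < s -> Rbar_lt s L ->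
    0 < Im (log_proj (e s)) /\
    is_derive (V := C_R_NormedModule) (fun s => log_proj (e s)) s
      (cis (h (e s))).

(** [arg(z - z0)] is the single-valued angular coordinate. *)
Definition field_interior (rho : R) {z0 : C} (p : log_surface z0) : R :=
  PI - argH (log_proj p)
  - rho / 4 * (ang p + argH (log_proj p - Cconj z0)%C).

(* Main.v *)
Require Import Defs.
From Stdlib Require Import Reals Lra Lia Arith ClassicalEpsilon.
From Coquelicot Require Import Coquelicot.
Open Scope R_scope.

(** For [x = g_t^(-1)(W_t + i y)] the centered flow [U_s = g_s(x) - W_s]
    satisfies [U' = 2 / U - W'], starts at [x] and ends at [i y].  Two such
    flows [U], [V] are compared through their squares:
    [(V^2 - U^2)' = - (2 W' / (U + V)) (V^2 - U^2)], so that the gap between the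
    squares of the starting points is the gap at the final time multiplied by
    the exponential of the integral of [2 W' / (U + V)].  A flow leaves the tip
    at least like a square root, [Im U_s >= c sqrt (t - s)]
    ([tip_flow_Im_lower]); such integrals therefore converge uniformly as [y]
    decreases to 0 ([flow_integral_modulus]), and in the limit
    [(gamma^2)' = - 4 exp(E(t))], where [E(t)] is the limit of the integral of
    [W' / U] over [[0, t]] ([tip_square_derivative]).  Since [gamma] lies in the
    upper half-plane, it is strictly differentiable with respect to [sqrt t], up
    to time 0, with a nonzero velocity of argument [pi - arg(gamma) + Im E]
    ([tip_sqrt_derivative], [tip_speed_direction]).  Strict differentiability
    makes the arc-length comparable to [sqrt t] and passes to the arc-length
    parametrization ([arc_length_strict_derivative]).

    The special form of [W'] is only used to compute [Im E].  With
    [Z_s = z_s - W_s] one has [W' = - Re(rho / Z)], hence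
    [W' / U = (rho / 4) (- 2 / (Z U) - 2 / (conj(Z) U))], and [- 2 / (Z U)] is
    the logarithmic derivative of [U - Z = g_s(x) - z_s]; the same holds for the
    conjugate of [Z].  So [Im E] is [rho / 4] times the sum of the increments over
    [[0, t]] of the arguments of [g_s(x) - z_s] and of [g_s(x) - conj(z_s)].  Both
    start from the arguments of [gamma - z0] and [gamma - conj(z0)] that occur in
    the field.  At time [t] they are the arguments of [W_t - z_t] and of its
    conjugate, which cancel when [z0] is an interior point, and are both 0 or both
    [pi] when [z0] is real.  For an interior point the increment of the argument
    of [g_s(x) - z_s] also provides the lift to the logarithmic surface
    ([tip_angle_spec]). *)

(** * Complex-valued functions of a real variable *)

(** Turns the abstract operations of normed modules into those of [R]. *)
Ltac hsimpl :=
  do 3 (unfold minus, plus, opp, scal, mult, one, zero; simpl);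
  match goal with |- ?a = ?b => change (@eq R a b) end.

(** Closes an identity between real components of complex expressions. *)
Ltac cring :=
  unfold cis, RtoC, Re, Im; hsimpl; unfold Re, Im; ring.

(** Complex exponential. *)
Definition cexp (w : C) : C := (exp (Re w) * cis (Im w))%C.

Lemma cexp_plus (a b : C) : cexp (a + b) = (cexp a * cexp b)%C.
Proof.
destruct a as [a1 a2], b as [b1 b2].
unfold cexp, cis, Cmult, RtoC; simpl.
rewrite exp_plus, cos_plus, sin_plus.
apply f_equal2; ring.
Qed.

Lemma cexp_0 : cexp 0 = 1.
Proof.
unfold cexp, cis, Cmult, RtoC; simpl.
rewrite exp_0, cos_0, sin_0.
apply f_equal2; ring.
Qed.

Lemma Cmod_cis (a : R) : Cmod (cis a) = 1.
Proof.
unfold Cmod, cis; simpl.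
replace (cos a * (cos a * 1) + sin a * (sin a * 1)) with 1.
- apply sqrt_1.
- generalize (sin2_cos2 a); unfold Rsqr; lra.
Qed.

Lemma Cmod_cexp (w : C) : Cmod (cexp w) = exp (Re w).
Proof.
unfold cexp.
rewrite Cmod_mult, Cmod_cis, Cmod_R, Rabs_pos_eq.
- ring.
- left; apply exp_pos.
Qed.

Lemma cexp_neq_0 (w : C) : cexp w <> 0.
Proof.
intros E; apply (Rlt_not_eq 0 (Cmod (cexp w))).
- rewrite Cmod_cexp; apply exp_pos.
- rewrite E, Cmod_0; reflexivity.
Qed.

Lemma Cmod_cexp_le (w : C) (K : R) : Cmod w <= K -> Cmod (cexp w) <= exp K.
Proof.
intros H; rewrite Cmod_cexp.
assert (Re w <= K).
{ apply Rle_trans with (2 := H).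
  apply Rle_trans with (2 := re_le_Cmod w), Rle_abs. }
destruct (Rle_lt_or_eq_dec _ _ H0) as [H1|H1].
- left; now apply exp_increasing.
- rewrite H1; lra.
Qed.

Lemma im_le_Cmod (w : C) : Rabs (Im w) <= Cmod w.
Proof. apply Rle_trans with (2 := Rmax_Cmod w), Rmax_r. Qed.

Lemma Im_le_Cmod (w : C) : Im w <= Cmod w.
Proof. apply Rle_trans with (2 := im_le_Cmod w), Rle_abs. Qed.

Lemma Re_le_Cmod (w : C) : Re w <= Cmod w.
Proof. apply Rle_trans with (2 := re_le_Cmod w), Rle_abs. Qed.

Lemma Im_pos_neq_0 (w : C) : 0 < Im w -> w <> 0.
Proof. intros H E; rewrite E in H; simpl in H; lra. Qed.

Lemma imaginary_pair (y : R) : (0, y) = (Ci * RtoC y)%C.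
Proof. unfold Ci, Cmult, RtoC; simpl; apply f_equal2; ring. Qed.

Lemma Cmod_le_components (w : C) (e : R) :
  Rabs (Re w) <= e -> Rabs (Im w) <= e -> Cmod w <= 2 * e.
Proof.
intros H1 H2.
replace w with (RtoC (Re w) + Ci * RtoC (Im w))%C.
- apply Rle_trans with (1 := Cmod_triangle _ _).
  rewrite Cmod_mult, Cmod_Ci, !Cmod_R; lra.
- destruct w; unfold Ci, Cplus, Cmult, RtoC; simpl.
  apply f_equal2; ring.
Qed.

Lemma Cmod_minus_sym (a b : C) : Cmod (a - b) = Cmod (b - a).
Proof. rewrite <- Cmod_opp; apply f_equal; ring. Qed.

Lemma Cmod_minus_triangle (a b c : C) :
  Cmod (a - c) <= Cmod (a - b) + Cmod (b - c).
Proof.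
replace (a - c)%C with ((a - b) + (b - c))%C by ring.
apply Cmod_triangle.
Qed.

(** Both components are continuous on the whole line. *)
Definition Ccontinuity (f : R -> C) : Prop :=
  continuity (fun s => Re (f s)) /\ continuity (fun s => Im (f s)).

(** Derivative taken on both components. *)
Definition is_Cderive (f : R -> C) (t : R) (l : C) : Prop :=
  is_derive (fun s => Re (f s)) t (Re l) /\
  is_derive (fun s => Im (f s)) t (Im l).

Lemma continuity_ext (f g : R -> R) :
  (forall s, f s = g s) -> continuity f -> continuity g.
Proof.
intros E H s.
apply continuity_pt_ext with (f := f); auto.
Qed.

Lemma continuity_cst (c : R) : continuity (fun _ => c).
Proof. apply continuity_const; intros x y; reflexivity. Qed.

Lemma Ccontinuity_const (c : C) : Ccontinuity (fun _ => c).
Proof. split; apply continuity_cst. Qed.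

Lemma Ccontinuity_plus (f g : R -> C) :
  Ccontinuity f -> Ccontinuity g -> Ccontinuity (fun s => (f s + g s)%C).
Proof.
intros [F1 F2] [G1 G2]; split;
  [apply (continuity_plus _ _ F1 G1) | apply (continuity_plus _ _ F2 G2)].
Qed.

Lemma Ccontinuity_opp (f : R -> C) :
  Ccontinuity f -> Ccontinuity (fun s => (- f s)%C).
Proof.
intros [F1 F2]; split;
  [apply (continuity_opp _ F1) | apply (continuity_opp _ F2)].
Qed.

Lemma Ccontinuity_minus (f g : R -> C) :
  Ccontinuity f -> Ccontinuity g -> Ccontinuity (fun s => (f s - g s)%C).
Proof.
intros F G; apply Ccontinuity_plus; [exact F | now apply Ccontinuity_opp].
Qed.

Lemma Ccontinuity_mult (f g : R -> C) :
  Ccontinuity f -> Ccontinuity g -> Ccontinuity (fun s => (f s * g s)%C).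
Proof.
intros [F1 F2] [G1 G2]; split.
- apply (continuity_minus _ _ (continuity_mult _ _ F1 G1)
           (continuity_mult _ _ F2 G2)).
- apply (continuity_plus _ _ (continuity_mult _ _ F1 G2)
           (continuity_mult _ _ F2 G1)).
Qed.

Lemma Ccontinuity_RtoC (f : R -> R) :
  continuity f -> Ccontinuity (fun s => RtoC (f s)).
Proof. intros F; split; [exact F | apply (continuity_cst 0)]. Qed.

Lemma Ccontinuity_conj (f : R -> C) :
  Ccontinuity f -> Ccontinuity (fun s => Cconj (f s)).
Proof. intros [F1 F2]; split; [exact F1 | apply (continuity_opp _ F2)]. Qed.

Lemma Cnorm2_neq_0 (w : C) : w <> 0 -> Re w ^ 2 + Im w ^ 2 <> 0.
Proof.
intros H; rewrite <- Cmod2_alt.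
apply pow_nonzero.
apply Cmod_gt_0 in H; lra.
Qed.

Lemma Ccontinuity_inv (f : R -> C) :
  Ccontinuity f -> (forall s, f s <> 0) -> Ccontinuity (fun s => (/ f s)%C).
Proof.
intros [F1 F2] N.
assert (D : continuity (fun s => Re (f s) ^ 2 + Im (f s) ^ 2)).
{ apply continuity_ext with
    (f := (fun s => Re (f s) * Re (f s) + Im (f s) * Im (f s))).
  - intros s; ring.
  - apply (continuity_plus _ _ (continuity_mult _ _ F1 F1)
             (continuity_mult _ _ F2 F2)). }
split.
- apply (continuity_div _ _ F1 D).
  intros s; now apply Cnorm2_neq_0.
- apply (continuity_div _ _ (continuity_opp _ F2) D).
  intros s; now apply Cnorm2_neq_0.
Qed.

Lemma Ccontinuity_div (f g : R -> C) :
  Ccontinuity f -> Ccontinuity g -> (forall s, g s <> 0) ->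
  Ccontinuity (fun s => (f s / g s)%C).
Proof.
intros F G N; apply Ccontinuity_mult; [exact F | now apply Ccontinuity_inv].
Qed.

Lemma Ccontinuity_cexp (f : R -> C) :
  Ccontinuity f -> Ccontinuity (fun s => cexp (f s)).
Proof.
intros [F1 F2]; unfold cexp; apply Ccontinuity_mult.
- apply Ccontinuity_RtoC.
  apply (continuity_comp _ exp F1).
  apply derivable_continuous, derivable_exp.
- split.
  + apply (continuity_comp _ cos F2), continuity_cos.
  + apply (continuity_comp _ sin F2), continuity_sin.
Qed.

Lemma is_Cderive_const (c : C) (t : R) : is_Cderive (fun _ => c) t 0.
Proof.
split; [apply (is_derive_const (V := R_NormedModule) (Re c))
       | apply (is_derive_const (V := R_NormedModule) (Im c))].
Qed.

Lemma is_Cderive_plus (f g : R -> C) (t : R) (a b : C) :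
  is_Cderive f t a -> is_Cderive g t b ->
  is_Cderive (fun s => (f s + g s)%C) t (a + b).
Proof.
intros [F1 F2] [G1 G2]; split;
  [apply (is_derive_plus _ _ _ _ _ F1 G1)
  | apply (is_derive_plus _ _ _ _ _ F2 G2)].
Qed.

Lemma is_Cderive_opp (f : R -> C) (t : R) (a : C) :
  is_Cderive f t a -> is_Cderive (fun s => (- f s)%C) t (- a).
Proof.
intros [F1 F2]; split;
  [apply (is_derive_opp _ _ _ F1) | apply (is_derive_opp _ _ _ F2)].
Qed.

Lemma is_Cderive_minus (f g : R -> C) (t : R) (a b : C) :
  is_Cderive f t a -> is_Cderive g t b ->
  is_Cderive (fun s => (f s - g s)%C) t (a - b).
Proof.
intros F G; apply is_Cderive_plus; [exact F | now apply is_Cderive_opp].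
Qed.

Lemma is_Cderive_conj (f : R -> C) (t : R) (a : C) :
  is_Cderive f t a -> is_Cderive (fun s => Cconj (f s)) t (Cconj a).
Proof. intros [F1 F2]; split; [exact F1 | apply (is_derive_opp _ _ _ F2)]. Qed.

Lemma is_derive_Rmult (f g : R -> R) (t a b : R) :
  is_derive f t a -> is_derive g t b ->
  is_derive (fun s => f s * g s) t (a * g t + f t * b).
Proof.
intros F G; apply (is_derive_mult f g t a b F G).
intros n m; apply Rmult_comm.
Qed.

Lemma is_Cderive_mult (f g : R -> C) (t : R) (a b : C) :
  is_Cderive f t a -> is_Cderive g t b ->
  is_Cderive (fun s => (f s * g s)%C) t (a * g t + f t * b).
Proof.
intros [F1 F2] [G1 G2]; split.
- evar_last.
  + apply (is_derive_minus _ _ _ _ _ (is_derive_Rmult _ _ _ _ _ F1 G1)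
             (is_derive_Rmult _ _ _ _ _ F2 G2)).
  + cring.
- evar_last.
  + apply (is_derive_plus _ _ _ _ _ (is_derive_Rmult _ _ _ _ _ F1 G2)
             (is_derive_Rmult _ _ _ _ _ F2 G1)).
  + cring.
Qed.

Lemma is_Cderive_cexp (f : R -> C) (t : R) (a : C) :
  is_Cderive f t a ->
  is_Cderive (fun s => cexp (f s)) t (a * cexp (f t)).
Proof.
intros [F1 F2].
assert (HE : is_derive (fun s => exp (Re (f s))) t (Re a * exp (Re (f t)))).
{ apply (is_derive_comp exp (fun s => Re (f s)) t); [apply is_derive_exp|exact F1]. }
assert (HC : is_derive (fun s => cos (Im (f s))) t (Im a * - sin (Im (f t)))).
{ apply (is_derive_comp cos (fun s => Im (f s)) t); [apply is_derive_cos|exact F2]. }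
assert (HS : is_derive (fun s => sin (Im (f s))) t (Im a * cos (Im (f t)))).
{ apply (is_derive_comp sin (fun s => Im (f s)) t); [apply is_derive_sin|exact F2]. }
split.
- apply is_derive_ext with
    (f := fun s => exp (Re (f s)) * cos (Im (f s))).
  { intros s; unfold cexp; cring. }
  evar_last; [apply (is_derive_Rmult _ _ _ _ _ HE HC) | unfold cexp; cring].
- apply is_derive_ext with
    (f := fun s => exp (Re (f s)) * sin (Im (f s))).
  { intros s; unfold cexp; cring. }
  evar_last; [apply (is_derive_Rmult _ _ _ _ _ HE HS) | unfold cexp; cring].
Qed.

Lemma is_Cderive_eq (f : R -> C) (t : R) (a b : C) :
  a = b -> is_Cderive f t a -> is_Cderive f t b.
Proof. intros ->; trivial. Qed.

Lemma is_Cderive_ext_loc (f g : R -> C) (t : R) (a : C) :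
  locally t (fun s => f s = g s) -> is_Cderive f t a -> is_Cderive g t a.
Proof.
intros E [F1 F2]; split.
- apply is_derive_ext_loc with (2 := F1).
  apply filter_imp with (2 := E); intros s ->; reflexivity.
- apply is_derive_ext_loc with (2 := F2).
  apply filter_imp with (2 := E); intros s ->; reflexivity.
Qed.

(** * Mean value inequalities *)

Lemma increasing_of_derive (f df : R -> R) (a b : R) :
  a <= b -> continuity f ->
  (forall s, a < s < b -> is_derive f s (df s)) ->
  (forall s, a < s < b -> 0 <= df s) ->
  f a <= f b.
Proof.
intros Hab Hc Hd Hp.
(* The mean value point may be an end point, where [df] is unconstrained. *)
destruct (MVT_gen f a b
  (fun s => if Rlt_dec a s then if Rlt_dec s b then df s else 0 else 0))
  as [c [_ Hc']].
- rewrite Rmin_left, Rmax_right by lra; intros s [H1 H2].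
  destruct (Rlt_dec a s); [|lra].
  destruct (Rlt_dec s b); [|lra].
  now apply Hd.
- intros s _; apply Hc.
- assert (0 <= (if Rlt_dec a c then if Rlt_dec c b then df c else 0 else 0)).
  { destruct (Rlt_dec a c); [|lra].
    destruct (Rlt_dec c b); [|lra].
    apply Hp; lra. }
  nra.
Qed.

(** Mean value inequality with a variable bound on the derivative. *)
Lemma Cmod_mean_value (f f' : R -> C) (g g' : R -> R) (a b : R) :
  a <= b -> Ccontinuity f -> continuity g ->
  (forall s, a < s < b -> is_Cderive f s (f' s)) ->
  (forall s, a < s < b -> is_derive g s (g' s)) ->
  (forall s, a < s < b -> Cmod (f' s) <= g' s) ->
  Cmod (f b - f a) <= g b - g a.
Proof.
intros Hab [Fc1 Fc2] Gc Fd Gd H.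
destruct (Req_dec (Cmod (f b - f a)) 0) as [E|N].
{ rewrite E.
  enough (g a <= g b) by lra.
  apply increasing_of_derive with (df := g'); auto.
  intros s Hs; apply Rle_trans with (2 := H s Hs), Cmod_ge_0. }
set (w := (f b - f a)%C) in *.
assert (P : 0 < Cmod w) by (generalize (Cmod_ge_0 w); lra).
(* Project onto the direction of [w]. *)
assert (K : Cmod w * g a - (Re w * Re (f a) + Im w * Im (f a))
         <= Cmod w * g b - (Re w * Re (f b) + Im w * Im (f b))).
{ apply increasing_of_derive with
    (f := fun s => Cmod w * g s - (Re w * Re (f s) + Im w * Im (f s)))
    (df := fun s => Cmod w * g' s - (Re w * Re (f' s) + Im w * Im (f' s))); auto.
  - apply (continuity_minus _ _ (continuity_scal _ (Cmod w) Gc)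
             (continuity_plus _ _ (continuity_scal _ (Re w) Fc1)
                (continuity_scal _ (Im w) Fc2))).
  - intros s Hs.
    destruct (Fd s Hs) as [D1 D2].
    apply (is_derive_minus (V := R_NormedModule)).
    + apply (is_derive_scal g s (Cmod w) (g' s)), Gd, Hs.
    + apply (is_derive_plus (V := R_NormedModule));
        [ apply (is_derive_scal (fun s => Re (f s))), D1
        | apply (is_derive_scal (fun s => Im (f s))), D2 ].
  - intros s Hs.
    assert (Re w * Re (f' s) + Im w * Im (f' s) <= Cmod w * Cmod (f' s)).
    { rewrite <- (Cmod_conj w), <- Cmod_mult.
      apply Rle_trans with (2 := Re_le_Cmod _).
      simpl; unfold Re, Im; lra. }
    specialize (H s Hs); nra. }
assert (E : Re w * (Re (f b) - Re (f a)) + Im w * (Im (f b) - Im (f a))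
            = Cmod w * Cmod w).
{ transitivity (Cmod w ^ 2); [rewrite Cmod2_alt; unfold w; cring|ring]. }
nra.
Qed.

Lemma Ccontinuity_antiderivative (f : R -> C) :
  Ccontinuity f ->
  exists F : R -> C,
    F 0 = 0 /\ Ccontinuity F /\ forall s, is_Cderive F s (f s).
Proof.
assert (H : forall g : R -> R, continuity g ->
  RInt g 0 0 = 0 /\ forall s, is_derive (RInt g 0) s (g s)).
{ intros g G; split; [exact (RInt_point (V := R_CompleteNormedModule) 0 g)|].
  assert (G' : forall s, continuous g s)
    by (intros s; apply continuity_pt_filterlim, G).
  intros s; apply is_derive_RInt with (a := 0); [|apply G'].
  apply filter_forall; intros b.
  apply RInt_correct, (ex_RInt_continuous (V := R_CompleteNormedModule)).
  intros; apply G'. }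
intros [F1 F2].
destruct (H _ F1) as [I1 D1], (H _ F2) as [I2 D2].
exists (fun s => (RInt (fun s => Re (f s)) 0 s, RInt (fun s => Im (f s)) 0 s)).
split; [now rewrite I1, I2 | split; split].
- intros s; apply continuity_pt_filterlim.
  apply (ex_derive_continuous (V := R_NormedModule)); eexists; apply D1.
- intros s; apply continuity_pt_filterlim.
  apply (ex_derive_continuous (V := R_NormedModule)); eexists; apply D2.
- apply D1.
- apply D2.
Qed.

Lemma Cconstant_of_derive (f : R -> C) (a b : R) :
  a <= b -> Ccontinuity f ->
  (forall s, a < s < b -> is_Cderive f s 0) -> f b = f a.
Proof.
intros Hab Hc Hd.
assert (H : Cmod (f b - f a) <= 0 - 0).
{ apply Cmod_mean_value with (f' := fun _ => RtoC 0) (g := fun _ => 0)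
    (g' := fun _ => 0); auto using continuity_cst.
  - intros s _; apply (is_derive_const (V := R_NormedModule) 0).
  - intros s _; rewrite Cmod_0; lra. }
assert (E : (f b - f a)%C = 0).
{ apply Cmod_eq_0; generalize (Cmod_ge_0 (f b - f a)); lra. }
replace (f b) with ((f b - f a) + f a)%C by ring.
rewrite E; ring.
Qed.

(** * Restriction to a compact interval *)

(** The retraction of the line onto [[0, t]]. *)
Definition clamp (t s : R) : R := Rmax 0 (Rmin t s).

Lemma clamp_bounds (t s : R) : 0 <= t -> 0 <= clamp t s <= t.
Proof.
intros H; unfold clamp, Rmax, Rmin.
repeat (destruct Rle_dec); lra.
Qed.

Lemma clamp_id (t s : R) : 0 <= s <= t -> clamp t s = s.
Proof.
intros H; unfold clamp, Rmax, Rmin.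
repeat (destruct Rle_dec); lra.
Qed.

Lemma clamp_lipschitz (t a b : R) : Rabs (clamp t b - clamp t a) <= Rabs (b - a).
Proof.
unfold clamp, Rmax, Rmin, Rabs.
repeat (destruct Rle_dec); repeat (destruct Rcase_abs); lra.
Qed.

Lemma clamp_continuity (t : R) : continuity (clamp t).
Proof.
intros s e He; exists e; split; [exact He|].
intros r [_ Hr]; apply Rle_lt_trans with (2 := Hr), clamp_lipschitz.
Qed.

Lemma clamp_near (t s : R) : 0 < s < t -> locally s (fun r => clamp t r = r).
Proof.
intros [H1 H2].
apply filter_imp with (fun r => 0 < r /\ r < t).
- intros r [R1 R2]; apply clamp_id; lra.
- apply filter_and; [now apply (open_gt 0) | now apply (open_lt t)].
Qed.

Lemma Cmod_cexp_minus_1 (w : C) : Cmod w <= 1 -> Cmod (cexp w - 1) <= 3 * Cmod w.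
Proof.
intros Hw.
assert (D : forall s, is_Cderive (fun s => RtoC s * w)%C s w).
{ intros s.
  apply is_Cderive_eq with (1 * w + RtoC s * 0)%C; [ring|].
  apply is_Cderive_mult; [|apply is_Cderive_const].
  split; [apply (is_derive_id (K := R_AbsRing))
         | apply (is_derive_const (V := R_NormedModule) 0)]. }
replace (cexp w - 1)%C with (cexp (RtoC 1 * w) - cexp (RtoC 0 * w))%C.
2:{ rewrite Cmult_1_l, Cmult_0_l, cexp_0; reflexivity. }
replace (3 * Cmod w) with (3 * Cmod w * 1 - 3 * Cmod w * 0) by ring.
apply Cmod_mean_value with (f := fun s => cexp (RtoC s * w))
  (f' := fun s => (w * cexp (RtoC s * w))%C)
  (g := fun s => 3 * Cmod w * s) (g' := fun _ => 3 * Cmod w); try lra.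
- apply Ccontinuity_cexp, Ccontinuity_mult; [|apply Ccontinuity_const].
  apply Ccontinuity_RtoC, derivable_continuous, derivable_id.
- apply (continuity_scal (fun s => s)), derivable_continuous, derivable_id.
- intros s _; apply is_Cderive_cexp, D.
- intros s _; auto_derive; [trivial|ring].
- intros s Hs; rewrite Cmod_mult, Rmult_comm.
  apply Rmult_le_compat_r; [apply Cmod_ge_0|].
  apply Rle_trans with (2 := exp_le_3), Cmod_cexp_le.
  rewrite Cmod_mult, Cmod_R, Rabs_pos_eq by lra.
  generalize (Cmod_ge_0 w); nra.
Qed.

(** One [d] makes both a linear and a square root error small. *)
Lemma exists_small (A e : R) : 0 < e ->
  exists d, 0 < d <= 1 /\ A * d <= e /\ A * sqrt d <= e.
Proof.
intros He.
set (q := Rmin 1 (e / (Rabs A + 1))).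
assert (PA := Rabs_pos A).
assert (Hq : 0 < q <= 1).
{ split; [apply Rmin_pos; [lra | apply Rdiv_lt_0_compat; lra] | apply Rmin_l]. }
assert (Hb : A * q <= e).
{ apply Rle_trans with ((Rabs A + 1) * q).
  - generalize (Rle_abs A); nra.
  - apply Rle_trans with ((Rabs A + 1) * (e / (Rabs A + 1))).
    + apply Rmult_le_compat_l; [lra | apply Rmin_r].
    + right; field; lra. }
exists (q * q); rewrite sqrt_square by lra.
assert (A * (q * q) <= e) by (destruct (Rle_lt_dec 0 A); nra).
repeat split; nra.
Qed.

Lemma continuity_bounded (f : R -> R) (T : R) : 0 <= T -> continuity f ->
  exists M, 0 < M /\ forall s, 0 <= s <= T -> Rabs (f s) <= M.
Proof.
intros HT Hc.
destruct (continuity_ab_maj f 0 T HT ltac:(intros; apply Hc)) as (a & Ha & _).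
destruct (continuity_ab_min f 0 T HT ltac:(intros; apply Hc)) as (b & Hb & _).
exists (Rabs (f a) + Rabs (f b) + 1); split.
- generalize (Rabs_pos (f a)), (Rabs_pos (f b)); lra.
- intros s Hs; apply Rabs_le.
  specialize (Ha s Hs); specialize (Hb s Hs).
  generalize (Rle_abs (f a)), (Rle_abs (- f b)), (Rabs_pos (f a)), (Rabs_pos (f b)).
  rewrite Rabs_Ropp; lra.
Qed.

Lemma Ccontinuity_bounded (f : R -> C) (T : R) : 0 <= T -> Ccontinuity f ->
  exists M, 0 < M /\ forall s, 0 <= s <= T -> Cmod (f s) <= M.
Proof.
intros HT [F1 F2].
destruct (continuity_bounded _ T HT F1) as (a & Pa & Ha).
destruct (continuity_bounded _ T HT F2) as (b & Pb & Hb).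
exists (2 * (a + b)); split; [lra|]; intros s Hs.
specialize (Ha s Hs); specialize (Hb s Hs).
apply Cmod_le_components; lra.
Qed.

(** Choice over the elements that satisfy [P]. *)
Lemma choice_on {A B : Type} (P : A -> Prop) (Q : A -> B -> Prop) (b : B) :
  (forall x, P x -> exists y, Q x y) -> exists f, forall x, P x -> Q x (f x).
Proof.
intros H.
assert (H' : forall x, { y | P x -> Q x y }).
{ intros x; apply constructive_indefinite_description.
  destruct (excluded_middle_informative (P x)) as [p|n].
  - destruct (H x p) as [y Hy]; exists y; auto.
  - exists b; intros; contradiction. }
exists (fun x => proj1_sig (H' x)); intros x; exact (proj2_sig (H' x)).
Qed.

(** * Solutions of the Loewner equation *)

Lemma Re_two_div (w : C) : w <> 0 ->
  Re (2 / w)%C = 2 * Re w / (Re w ^ 2 + Im w ^ 2).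
Proof.
intros H; apply Cnorm2_neq_0 in H.
destruct w as [a b]; unfold Cdiv, Cmult, Cinv, RtoC, Re, Im in *; simpl in *.
field; lra.
Qed.

Lemma Im_two_div (w : C) : w <> 0 ->
  Im (2 / w)%C = - 2 * Im w / (Re w ^ 2 + Im w ^ 2).
Proof.
intros H; apply Cnorm2_neq_0 in H.
destruct w as [a b]; unfold Cdiv, Cmult, Cinv, RtoC, Re, Im in *; simpl in *.
field; lra.
Qed.

(** [Z s = g_s(x) - W_s] on [[0, T]], where [W' = k]; outside of [[0, T]] only
    continuity and [Z s <> 0] matter. *)
Definition centered_flow (k : R -> R) (T : R) (Z : R -> C) : Prop :=
  Ccontinuity Z /\ (forall s, Z s <> 0) /\
  forall s, 0 < s < T -> is_Cderive Z s (2 / Z s - k s)%C.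

Section Centered.

Context (k : R -> R) (T : R) (Z : R -> C) (HZ : centered_flow k T Z).

Lemma centered_flow_Im_derive (s : R) : 0 < s < T ->
  is_derive (fun r => Im (Z r)) s
    (- 2 * Im (Z s) / (Re (Z s) ^ 2 + Im (Z s) ^ 2)).
Proof.
intros Hs; destruct HZ as (_ & N & D).
rewrite <- Im_two_div by apply N.
evar_last; [exact (proj2 (D s Hs))|].
unfold Cminus, Cplus, Copp, RtoC, Im; hsimpl; ring.
Qed.

Lemma centered_flow_conj : centered_flow k T (fun s => Cconj (Z s)).
Proof.
destruct HZ as (Zc & N & D); split; [now apply Ccontinuity_conj | split].
- intros s E; apply (N s).
  rewrite <- (Cconj_conj (Z s)), E; unfold Cconj, RtoC; simpl; apply f_equal2; ring.
- intros s Hs.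
  apply is_Cderive_eq with (Cconj (2 / Z s - k s)%C).
  + rewrite Cminus_conj, Cdiv_conj by apply N.
    unfold Cconj at 1 3, RtoC; simpl; rewrite !Ropp_0; reflexivity.
  + apply is_Cderive_conj, D, Hs.
Qed.

Lemma centered_flow_norm2_pos (s : R) : 0 < Re (Z s) ^ 2 + Im (Z s) ^ 2.
Proof.
destruct HZ as (_ & N & _).
rewrite <- Cmod2_alt; apply pow_lt, Cmod_gt_0, N.
Qed.

Lemma centered_flow_Im2_decreasing (a b : R) : 0 <= a -> a <= b -> b <= T ->
  Im (Z b) ^ 2 <= Im (Z a) ^ 2.
Proof.
intros Ha Hab Hb; apply Ropp_le_cancel.
destruct HZ as ([_ C2] & _ & _).
replace (Im (Z a) ^ 2) with (Im (Z a) * Im (Z a)) by ring.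
replace (Im (Z b) ^ 2) with (Im (Z b) * Im (Z b)) by ring.
apply increasing_of_derive with (f := fun s => - (Im (Z s) * Im (Z s)))
  (df := fun s => 4 * (Im (Z s) ^ 2 * / (Re (Z s) ^ 2 + Im (Z s) ^ 2))); auto.
- apply (continuity_opp _ (continuity_mult _ _ C2 C2)).
- intros s Hs.
  assert (D := centered_flow_Im_derive s ltac:(lra)).
  evar_last.
  + apply (is_derive_opp (V := R_NormedModule)), (is_derive_Rmult _ _ _ _ _ D D).
  + hsimpl; field; generalize (centered_flow_norm2_pos s); simpl; lra.
- intros s _; apply Rmult_le_pos; [lra|].
  apply Rmult_le_pos; [apply pow2_ge_0|].
  left; apply Rinv_0_lt_compat, centered_flow_norm2_pos.
Qed.

Lemma centered_flow_real (t : R) : 0 <= t <= T -> Im (Z 0) = 0 -> Im (Z t) = 0.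
Proof.
intros Ht E.
assert (H := centered_flow_Im2_decreasing 0 t ltac:(lra) ltac:(lra) ltac:(lra)).
rewrite E in H; nra.
Qed.

(** A flow that ends in the upper half-plane was always there: backward in time
    [Im Z] cannot vanish, because its square increases. *)
Lemma centered_flow_Im_backward (s : R) : 0 <= s <= T -> 0 < Im (Z T) -> 0 < Im (Z s).
Proof.
intros Hs P; apply Rnot_le_lt; intros N.
destruct (IVT_gen (fun s => Im (Z s)) s T 0 (proj2 (proj1 HZ))) as (r & Hr & E).
- rewrite Rmin_left, Rmax_right; lra.
- rewrite Rmin_left, Rmax_right in Hr by lra.
  assert (H := centered_flow_Im2_decreasing r T ltac:(lra) ltac:(lra) ltac:(lra)).
  rewrite E in H; nra.
Qed.

(** On a compact interval [Z] stays away from 0, so that [Im Z] decays at most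
    exponentially. *)
Lemma centered_flow_Im_forward (t : R) : 0 <= t <= T -> 0 < Im (Z 0) -> 0 < Im (Z t).
Proof.
intros Ht P.
destruct HZ as (Zc & N & _).
destruct (Ccontinuity_bounded (fun s => / Z s)%C T ltac:(lra)
  (Ccontinuity_inv Z Zc N)) as (K & PK & HK).
assert (Key : forall r, 0 <= r <= T -> 0 < Im (Z r) ^ 2).
{ intros r Hr.
  assert (H : Im (Z 0) * Im (Z 0) * exp (4 * (K * K) * 0) <=
    Im (Z r) * Im (Z r) * exp (4 * (K * K) * r)).
  { assert (De : forall s, is_derive (fun s => exp (4 * (K * K) * s)) s
      (4 * (K * K) * exp (4 * (K * K) * s)))
      by (intros s; auto_derive; [trivial | ring]).
    apply increasing_of_derive with
      (f := fun s => Im (Z s) * Im (Z s) * exp (4 * (K * K) * s))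
      (df := fun s => 4 * (Im (Z s) ^ 2 * exp (4 * (K * K) * s)) *
         (K * K - / (Re (Z s) ^ 2 + Im (Z s) ^ 2))); [lra | | |].
    - apply (continuity_mult _ (fun s => exp (4 * (K * K) * s))
        (continuity_mult _ _ (proj2 Zc) (proj2 Zc))).
      intros s; apply (proj2 (continuity_pt_filterlim (fun s => exp (4 * (K * K) * s)) s)).
      apply (ex_derive_continuous (V := R_NormedModule)
        (fun s => exp (4 * (K * K) * s)) s); eexists; apply De.
    - intros s Hs.
      assert (D := centered_flow_Im_derive s ltac:(lra)).
      evar_last.
      + apply (is_derive_Rmult _ _ _ _ _ (is_derive_Rmult _ _ _ _ _ D D) (De s)).
      + hsimpl; field; generalize (centered_flow_norm2_pos s); simpl; lra.
    - intros s Hs.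
      apply Rmult_le_pos.
      + apply Rmult_le_pos; [lra|].
        apply Rmult_le_pos; [apply pow2_ge_0 | left; apply exp_pos].
      + specialize (HK s ltac:(lra)).
        rewrite Cmod_inv in HK by apply N.
        rewrite <- Cmod2_alt.
        assert (Pz : 0 < Cmod (Z s)) by apply Cmod_gt_0, N.
        replace (/ Cmod (Z s) ^ 2) with (/ Cmod (Z s) * / Cmod (Z s))
          by (field; lra).
        assert (0 < / Cmod (Z s)) by now apply Rinv_0_lt_compat.
        nra. }
  rewrite Rmult_0_r, exp_0 in H.
  assert (Pe := exp_pos (4 * (K * K) * r)).
  destruct (Req_dec (Im (Z r)) 0) as [E|E]; [rewrite E in H; nra|].
  now apply pow2_gt_0. }
apply Rnot_le_lt; intros Q.
destruct (IVT_gen (fun s => Im (Z s)) 0 t 0 (proj2 Zc)) as (r & Hr & E).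
- rewrite Rmin_right, Rmax_left; lra.
- rewrite Rmin_left, Rmax_right in Hr by lra.
  specialize (Key r ltac:(lra)); rewrite E in Key; lra.
Qed.

Lemma centered_flow_real_sign (t : R) : 0 <= t <= T -> Im (Z 0) = 0 ->
  (0 < Re (Z 0) <-> 0 < Re (Z t)).
Proof.
intros Ht E0.
destruct HZ as ([C1 C2] & N & _).
assert (Nz : forall r, 0 <= r <= T -> Re (Z r) <> 0).
{ intros r Hr E; apply (N r).
  assert (Er := centered_flow_real r Hr E0).
  destruct (Z r) as [a b]; unfold Re, Im in *; simpl in *; rewrite E, Er; reflexivity. }
assert (Key : forall a b, 0 <= a <= T -> 0 <= b <= T -> 0 < Re (Z a) -> 0 < Re (Z b)).
{ intros a b Ha Hb P; apply Rnot_le_lt; intros Q.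
  destruct (IVT_gen (fun s => Re (Z s)) a b 0 C1) as (r & Hr & E).
  - rewrite Rmin_right, Rmax_left; lra.
  - apply (Nz r); [|exact E].
    unfold Rmin, Rmax in Hr; destruct (Rle_dec a b); lra. }
split; apply Key; lra.
Qed.

End Centered.

(** * Flows seen from the tip *)

(** [U s = g_s(x) - W_s] on [[0, t]], where [W' = k] and [g_t(x) = W_t + i y];
    outside of [[0, t]] only continuity and positivity matter. *)
Definition tip_flow (k : R -> R) (t y : R) (U : R -> C) : Prop :=
  Ccontinuity U /\ (forall s, 0 < Im (U s)) /\ U t = (0, y) /\
  forall s, 0 < s < t -> is_Cderive U s (2 / U s - k s)%C.

Section Tip.

Context (k : R -> R) (t y M : R) (U : R -> C).
Context (Hy : 0 < y).
Context (HU : tip_flow k t y U).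
Context (Hk : forall s, 0 <= s <= t -> Rabs (k s) <= M).

Lemma tip_flow_neq_0 (s : R) : U s <> 0.
Proof. apply Im_pos_neq_0, HU. Qed.

Lemma tip_flow_centered : centered_flow k t U.
Proof. split; [apply HU | split; [apply tip_flow_neq_0 | apply HU]]. Qed.

Lemma tip_flow_norm2_pos (s : R) : 0 < Re (U s) ^ 2 + Im (U s) ^ 2.
Proof. apply (centered_flow_norm2_pos _ _ _ tip_flow_centered). Qed.

Lemma tip_flow_Im_derive (s : R) : 0 < s < t ->
  is_derive (fun r => Im (U r)) s
    (- 2 * Im (U s) / (Re (U s) ^ 2 + Im (U s) ^ 2)).
Proof. apply (centered_flow_Im_derive _ _ _ tip_flow_centered). Qed.

Lemma tip_flow_Re_derive (s : R) : 0 < s < t ->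
  is_derive (fun r => Re (U r)) s
    (2 * Re (U s) / (Re (U s) ^ 2 + Im (U s) ^ 2) - k s).
Proof.
intros Hs; destruct HU as (_ & _ & _ & D).
rewrite <- Re_two_div by apply tip_flow_neq_0.
exact (proj1 (D s Hs)).
Qed.

Lemma tip_flow_Im_decreasing (r s : R) :
  0 <= r -> r <= s -> s <= t -> Im (U s) <= Im (U r).
Proof.
intros Hr Hrs Hst.
assert (H := centered_flow_Im2_decreasing _ _ _ tip_flow_centered r s Hr Hrs Hst).
assert (Pr : 0 < Im (U r)) by apply HU.
apply Rnot_lt_le; intros N; nra.
Qed.

(** The singular term [2 Re U / |U|^2] repels [Re U] from 0, so that backward in
    time [|Re U|] grows at most at speed [M].  The absolute value is smoothed into
    [sqrt ((Re U)^2 + e^2)]. *)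
Lemma tip_flow_Re_bound (s : R) : 0 <= s <= t -> Rabs (Re (U s)) <= M * (t - s).
Proof.
intros Hs.
apply le_epsilon; intros e He.
set (phi := fun r => sqrt (Re (U r) * Re (U r) + e * e)).
assert (Pos : forall r, 0 < Re (U r) * Re (U r) + e * e) by (intros; nra).
assert (Pp : forall r, 0 < phi r) by (intros; apply sqrt_lt_R0, Pos).
assert (Sq : forall r, phi r * phi r = Re (U r) * Re (U r) + e * e).
{ intros r; apply sqrt_sqrt; left; apply Pos. }
assert (Le : forall r, Rabs (Re (U r)) <= phi r).
{ intros r; rewrite <- sqrt_Rsqr_abs; apply sqrt_le_1_alt.
  unfold Rsqr; nra. }
assert (Hc : continuity (fun r => Re (U r))) by apply HU.
assert (K : phi s + M * s <= phi t + M * t).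
{ apply increasing_of_derive with (f := fun r => phi r + M * r)
    (df := fun r => (Re (U r) *
       (2 * Re (U r) / (Re (U r) ^ 2 + Im (U r) ^ 2) - k r)) / phi r + M);
    [lra | | |].
  - apply (continuity_plus phi (fun r => M * r)).
    + apply (continuity_comp (fun r => Re (U r) * Re (U r) + e * e) sqrt).
      * apply (continuity_plus _ _ (continuity_mult _ _ Hc Hc)
                 (continuity_cst (e * e))).
      * intros r; apply continuity_pt_filterlim, continuous_sqrt.
    + apply (continuity_scal (fun r => r) M), derivable_continuous, derivable_id.
  - intros r Hr.
    set (l := 2 * Re (U r) / (Re (U r) ^ 2 + Im (U r) ^ 2) - k r).
    assert (D : is_derive (fun r => Re (U r)) r l)
      by (apply tip_flow_Re_derive; lra).
    apply (is_derive_plus (V := R_NormedModule)).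
    + evar_last.
      * apply (is_derive_comp sqrt
          (fun r => Re (U r) * Re (U r) + e * e) r).
        -- apply is_derive_sqrt with (f := fun x => x) (df := 1).
           ++ apply (is_derive_id (K := R_AbsRing)).
           ++ apply Pos.
        -- apply (is_derive_plus (V := R_NormedModule)).
           ++ apply (is_derive_Rmult _ _ _ _ _ D D).
           ++ apply (is_derive_const (V := R_NormedModule) (e * e)).
      * fold (phi r); unfold scal, plus, zero; simpl; unfold mult; simpl.
        field; generalize (Pp r); lra.
    + evar_last; [apply (is_derive_scal (fun r => r) r M), (is_derive_id (K := R_AbsRing))|].
      hsimpl; ring.
  - intros r Hr.
    assert (Q : 0 <= Re (U r) * Re (U r) * / (Re (U r) ^ 2 + Im (U r) ^ 2)).
    { apply Rmult_le_pos; [nra|].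
      left; apply Rinv_0_lt_compat, tip_flow_norm2_pos. }
    assert (B : Rabs (Re (U r) * k r) <= phi r * M).
    { rewrite Rabs_mult; apply Rmult_le_compat; auto using Rabs_pos.
      apply Hk; lra. }
    assert (- (phi r * M) <= Re (U r) *
       (2 * Re (U r) / (Re (U r) ^ 2 + Im (U r) ^ 2) - k r)).
    { unfold Rdiv; generalize (Rle_abs (Re (U r) * k r)).
      set (i := / _) in *; nra. }
    apply Rmult_le_reg_r with (1 := Pp r).
    rewrite Rmult_0_l, Rmult_plus_distr_r.
    unfold Rdiv at 1; rewrite Rmult_assoc, Rinv_l by (generalize (Pp r); lra).
    lra. }
assert (E : phi t = e).
{ unfold phi; destruct HU as (_ & _ & -> & _); simpl.
  rewrite Rmult_0_l, Rplus_0_l; apply sqrt_square; lra. }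
generalize (Le s); lra.
Qed.

Lemma tip_flow_Re_mult_le (s : R) : 0 <= s <= t ->
  Rabs (k s * Re (U s)) <= M * (M * (t - s)).
Proof.
intros Hs; rewrite Rabs_mult.
apply Rmult_le_compat; auto using Rabs_pos, tip_flow_Re_bound.
Qed.

(** [(Im U)^2 - (Re U)^2] has derivative [- 4 + 2 k Re U], without singular
    term. *)
Lemma tip_flow_Im_lower_near (s : R) : 0 <= s <= t -> M * M * (t - s) <= 1 ->
  y ^ 2 + 2 * (t - s) <= Im (U s) ^ 2.
Proof.
intros Hs Hn.
destruct HU as ([C1 C2] & _ & Et & _).
assert (K : - (Im (U s) * Im (U s) - Re (U s) * Re (U s) + 2 * s)
         <= - (Im (U t) * Im (U t) - Re (U t) * Re (U t) + 2 * t)).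
{ apply increasing_of_derive with
    (f := fun s => - (Im (U s) * Im (U s) - Re (U s) * Re (U s) + 2 * s))
    (df := fun s => 2 - 2 * (k s * Re (U s))); [lra | | |].
  - apply (continuity_opp (fun s => Im (U s) * Im (U s) - Re (U s) * Re (U s) + 2 * s)).
    apply (continuity_plus _ (fun s => 2 * s) (continuity_minus _ _
      (continuity_mult _ _ C2 C2) (continuity_mult _ _ C1 C1))).
    apply (continuity_scal (fun r => r) 2), derivable_continuous, derivable_id.
  - intros r Hr.
    assert (Hr' : 0 < r < t) by lra.
    assert (D1 := tip_flow_Re_derive r Hr').
    assert (D2 := tip_flow_Im_derive r Hr').
    evar_last.
    + apply (is_derive_opp (V := R_NormedModule)
        (fun s => Im (U s) * Im (U s) - Re (U s) * Re (U s) + 2 * s)).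
      apply (is_derive_plus (V := R_NormedModule)
        (fun s => Im (U s) * Im (U s) - Re (U s) * Re (U s)) (fun s => 2 * s)).
      * apply (is_derive_minus (V := R_NormedModule) _ _ _ _ _
          (is_derive_Rmult _ _ _ _ _ D2 D2) (is_derive_Rmult _ _ _ _ _ D1 D1)).
      * apply (is_derive_scal (fun r => r) r 2), (is_derive_id (K := R_AbsRing)).
    + hsimpl.
      field; generalize (tip_flow_norm2_pos r); simpl; lra.
  - intros r Hr.
    assert (B := tip_flow_Re_mult_le r ltac:(lra)).
    assert (A := Rle_abs (k r * Re (U r))).
    assert (M * (M * (t - r)) <= 1).
    { apply Rle_trans with (2 := Hn); nra. }
    lra. }
rewrite Et in K; simpl in K.
nra.
Qed.

Lemma tip_flow_Im_upper (s : R) : 0 <= s <= t ->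
  Im (U s) ^ 2 <= y ^ 2 + 4 * (t - s).
Proof.
intros Hs.
destruct HU as ([C1 C2] & _ & Et & _).
assert (K : Im (U s) * Im (U s) + 4 * s <= Im (U t) * Im (U t) + 4 * t).
{ apply increasing_of_derive with
    (f := fun s => Im (U s) * Im (U s) + 4 * s)
    (df := fun s => 4 * (Re (U s) ^ 2 * / (Re (U s) ^ 2 + Im (U s) ^ 2)));
    [lra | | |].
  - apply (continuity_plus _ (fun s => 4 * s) (continuity_mult _ _ C2 C2)).
    apply (continuity_scal (fun r => r) 4), derivable_continuous, derivable_id.
  - intros r Hr.
    assert (D2 := tip_flow_Im_derive r ltac:(lra)).
    evar_last.
    + apply (is_derive_plus (V := R_NormedModule)
        (fun s => Im (U s) * Im (U s)) (fun s => 4 * s)).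
      * apply (is_derive_Rmult _ _ _ _ _ D2 D2).
      * apply (is_derive_scal (fun r => r) r 4), (is_derive_id (K := R_AbsRing)).
    + hsimpl.
      field; generalize (tip_flow_norm2_pos r); simpl; lra.
  - intros r Hr; apply Rmult_le_pos; [lra|].
    apply Rmult_le_pos; [apply pow2_ge_0|].
    left; apply Rinv_0_lt_compat, tip_flow_norm2_pos. }
rewrite Et in K; simpl in K.
nra.
Qed.

Lemma tip_flow_Cmod_bound (s : R) : 0 <= s <= t ->
  Cmod (U s) <= y + 2 * sqrt (t - s) + M * (t - s).
Proof.
intros Hs.
replace (U s) with (RtoC (Re (U s)) + Ci * RtoC (Im (U s)))%C.
2:{ destruct (U s); unfold Ci, Cplus, Cmult, RtoC; simpl.
    apply f_equal2; ring. }
apply Rle_trans with (1 := Cmod_triangle _ _).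
rewrite Cmod_mult, Cmod_Ci, !Cmod_R.
assert (H1 := tip_flow_Re_bound s Hs).
assert (H2 := tip_flow_Im_upper s Hs).
assert (P : 0 < Im (U s)) by apply HU.
rewrite (Rabs_pos_eq (Im (U s))) by lra.
assert (Im (U s) <= y + 2 * sqrt (t - s)).
{ assert (S1 := sqrt_pos (t - s)).
  assert (S2 : sqrt (t - s) * sqrt (t - s) = t - s) by (apply sqrt_sqrt; lra).
  set (q := sqrt (t - s)) in *.
  apply Rnot_lt_le; intros N; nra. }
lra.
Qed.

End Tip.

(** The constant [c] of the bound [Im U_s >= c sqrt (t - s)] for [t <= T] and
    [|W'| <= M] ([tip_flow_Im_lower]). *)
Definition tip_rate (M T : R) : R := sqrt (2 / (1 + M * M * T)).

Lemma tip_rate_pos (M T : R) : 0 <= T -> 0 < tip_rate M T.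
Proof. intros H; apply sqrt_lt_R0, Rdiv_lt_0_compat; nra. Qed.

Lemma tip_flow_Im_lower (k : R -> R) (t y M T : R) (U : R -> C) (s : R) :
  0 <= t <= T -> 0 < M -> tip_flow k t y U ->
  (forall s, 0 <= s <= t -> Rabs (k s) <= M) ->
  0 <= s <= t ->
  tip_rate M T * sqrt (t - s) <= Im (U s).
Proof.
intros Ht HM HU Hk Hs.
assert (P : 0 < Im (U s)) by apply HU.
assert (D : 0 < 1 + M * M * T) by nra.
unfold tip_rate; rewrite <- sqrt_mult_alt by (left; apply Rdiv_lt_0_compat; lra).
rewrite <- (sqrt_pow2 (Im (U s))) by lra.
apply sqrt_le_1_alt.
destruct (Rle_lt_dec (M * M * (t - s)) 1) as [H|H].
- assert (A := tip_flow_Im_lower_near k t y M U HU Hk s Hs H).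
  assert (2 / (1 + M * M * T) <= 2).
  { apply Rmult_le_reg_r with (1 := D); unfold Rdiv.
    rewrite Rmult_assoc, Rinv_l by lra; nra. }
  nra.
- (* At distance [1 / M^2] from the tip, [Im U] is already large. *)
  assert (I : M * M * / (M * M) = 1) by (apply Rinv_r; nra).
  assert (Ip : 0 < / (M * M)) by (apply Rinv_0_lt_compat; nra).
  set (i := / (M * M)) in *.
  assert (Hi : i < t - s).
  { apply Rmult_lt_reg_l with (M * M); [nra | lra]. }
  assert (A := tip_flow_Im_lower_near k t y M U HU Hk (t - i)
    ltac:(lra) ltac:(nra)).
  assert (B := tip_flow_Im_decreasing k t y U HU s (t - i)
    ltac:(lra) ltac:(lra) ltac:(lra)).
  assert (P' : 0 < Im (U (t - i))) by apply HU.
  apply Rle_trans with (2 * i).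
  + apply Rmult_le_reg_r with (1 := D).
    replace (2 / (1 + M * M * T) * (t - s) * (1 + M * M * T))
      with (2 * (t - s)) by (field; lra).
    nra.
  + simpl in *; nra.
Qed.

(** Integrated form of an integrable singularity at the right end point:
    the first bound on [D'] is used within distance [d] of [t], the second one
    farther away. *)
Lemma singular_increment_bound (D D' : R -> C) (t A B d : R) :
  0 <= t -> 0 <= A -> 0 <= B -> 0 < d -> Ccontinuity D ->
  (forall s, 0 < s < t -> is_Cderive D s (D' s)) ->
  (forall s, 0 < s < t -> Cmod (D' s) <= B / sqrt (t - s)) ->
  (forall s, 0 < s < t -> Cmod (D' s) <= A / ((t - s) * sqrt (t - s))) ->
  Cmod (D t - D 0) <= 2 * A / sqrt d + 2 * B * sqrt d.
Proof.
intros Ht HA HB Hd Dc Dd HDB HDA.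
assert (Sd := sqrt_lt_R0 d Hd).
assert (Near : forall r, 0 <= r <= t ->
  Cmod (D t - D r) <= 2 * B * sqrt (t - r)).
{ intros r Hr.
  replace (2 * B * sqrt (t - r)) with
    (- 2 * B * sqrt (t - t) - - 2 * B * sqrt (t - r)).
  2:{ replace (t - t) with 0 by ring; rewrite sqrt_0; ring. }
  apply Cmod_mean_value with (f' := D') (g := fun s => - 2 * B * sqrt (t - s))
    (g' := fun s => B / sqrt (t - s)); auto; try lra.
  - apply (continuity_scal (fun s => sqrt (t - s))).
    apply (continuity_comp (fun s => t - s) sqrt).
    + apply (continuity_minus _ (fun s => s) (continuity_cst t)).
      apply derivable_continuous, derivable_id.
    + intros q; apply continuity_pt_filterlim, continuous_sqrt.
  - intros s Hs; apply Dd; lra.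
  - intros s Hs; auto_derive; [lra|].
    change (t + - s) with (t - s).
    field; apply Rgt_not_eq, sqrt_lt_R0; lra.
  - intros s Hs; apply HDB; lra. }
assert (Ap : 0 <= 2 * A / sqrt d).
{ apply Rmult_le_pos; [lra|left; now apply Rinv_0_lt_compat]. }
destruct (Rle_lt_dec t d) as [H|H].
- assert (N := Near 0 ltac:(lra)).
  assert (sqrt (t - 0) <= sqrt d) by (apply sqrt_le_1_alt; lra).
  nra.
- assert (N := Near (t - d) ltac:(lra)).
  replace (t - (t - d)) with d in N by ring.
  assert (F : Cmod (D (t - d) - D 0) <= 2 * A / sqrt d).
  { (* The function [2 A / sqrt] is frozen beyond [t - d] to be continuous. *)
    apply Rle_trans with
      (2 * A / sqrt (t - clamp (t - d) (t - d)) - 2 * A / sqrt (t - clamp (t - d) 0)).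
    - apply Cmod_mean_value with (f' := D')
        (g := fun s => 2 * A / sqrt (t - clamp (t - d) s))
        (g' := fun s => A / ((t - s) * sqrt (t - s))); auto; try lra.
      + apply (continuity_scal (fun s => / sqrt (t - clamp (t - d) s))).
        apply (continuity_inv (fun s => sqrt (t - clamp (t - d) s))).
        * apply (continuity_comp (fun s => t - clamp (t - d) s) sqrt).
          -- apply (continuity_minus _ _ (continuity_cst t)), clamp_continuity.
          -- intros q; apply continuity_pt_filterlim, continuous_sqrt.
        * intros s; apply Rgt_not_eq, sqrt_lt_R0.
          generalize (clamp_bounds (t - d) s ltac:(lra)); lra.
      + intros s Hs; apply Dd; lra.
      + intros s Hs.
        apply is_derive_ext_loc with (fun s => 2 * A / sqrt (t - s)).
        * apply filter_imp with (2 := clamp_near (t - d) s Hs).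
          intros r ->; reflexivity.
        * assert (0 < sqrt (t - s)) by (apply sqrt_lt_R0; lra).
          auto_derive.
          { change (t + - s) with (t - s); repeat split; lra. }
          change (t + - s) with (t - s).
          assert (Q : sqrt (t - s) * sqrt (t - s) = t - s) by (apply sqrt_sqrt; lra).
          set (q := sqrt (t - s)) in *; clearbody q.
          rewrite <- Q; field; lra.
      + intros s Hs; apply HDA; lra.
    - rewrite clamp_id by lra.
      replace (t - (t - d)) with d by ring.
      rewrite clamp_id by lra.
      assert (0 <= 2 * A / sqrt (t - 0)).
      { apply Rmult_le_pos; [lra|left; apply Rinv_0_lt_compat, sqrt_lt_R0; lra]. }
      lra. }
  apply Rle_trans with (1 := Cmod_minus_triangle _ (D (t - d)) _); lra.
Qed.

(** * Comparison of two flows *)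

(** [l] is the integral of [beta / U] over [[0, t]]. *)
Definition is_flow_integral (beta : R -> C) (t : R) (U : R -> C) (l : C) : Prop :=
  exists F : R -> C, F 0 = 0 /\ Ccontinuity F /\
    (forall s, 0 < s < t -> is_Cderive F s (beta s / U s)%C) /\ F t = l.

Lemma is_flow_integral_unique (b1 b2 : R -> C) (t : R) (U : R -> C) (l1 l2 : C) :
  0 <= t -> (forall s, 0 < s < t -> b1 s = b2 s) ->
  is_flow_integral b1 t U l1 -> is_flow_integral b2 t U l2 -> l1 = l2.
Proof.
intros Ht Hb (F & F0 & Fc & Fd & <-) (G & G0 & Gc & Gd & <-).
assert (E : (F t - G t)%C = (F 0 - G 0)%C).
{ apply (Cconstant_of_derive (fun s => F s - G s)%C 0 t Ht).
  - now apply Ccontinuity_minus.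
  - intros s Hs.
    apply is_Cderive_eq with (b1 s / U s - b2 s / U s)%C.
    + rewrite Hb by exact Hs; ring.
    + apply is_Cderive_minus; auto. }
rewrite F0, G0 in E.
replace (F t) with ((F t - G t) + G t)%C by ring.
rewrite E; ring.
Qed.

Lemma is_flow_integral_exists (k : R -> R) (beta : R -> C) (t y : R) (U : R -> C) :
  0 <= t -> tip_flow k t y U -> Ccontinuity (fun s => beta (clamp t s)) ->
  exists l, is_flow_integral beta t U l.
Proof.
intros Ht HU Hb.
destruct (Ccontinuity_antiderivative (fun s => beta (clamp t s) / U s)%C)
  as (F & F0 & Fc & Fd).
{ apply Ccontinuity_div; [exact Hb | apply HU |].
  intros s; apply (tip_flow_neq_0 k t y U HU). }
exists (F t), F; split; [exact F0 | split; [exact Fc | split; [|reflexivity]]].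
intros s Hs; apply is_Cderive_eq with (2 := Fd s).
rewrite clamp_id by lra; reflexivity.
Qed.

Lemma Cmod_div_le (a b : C) (A B : R) :
  0 < B -> Cmod a <= A -> B <= Cmod b -> Cmod (a / b) <= A / B.
Proof.
intros HB Ha Hb.
assert (Hb0 : 0 < Cmod b) by lra.
rewrite Cmod_div by now apply Cmod_gt_0.
unfold Rdiv; apply Rmult_le_compat; auto using Cmod_ge_0.
- left; now apply Rinv_0_lt_compat.
- now apply Rinv_le_contravar.
Qed.

Lemma flow_integral_increment (k : R -> R) (t y M T K : R) (U F : R -> C)
  (beta : R -> C) (s : R) :
  0 <= t <= T -> 0 < M -> tip_flow k t y U ->
  (forall s, 0 <= s <= t -> Rabs (k s) <= M) ->
  (forall s, 0 <= s <= t -> Cmod (beta s) <= K) ->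
  Ccontinuity F ->
  (forall r, s < r < t -> is_Cderive F r (beta r / U r)%C) ->
  0 <= s <= t ->
  Cmod (F t - F s) <= 2 * K / tip_rate M T * sqrt (t - s).
Proof.
intros Ht HM HU Hk Hb Fc Fd Hs.
assert (Pc := tip_rate_pos M T ltac:(lra)).
set (c := tip_rate M T) in *.
replace (2 * K / c * sqrt (t - s)) with
  (- 2 * K / c * sqrt (t - t) - - 2 * K / c * sqrt (t - s)).
2:{ replace (t - t) with 0 by ring; rewrite sqrt_0; field; lra. }
apply Cmod_mean_value with (f' := fun r => (beta r / U r)%C)
  (g := fun r => - 2 * K / c * sqrt (t - r))
  (g' := fun r => K / (c * sqrt (t - r))); auto; try lra.
- apply (continuity_scal (fun s => sqrt (t - s))).
  apply (continuity_comp (fun s => t - s) sqrt).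
  + apply (continuity_minus _ (fun s => s) (continuity_cst t)).
    apply derivable_continuous, derivable_id.
  + intros q; apply continuity_pt_filterlim, continuous_sqrt.
- intros r Hr; auto_derive; [lra|].
  change (t + - r) with (t - r).
  field; split; [apply Rgt_not_eq, sqrt_lt_R0; lra | lra].
- intros r Hr.
  assert (0 < sqrt (t - r)) by (apply sqrt_lt_R0; lra).
  apply Cmod_div_le; [nra | apply Hb; lra |].
  apply Rle_trans with (2 := Im_le_Cmod _).
  apply tip_flow_Im_lower with k y; auto; lra.
Qed.

Section Pair.

Context (k : R -> R) (t t' T y y' M : R) (U V : R -> C).
Context (Ht : 0 <= t) (Htt : t <= t') (HT : t' <= T).
Context (Hy' : 0 < y') (HM : 0 < M).
Context (HU : tip_flow k t y U) (HV : tip_flow k t' y' V).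
Context (Hk : forall s, 0 <= s <= T -> Rabs (k s) <= M).
Context (Hkc : continuity (fun s => k (clamp t s))).

Local Notation c := (tip_rate M T).

(** The difference of the squares of both flows solves the linear equation
    [N' = - (2 k / (U + V)) N]. *)
Definition square_gap : R -> C := fun s => (V s * V s - U s * U s)%C.

(** Bound on the integral of [2 k / (U + V)]. *)
Definition gap_exponent : R := 2 * (2 * M) / tip_rate M T * sqrt T.

Let Pc : 0 < c.
Proof. apply tip_rate_pos; lra. Qed.

Let U_lower (s : R) : 0 <= s <= t -> c * sqrt (t - s) <= Im (U s).
Proof.
intros Hs; apply tip_flow_Im_lower with k y; auto; try lra.
intros; apply Hk; lra.
Qed.

Let V_lower (s : R) : 0 <= s <= t -> c * sqrt (t - s) <= Im (V s).
Proof.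
intros Hs; apply Rle_trans with (c * sqrt (t' - s)).
- apply Rmult_le_compat_l; [lra|].
  apply sqrt_le_1_alt; lra.
- apply tip_flow_Im_lower with k y'; auto; try lra.
  intros; apply Hk; lra.
Qed.

Let ImU (s : R) : 0 < Im (U s).
Proof. apply HU. Qed.

Let ImV (s : R) : 0 < Im (V s).
Proof. apply HV. Qed.

Let Usum_neq_0 (s : R) : (U s + V s)%C <> 0.
Proof.
apply Im_pos_neq_0; simpl; fold (Im (U s)) (Im (V s)).
generalize (ImU s), (ImV s); lra.
Qed.

Let Usum_lower (s : R) : 0 <= s <= t -> c * sqrt (t - s) <= Cmod (U s + V s).
Proof.
intros Hs; apply Rle_trans with (2 := Im_le_Cmod _); simpl.
fold (Im (U s)) (Im (V s)).
generalize (U_lower s Hs), (ImV s); lra.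
Qed.

(** Over [[t, t']] the square of [V] moves at speed close to 4. *)
Lemma square_gap_end :
  Cmod (square_gap t - RtoC (y * y - y' * y' - 4 * (t' - t))) <=
  2 * M * (y' + 2 * sqrt (t' - t) + M * (t' - t)) * (t' - t).
Proof.
set (S := y' + 2 * sqrt (t' - t) + M * (t' - t)).
assert (K : Cmod ((V t' * V t' - RtoC (4 * t')) - (V t * V t - RtoC (4 * t)))%C <=
  2 * M * S * t' - 2 * M * S * t).
{ apply Cmod_mean_value with (f := fun s => (V s * V s - RtoC (4 * s))%C)
    (f' := fun s => (- (2) * RtoC (k s) * V s)%C)
    (g := fun s => 2 * M * S * s) (g' := fun _ => 2 * M * S); auto.
  - apply Ccontinuity_minus; [apply Ccontinuity_mult; apply HV|].
    apply Ccontinuity_RtoC, (continuity_scal (fun s => s)).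
    apply derivable_continuous, derivable_id.
  - apply (continuity_scal (fun s => s)), derivable_continuous, derivable_id.
  - intros s Hs.
    assert (D : is_Cderive V s (2 / V s - k s)%C) by (apply HV; lra).
    apply is_Cderive_eq with
      ((2 / V s - k s) * V s + V s * (2 / V s - k s) - RtoC 4)%C.
    { replace (RtoC 4) with (2 + 2)%C by (unfold Cplus, RtoC; simpl; f_equal; ring).
      field; apply (tip_flow_neq_0 k t' y' V HV). }
    apply is_Cderive_minus; [now apply is_Cderive_mult|].
    split; simpl.
    + auto_derive; [trivial|ring].
    + apply (is_derive_const (V := R_NormedModule) 0).
  - intros s Hs; auto_derive; [trivial|ring].
  - intros s Hs.
    rewrite !Cmod_mult, Cmod_opp, !Cmod_R, (Rabs_pos_eq 2) by lra.
    assert (B := tip_flow_Cmod_bound k t' y' M V Hy' HV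
      ltac:(intros; apply Hk; lra) s ltac:(lra)).
    assert (B1 : Rabs (k s) <= M) by (apply Hk; lra).
    assert (B2 : sqrt (t' - s) <= sqrt (t' - t)) by (apply sqrt_le_1_alt; lra).
    assert (B3 : Cmod (V s) <= S) by (unfold S; nra).
    rewrite !Rmult_assoc; apply Rmult_le_compat_l; [lra|].
    apply Rmult_le_compat; auto using Rabs_pos, Cmod_ge_0. }
replace (2 * M * S * (t' - t)) with (2 * M * S * t' - 2 * M * S * t) by ring.
apply Rle_trans with (2 := K); right.
rewrite <- Cmod_opp; apply f_equal; unfold square_gap.
destruct HU as (_ & _ & -> & _), HV as (_ & _ & -> & _).
destruct (V t) as [a b]; unfold Cminus, Cplus, Copp, Cmult, RtoC; simpl.
apply f_equal2; ring.
Qed.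

Lemma square_gap_integral :
  exists Q : R -> C, Q 0 = 0 /\ Ccontinuity Q /\
    (forall s, 0 < s < t -> is_Cderive Q s (2 * k s / (U s + V s))%C) /\
    (forall s, 0 <= s <= t -> Cmod (Q t - Q s) <= gap_exponent) /\
    (forall s, 0 <= s <= t -> square_gap s = (square_gap t * cexp (Q t - Q s))%C).
Proof.
destruct (Ccontinuity_antiderivative (fun s => 2 * k (clamp t s) / (U s + V s))%C)
  as (Q & Q0 & Qc & Qd).
{ apply Ccontinuity_div; auto.
  - apply Ccontinuity_mult; [apply Ccontinuity_const | now apply Ccontinuity_RtoC].
  - apply Ccontinuity_plus; [apply HU | apply HV]. }
assert (Qd' : forall s, 0 < s < t -> is_Cderive Q s (2 * k s / (U s + V s))%C).
{ intros s Hs; apply is_Cderive_eq with (2 := Qd s).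
  rewrite clamp_id by lra; reflexivity. }
exists Q; split; [exact Q0 | split; [exact Qc | split; [exact Qd' | split]]].
- intros s Hs; unfold gap_exponent.
  apply Rle_trans with (2 * (2 * M) / c * sqrt (t - s)).
  + replace (2 * (2 * M) / c * sqrt (t - s)) with
      (- 2 * (2 * M) / c * sqrt (t - t) - - 2 * (2 * M) / c * sqrt (t - s)).
    2:{ replace (t - t) with 0 by ring; rewrite sqrt_0; field; lra. }
    apply Cmod_mean_value with (f' := fun r => (2 * k r / (U r + V r))%C)
      (g := fun r => - 2 * (2 * M) / c * sqrt (t - r))
      (g' := fun r => 2 * M / (c * sqrt (t - r))); auto; try lra.
    * apply (continuity_scal (fun s => sqrt (t - s))).
      apply (continuity_comp (fun s => t - s) sqrt).
      -- apply (continuity_minus _ (fun s => s) (continuity_cst t)).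
         apply derivable_continuous, derivable_id.
      -- intros q; apply continuity_pt_filterlim, continuous_sqrt.
    * intros r Hr; apply Qd'; lra.
    * intros r Hr; auto_derive; [lra|].
      change (t + - r) with (t - r).
      field; split; [apply Rgt_not_eq, sqrt_lt_R0; lra | lra].
    * intros r Hr.
      assert (0 < sqrt (t - r)) by (apply sqrt_lt_R0; lra).
      apply Cmod_div_le; [nra | | apply Usum_lower; lra].
      rewrite Cmod_mult, !Cmod_R, (Rabs_pos_eq 2) by lra.
      apply Rmult_le_compat_l; [lra | apply Hk; lra].
  + apply Rmult_le_compat_l; [|apply sqrt_le_1_alt; lra].
    apply Rmult_le_pos; [lra | left; now apply Rinv_0_lt_compat].
- intros s Hs.
  assert (E : (square_gap t * cexp (Q t))%C = (square_gap s * cexp (Q s))%C).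
  { apply (Cconstant_of_derive (fun s => square_gap s * cexp (Q s))%C s t); [lra | |].
    - apply Ccontinuity_mult; [|now apply Ccontinuity_cexp].
      apply Ccontinuity_minus; apply Ccontinuity_mult; first [apply HU | apply HV].
    - intros r Hr.
      assert (DU : is_Cderive U r (2 / U r - k r)%C) by (apply HU; lra).
      assert (DV : is_Cderive V r (2 / V r - k r)%C) by (apply HV; lra).
      unfold square_gap.
      eapply is_Cderive_eq;
        [|apply is_Cderive_mult;
           [apply is_Cderive_minus; apply is_Cderive_mult; eassumption
           |apply is_Cderive_cexp, Qd'; lra]].
      cbv beta; field; repeat split; [apply Usum_neq_0 | |].
      + apply (tip_flow_neq_0 k t y U HU).
      + apply (tip_flow_neq_0 k t' y' V HV). }
  replace (Q t - Q s)%C with (Q t + - Q s)%C by ring.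
  rewrite cexp_plus, Cmult_assoc, E, <- Cmult_assoc, <- cexp_plus.
  replace (Q s + - Q s)%C with (RtoC 0) by ring.
  rewrite cexp_0; ring.
Qed.

(** Flows with close squares are close, except near the tip. *)
Lemma flow_gap_bound (s : R) : 0 <= s < t ->
  Cmod (U s - V s) <= exp gap_exponent * Cmod (square_gap t) / (c * sqrt (t - s)).
Proof.
intros Hs.
destruct square_gap_integral as (Q & _ & _ & _ & HQ & HN).
assert (Sp : 0 < sqrt (t - s)) by (apply sqrt_lt_R0; lra).
replace (U s - V s)%C with (- square_gap s / (U s + V s))%C.
2:{ unfold square_gap; field; apply Usum_neq_0. }
apply Cmod_div_le; [nra | | apply Usum_lower; lra].
rewrite Cmod_opp, (HN s) by lra.
rewrite Cmod_mult, Rmult_comm.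
apply Rmult_le_compat_r; [apply Cmod_ge_0|].
apply Cmod_cexp_le, HQ; lra.
Qed.

(* The constant of the bounds of order [(t - s)^(- 3 / 2)]. *)
Local Notation A K :=
  (K * (exp gap_exponent * Cmod (square_gap t)) / (c * c * c)).

Let A_pos (K : R) : 0 <= K -> 0 <= A K.
Proof.
intros HK; apply Rmult_le_pos.
- apply Rmult_le_pos; [exact HK|].
  apply Rmult_le_pos; [left; apply exp_pos | apply Cmod_ge_0].
- left; apply Rinv_0_lt_compat.
  generalize Pc; intros; repeat apply Rmult_lt_0_compat; lra.
Qed.

Let gap_quotient_bound (K s : R) (b X Y : C) :
  0 <= s < t -> 0 <= K -> Cmod b <= K ->
  c * sqrt (t - s) <= Cmod X -> c * sqrt (t - s) <= Cmod Y ->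
  Cmod (b * (U s - V s) / (X * Y)) <= A K / ((t - s) * sqrt (t - s)).
Proof.
intros Hs HK Hb HX HY.
assert (Sp : 0 < sqrt (t - s)) by (apply sqrt_lt_R0; lra).
assert (Cp : 0 < c * sqrt (t - s)) by (generalize Pc; nra).
assert (Q : sqrt (t - s) * sqrt (t - s) = t - s) by (apply sqrt_sqrt; lra).
apply Rle_trans with
  (K * (exp gap_exponent * Cmod (square_gap t) / (c * sqrt (t - s))) /
   ((c * sqrt (t - s)) * (c * sqrt (t - s)))).
- apply Cmod_div_le.
  + nra.
  + rewrite Cmod_mult; apply Rmult_le_compat; auto using Cmod_ge_0.
    now apply flow_gap_bound.
  + rewrite Cmod_mult; apply Rmult_le_compat; lra.
- right.
  set (q := sqrt (t - s)) in *; clearbody q.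
  rewrite <- Q; field; split; [lra | generalize Pc; lra].
Qed.

Lemma flow_integral_gap (beta : R -> C) (K d : R) (F G : R -> C) :
  0 <= K -> 0 < d ->
  (forall s, 0 <= s <= t -> Cmod (beta s) <= K) ->
  F 0 = 0 -> G 0 = 0 -> Ccontinuity F -> Ccontinuity G ->
  (forall s, 0 < s < t -> is_Cderive F s (beta s / U s)%C) ->
  (forall s, 0 < s < t -> is_Cderive G s (beta s / V s)%C) ->
  Cmod (G t - F t) <= 2 * A K / sqrt d + 2 * (2 * K / c) * sqrt d.
Proof.
intros HK Hd Hb F0 G0 Fc Gc Fd Gd.
replace (G t - F t)%C with ((G t - F t) - (G 0 - F 0))%C.
2:{ rewrite F0, G0; ring. }
apply singular_increment_bound with (D := fun s => (G s - F s)%C)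
  (D' := fun s => (beta s / V s - beta s / U s)%C); auto.
- apply Rmult_le_pos; [lra | left; now apply Rinv_0_lt_compat].
- now apply Ccontinuity_minus.
- intros s Hs; apply is_Cderive_minus; auto.
- intros s Hs.
  assert (Sp : 0 < sqrt (t - s)) by (apply sqrt_lt_R0; lra).
  assert (B : forall W, c * sqrt (t - s) <= Im W ->
    Cmod (beta s / W) <= K / (c * sqrt (t - s))).
  { intros W HW; apply Cmod_div_le; [generalize Pc; nra | apply Hb; lra |].
    apply Rle_trans with (2 := Im_le_Cmod W), HW. }
  apply Rle_trans with (1 := Cmod_triangle _ _); rewrite Cmod_opp.
  assert (B1 := B _ (U_lower s ltac:(lra))).
  assert (B2 := B _ (V_lower s ltac:(lra))).
  replace (2 * K / c / sqrt (t - s)) with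
    (K / (c * sqrt (t - s)) + K / (c * sqrt (t - s))).
  + lra.
  + field; generalize Pc; lra.
- intros s Hs.
  replace (beta s / V s - beta s / U s)%C with
    (beta s * (U s - V s) / (U s * V s))%C.
  2:{ field; split; [apply (tip_flow_neq_0 k t y U HU)
                    | apply (tip_flow_neq_0 k t' y' V HV)]. }
  apply gap_quotient_bound; auto; try lra.
  + apply Hb; lra.
  + apply Rle_trans with (2 := Im_le_Cmod _), U_lower; lra.
  + apply Rle_trans with (2 := Im_le_Cmod _), V_lower; lra.
Qed.

(** The gap between the squares of the starting points; its exponent [q] is
    close to the integral of [k / U]. *)
Lemma square_gap_start (d : R) (e : C) :
  0 < d -> is_flow_integral (fun s => RtoC (k s)) t U e ->
  exists q : C, square_gap 0 = (square_gap t * cexp q)%C /\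
    Cmod q <= gap_exponent /\
    Cmod (q - e) <= 2 * A M / sqrt d + 2 * (3 * M / c) * sqrt d.
Proof.
intros Hd (E & E0 & Ec & Ed & <-).
destruct square_gap_integral as (Q & Q0 & Qc & Qd & HQ & HN).
assert (EQ : (Q t - Q 0)%C = Q t) by (rewrite Q0; ring).
exists (Q t); split; [|split].
- rewrite (HN 0) by lra; now rewrite EQ.
- rewrite <- EQ; apply HQ; lra.
- replace (Q t - E t)%C with ((Q t - E t) - (Q 0 - E 0))%C.
  2:{ rewrite Q0, E0; ring. }
  apply singular_increment_bound with (D := fun s => (Q s - E s)%C)
    (D' := fun s => (2 * k s / (U s + V s) - k s / U s)%C); auto.
  + apply A_pos; lra.
  + apply Rmult_le_pos; [lra | left; now apply Rinv_0_lt_compat].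
  + now apply Ccontinuity_minus.
  + intros s Hs; apply is_Cderive_minus; auto.
  + intros s Hs.
    assert (Sp : 0 < sqrt (t - s)) by (apply sqrt_lt_R0; lra).
    assert (Hks : Rabs (k s) <= M) by (apply Hk; lra).
    assert (B1 : Cmod (2 * k s / (U s + V s)) <= 2 * M / (c * sqrt (t - s))).
    { apply Cmod_div_le; [generalize Pc; nra | | apply Usum_lower; lra].
      rewrite Cmod_mult, !Cmod_R, (Rabs_pos_eq 2) by lra; lra. }
    assert (B2 : Cmod (k s / U s) <= M / (c * sqrt (t - s))).
    { apply Cmod_div_le; [generalize Pc; nra | now rewrite Cmod_R |].
      apply Rle_trans with (2 := Im_le_Cmod _), U_lower; lra. }
    apply Rle_trans with (1 := Cmod_triangle _ _); rewrite Cmod_opp.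
    replace (3 * M / c / sqrt (t - s)) with
      (2 * M / (c * sqrt (t - s)) + M / (c * sqrt (t - s))).
    * lra.
    * field; generalize Pc; lra.
  + intros s Hs.
    replace (2 * k s / (U s + V s) - k s / U s)%C with
      (k s * (U s - V s) / (U s * (U s + V s)))%C.
    2:{ field; split; [apply (tip_flow_neq_0 k t y U HU) | apply Usum_neq_0]. }
    apply gap_quotient_bound; try lra.
    * rewrite Cmod_R; apply Hk; lra.
    * apply Rle_trans with (2 := Im_le_Cmod _), U_lower; lra.
    * apply Usum_lower; lra.
Qed.

End Pair.

(** Uniformity in the final times [t], [t'] and heights [y], [y']. *)
Section Modulus.

Context (k : R -> R) (T M : R) (HT0 : 0 <= T) (HM : 0 < M).
Context (Hk : forall s, 0 <= s <= T -> Rabs (k s) <= M).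

Lemma square_gap_small (t t' y y' d : R) (U V : R -> C) :
  0 <= t -> t <= t' -> t' <= T -> 0 < d <= 1 ->
  t' - t <= d -> 0 < y <= d -> 0 < y' <= d ->
  tip_flow k t y U -> tip_flow k t' y' V ->
  Cmod (square_gap U V t) <= (6 + 2 * M * (3 + M)) * d.
Proof.
intros Ht Htt Ht' Hd Hh Hy Hy' HU HV.
assert (B := square_gap_end k t t' T y y' M U V Ht Htt Ht' ltac:(lra) HM HU HV Hk).
set (N := square_gap U V t) in *.
set (h := t' - t) in *.
assert (Hh0 : 0 <= h) by (unfold h; lra).
assert (Hs : 0 <= sqrt h <= 1).
{ split; [apply sqrt_pos|].
  rewrite <- sqrt_1; apply sqrt_le_1_alt; lra. }
assert (B1 : Rabs (y * y - y' * y' - 4 * h) <= 6 * d).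
{ apply Rabs_le; split; nra. }
replace N with ((N - RtoC (y * y - y' * y' - 4 * h)) +
  RtoC (y * y - y' * y' - 4 * h))%C by ring.
apply Rle_trans with (1 := Cmod_triangle _ _).
rewrite Cmod_R.
assert (2 * M * (y' + 2 * sqrt h + M * h) * h <= 2 * M * (3 + M) * d).
{ rewrite !(Rmult_assoc (2 * M)).
  apply Rmult_le_compat_l; [lra|].
  apply Rmult_le_compat; nra. }
lra.
Qed.

(** The smallness of an estimate [2 (a N) / sqrt d + b sqrt d] as [N] goes
    to 0, for a suitable [d]. *)
Lemma split_small (a b e : R) : 0 <= a -> 0 < e ->
  exists d n, 0 < d /\ 0 < n /\
    forall N, 0 <= N <= n -> 2 * (a * N) / sqrt d + b * sqrt d <= e.
Proof.
intros Ha He.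
destruct (exists_small b (e / 2)) as (d & Hd & _ & Hb); [lra|].
assert (Sd : 0 < sqrt d) by (apply sqrt_lt_R0; lra).
destruct (exists_small (2 * a / sqrt d) (e / 2)) as (n & Hn & Hn' & _); [lra|].
exists d, n; split; [lra | split; [lra|]].
intros N HN.
assert (2 * (a * N) / sqrt d <= 2 * a / sqrt d * n).
{ replace (2 * (a * N) / sqrt d) with (2 * a / sqrt d * N) by (field; lra).
  apply Rmult_le_compat_l; [|lra].
  apply Rmult_le_pos; [lra | left; now apply Rinv_0_lt_compat]. }
lra.
Qed.

Let c := tip_rate M T.

Let Pc : 0 < c.
Proof. now apply tip_rate_pos. Qed.

(** The integrals of [beta / U] depend uniformly continuously on the final time
    and height, down to height 0. *)
Lemma flow_integral_modulus (K e : R) : 0 <= K -> 0 < e ->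
  exists d, 0 < d /\
  forall (beta : R -> C) (t t' y y' : R) (U V : R -> C) (l l' : C),
    (forall s, 0 <= s <= T -> Cmod (beta s) <= K) ->
    0 <= t -> t <= t' -> t' <= T ->
    t' - t <= d -> 0 < y <= d -> 0 < y' <= d ->
    continuity (fun s => k (clamp t s)) ->
    tip_flow k t y U -> tip_flow k t' y' V ->
    is_flow_integral beta t U l -> is_flow_integral beta t' V l' ->
    Cmod (l' - l) <= e.
Proof.
intros HK He.
assert (Pe := exp_pos (gap_exponent T M)).
destruct (split_small (K * exp (gap_exponent T M) / (c * c * c))
  (2 * (2 * K / c)) (e / 2)) as (d1 & n & Hd1 & Hn & HN); [|lra|].
{ apply Rmult_le_pos; [apply Rmult_le_pos; lra|].
  left; apply Rinv_0_lt_compat; repeat apply Rmult_lt_0_compat; lra. }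
destruct (exists_small (2 * K / c) (e / 2)) as (d2 & Hd2 & _ & Hb2); [lra|].
destruct (exists_small (6 + 2 * M * (3 + M)) n) as (d3 & Hd3 & Hb3 & _); [lra|].
exists (Rmin d2 d3).
assert (M1 := Rmin_l d2 d3); assert (M2 := Rmin_r d2 d3).
split; [apply Rmin_pos; lra|].
intros beta t t' y y' U V l l' Hb Ht Htt Ht' Hh Hy Hy' Hkc HU HV
  (F & F0 & Fc & Fd & <-) (G & G0 & Gc & Gd & <-).
assert (E1 : Cmod (G t' - G t) <= e / 2).
{ apply Rle_trans with (2 * K / c * sqrt (t' - t)).
  - apply flow_integral_increment with (k := k) (y := y') (U := V) (beta := beta);
      auto; try lra.
    + intros; apply Hk; lra.
    + intros; apply Hb; lra.
    + intros; apply Gd; lra.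
  - apply Rle_trans with (2 * K / c * sqrt d2); [|exact Hb2].
    apply Rmult_le_compat_l; [|apply sqrt_le_1_alt; lra].
    apply Rmult_le_pos; [lra | left; now apply Rinv_0_lt_compat]. }
assert (E2 : Cmod (G t - F t) <= e / 2).
{ eapply Rle_trans; [apply (flow_integral_gap k t t' T y y' M U V Ht Htt Ht' HM HU HV
    Hk Hkc beta K d1 F G); auto|].
  - intros; apply Hb; lra.
  - intros; apply Gd; lra.
  - assert (S := square_gap_small t t' y y' d3 U V Ht Htt Ht' Hd3
      ltac:(lra) ltac:(lra) ltac:(lra) HU HV).
    assert (HN' := HN (Cmod (square_gap U V t))
      (conj (Cmod_ge_0 _) (Rle_trans _ _ _ S Hb3))).
    apply Rle_trans with (2 := HN'); right.
    fold c; field; split; [lra | apply Rgt_not_eq, sqrt_lt_R0; lra]. }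
apply Rle_trans with (1 := Cmod_minus_triangle _ (G t) _); lra.
Qed.

(** First order expansion, in [t' - t], of the gap between the squares of the
    starting points of flows of the same final height. *)
Lemma square_gap_modulus (e : R) : 0 < e ->
  exists d, 0 < d /\
  forall (t t' y : R) (U V : R -> C) (l : C),
    0 <= t -> t <= t' -> t' <= T -> t' - t <= d -> 0 < y <= d ->
    continuity (fun s => k (clamp t s)) ->
    tip_flow k t y U -> tip_flow k t' y V ->
    is_flow_integral (fun s => RtoC (k s)) t U l ->
    Cmod (square_gap U V 0 + 4 * RtoC (t' - t) * cexp l) <= e * (t' - t).
Proof.
intros He.
set (X := gap_exponent T M).
assert (Pe := exp_pos X).
assert (Pe' := exp_pos (X + 1)).
destruct (exists_small (12 * exp (X + 1)) (e / 2)) as (n1 & Hn1 & Hb1 & _); [lra|].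
destruct (split_small (M * exp X / (c * c * c))
  (2 * (3 * M / c)) n1) as (d1 & n & Hd1 & Hn & HN); [|lra|].
{ apply Rmult_le_pos; [apply Rmult_le_pos; lra|].
  left; apply Rinv_0_lt_compat; repeat apply Rmult_lt_0_compat; lra. }
destruct (exists_small (2 * M * (3 + M) * exp X) (e / 2)) as (d2 & Hd2 & _ & Hb2);
  [lra|].
destruct (exists_small (6 + 2 * M * (3 + M)) n) as (d3 & Hd3 & Hb3 & _); [lra|].
exists (Rmin d2 d3).
assert (M1 := Rmin_l d2 d3); assert (M2 := Rmin_r d2 d3).
split; [apply Rmin_pos; lra|].
intros t t' y U V l Ht Htt Ht' Hh Hy Hkc HU HV Hl.
destruct (square_gap_start k t t' T y y M U V Ht Htt Ht' HM HU HV Hk Hkc d1 l Hd1 Hl)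
  as (q & -> & Hq & Hql).
assert (Hql' : Cmod (q - l) <= n1).
{ apply Rle_trans with (1 := Hql).
  assert (S := square_gap_small t t' y y d3 U V Ht Htt Ht' Hd3
    ltac:(lra) ltac:(lra) ltac:(lra) HU HV).
  assert (HN' := HN (Cmod (square_gap U V t))
    (conj (Cmod_ge_0 _) (Rle_trans _ _ _ S Hb3))).
  apply Rle_trans with (2 := HN'); right.
  fold c X; field; split; [lra | apply Rgt_not_eq, sqrt_lt_R0; lra]. }
assert (B := square_gap_end k t t' T y y M U V Ht Htt Ht' ltac:(lra) HM HU HV Hk).
set (N := square_gap U V t) in *.
set (h := t' - t) in *.
assert (Hh0 : 0 <= h) by (unfold h; lra).
replace (RtoC (y * y - y * y - 4 * h)) with (- (4 * RtoC h))%C in B.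
2:{ unfold Copp, Cmult, RtoC; simpl; apply f_equal2; ring. }
replace (N * cexp q + 4 * h * cexp l)%C with
  ((N - - (4 * RtoC h)) * cexp q - 4 * RtoC h * (cexp l * (cexp (q - l) - 1)))%C.
2:{ replace (cexp q) with (cexp l * cexp (q - l))%C; [ring|].
    rewrite <- cexp_plus; apply f_equal; ring. }
apply Rle_trans with (1 := Cmod_triangle _ _).
rewrite Cmod_opp, !Cmod_mult, !Cmod_R, (Rabs_pos_eq h), (Rabs_pos_eq 4) by lra.
assert (Hl' : Cmod l <= X + 1).
{ replace l with (q - (q - l))%C by ring.
  apply Rle_trans with (1 := Cmod_triangle _ _); rewrite Cmod_opp.
  unfold X; lra. }
assert (E1 : Cmod (N - - (4 * RtoC h)) * Cmod (cexp q) <= e / 2 * h).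
{ apply Rle_trans with ((2 * M * (y + 2 * sqrt h + M * h) * h) * exp X).
  - apply Rmult_le_compat; auto using Cmod_ge_0, Cmod_cexp_le.
  - assert (S2 : 0 <= sqrt d2 <= 1).
    { split; [apply sqrt_pos|].
      rewrite <- sqrt_1; apply sqrt_le_1_alt; lra. }
    assert (S3 : d2 <= sqrt d2).
    { rewrite <- (sqrt_sqrt d2) at 1 by lra; nra. }
    assert (S4 : sqrt h <= sqrt d2) by (apply sqrt_le_1_alt; lra).
    assert (S5 : y + 2 * sqrt h + M * h <= (3 + M) * sqrt d2) by nra.
    apply Rle_trans with (2 * M * (3 + M) * exp X * sqrt d2 * h).
    + replace (2 * M * (y + 2 * sqrt h + M * h) * h * exp X) with
        ((2 * M * h * exp X) * (y + 2 * sqrt h + M * h)) by ring.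
      replace (2 * M * (3 + M) * exp X * sqrt d2 * h) with
        ((2 * M * h * exp X) * ((3 + M) * sqrt d2)) by ring.
      apply Rmult_le_compat_l; [|exact S5].
      repeat apply Rmult_le_pos; lra.
    + apply Rmult_le_compat_r; lra. }
assert (E2 : Cmod (cexp l) * Cmod (cexp (q - l) - 1) <= exp (X + 1) * (3 * n1)).
{ apply Rmult_le_compat; auto using Cmod_ge_0, Cmod_cexp_le.
  apply Rle_trans with (3 * Cmod (q - l)); [apply Cmod_cexp_minus_1; lra | lra]. }
nra.
Qed.

End Modulus.

(** * The curve of tips *)

(** [f y] tends to [l] as [y] decreases to 0. *)
Definition lim0 (f : R -> C) (l : C) : Prop :=
  forall e, 0 < e -> exists d, 0 < d /\ forall y, 0 < y < d -> Cmod (f y - l) < e.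

Lemma lim0_plus (f g : R -> C) (a b : C) :
  lim0 f a -> lim0 g b -> lim0 (fun y => f y + g y)%C (a + b)%C.
Proof.
intros F G e He.
destruct (F (e / 2)) as (d1 & P1 & H1); [lra|].
destruct (G (e / 2)) as (d2 & P2 & H2); [lra|].
exists (Rmin d1 d2); split; [now apply Rmin_pos|].
intros y Hy.
assert (M1 := Rmin_l d1 d2); assert (M2 := Rmin_r d1 d2).
replace (f y + g y - (a + b))%C with ((f y - a) + (g y - b))%C by ring.
apply Rle_lt_trans with (1 := Cmod_triangle _ _).
specialize (H1 y ltac:(lra)); specialize (H2 y ltac:(lra)); lra.
Qed.

Lemma lim0_const (a : C) : lim0 (fun _ => a) a.
Proof.
intros e He; exists 1; split; [lra|]; intros y _.
replace (a - a)%C with (RtoC 0) by ring; rewrite Cmod_0; exact He.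
Qed.

Lemma lim0_mult (f g : R -> C) (a b : C) :
  lim0 f a -> lim0 g b -> lim0 (fun y => f y * g y)%C (a * b)%C.
Proof.
intros F G e He.
assert (PA := Cmod_ge_0 a); assert (PB := Cmod_ge_0 b).
set (q := Rmin 1 (e / (2 + Cmod a + Cmod b))).
assert (Hq : 0 < q) by (apply Rmin_pos; [lra | apply Rdiv_lt_0_compat; lra]).
assert (Hq1 : q <= 1) by apply Rmin_l.
assert (Hq2 : (2 + Cmod a + Cmod b) * q <= e).
{ apply Rle_trans with ((2 + Cmod a + Cmod b) * (e / (2 + Cmod a + Cmod b))).
  - apply Rmult_le_compat_l; [lra | apply Rmin_r].
  - right; field; lra. }
destruct (F q Hq) as (d1 & P1 & H1).
destruct (G q Hq) as (d2 & P2 & H2).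
exists (Rmin d1 d2); split; [now apply Rmin_pos|].
intros y Hy.
assert (M1 := Rmin_l d1 d2); assert (M2 := Rmin_r d1 d2).
specialize (H1 y ltac:(lra)); specialize (H2 y ltac:(lra)).
replace (f y * g y - a * b)%C with
  ((f y - a) * (g y - b) + (a * (g y - b) + b * (f y - a)))%C by ring.
apply Rle_lt_trans with (1 := Cmod_triangle _ _).
apply Rle_lt_trans with (Cmod ((f y - a) * (g y - b)) +
  (Cmod (a * (g y - b)) + Cmod (b * (f y - a)))).
- apply Rplus_le_compat_l, Cmod_triangle.
- rewrite !Cmod_mult.
  generalize (Cmod_ge_0 (f y - a)), (Cmod_ge_0 (g y - b)); intros; nra.
Qed.

Lemma lim0_cexp (f : R -> C) (a : C) :
  lim0 f a -> lim0 (fun y => cexp (f y)) (cexp a).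
Proof.
intros F.
assert (H : lim0 (fun y => cexp a * (1 + (cexp (f y - a) - 1)))%C (cexp a * (1 + 0))%C).
{ apply lim0_mult; [apply lim0_const | apply lim0_plus; [apply lim0_const|]].
  intros e He.
  destruct (F (Rmin 1 (e / 4))) as (d & P & H); [apply Rmin_pos; lra|].
  exists d; split; [exact P|]; intros y Hy; specialize (H y Hy).
  assert (M1 := Rmin_l 1 (e / 4)); assert (M2 := Rmin_r 1 (e / 4)).
  replace (cexp (f y - a) - 1 - 0)%C with (cexp (f y - a) - 1)%C by ring.
  apply Rle_lt_trans with (3 * Cmod (f y - a)); [apply Cmod_cexp_minus_1|]; lra. }
intros e He; destruct (H e He) as (d & P & Hd).
exists d; split; [exact P|]; intros y Hy; specialize (Hd y Hy).
apply Rle_lt_trans with (2 := Hd); right; apply f_equal.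
replace (cexp (f y)) with (cexp a * cexp (f y - a))%C; [ring|].
rewrite <- cexp_plus; apply f_equal; ring.
Qed.

Lemma lim0_ext (f g : R -> C) (a : C) :
  (forall y, 0 < y -> f y = g y) -> lim0 f a -> lim0 g a.
Proof.
intros E F e He; destruct (F e He) as (d & P & H).
exists d; split; [exact P|]; intros y Hy.
rewrite <- E by lra; now apply H.
Qed.

Lemma lim0_Cmod_le (f : R -> C) (a : C) (B d : R) :
  0 < d -> lim0 f a -> (forall y, 0 < y <= d -> Cmod (f y) <= B) -> Cmod a <= B.
Proof.
intros Hd F H; apply le_epsilon; intros e He.
destruct (F e He) as (d' & P & Hd').
assert (Q : 0 < Rmin d (d' / 2)) by (apply Rmin_pos; lra).
assert (M1 := Rmin_l d (d' / 2)); assert (M2 := Rmin_r d (d' / 2)).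
set (y := Rmin d (d' / 2)) in *.
specialize (H y ltac:(lra)); specialize (Hd' y ltac:(lra)).
replace a with (f y - (f y - a))%C by ring.
apply Rle_trans with (1 := Cmod_triangle _ _); rewrite Cmod_opp; lra.
Qed.

Lemma lim0_unique (f : R -> C) (a b : C) : lim0 f a -> lim0 f b -> a = b.
Proof.
intros F G.
assert (H : Cmod (a + - (1) * b) <= 0).
{ apply lim0_Cmod_le with (f := fun y => (f y + - (1) * f y)%C) (d := 1); [lra | |].
  - apply lim0_plus; [exact F | apply lim0_mult; [apply lim0_const | exact G]].
  - intros y _; replace (f y + - (1) * f y)%C with (RtoC 0) by ring.
    rewrite Cmod_0; lra. }
assert (E : (a + - (1) * b)%C = 0).
{ apply Cmod_eq_0; generalize (Cmod_ge_0 (a + - (1) * b)); lra. }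
replace a with ((a + - (1) * b) + b)%C by ring; rewrite E; ring.
Qed.

Lemma lim0_Cauchy (f : R -> C) :
  (forall e, 0 < e -> exists d, 0 < d /\
     forall y y', 0 < y <= d -> 0 < y' <= d -> Cmod (f y' - f y) <= e) ->
  exists l, lim0 f l.
Proof.
intros H.
assert (R0 : forall p : C -> R, (forall w, Rabs (p w) <= Cmod w) ->
  (forall v w, p (v - w)%C = p v - p w) ->
  exists l, filterlim (fun y => p (f y)) (at_right 0) (locally l)).
{ intros p Hp Hm.
  apply (proj1 (filterlim_locally_cauchy (U := R_CompleteSpace) (F := at_right 0)
    (fun y => p (f y)))).
  intros e; destruct (H (e / 2)) as (d & Hd & Hd').
  { generalize (cond_pos e); lra. }
  exists (fun y => 0 < y <= d); split.
  - exists (mkposreal d Hd); intros y Hy H0; split; [exact H0|].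
    change (Rabs (y - 0) < d) in Hy.
    generalize (Rle_abs (y - 0)); lra.
  - intros u v Hu Hv; change (Rabs (p (f v) - p (f u)) < e).
    rewrite <- Hm; apply Rle_lt_trans with (1 := Hp _).
    generalize (Hd' u v Hu Hv), (cond_pos e); lra. }
destruct (R0 Re) as [a Ha]; [apply re_le_Cmod | reflexivity |].
destruct (R0 Im) as [b Hb]; [apply im_le_Cmod | reflexivity |].
exists (a, b); intros e He.
assert (He4 : 0 < e / 4) by lra.
destruct (proj1 (filterlim_locally _ _) Ha (mkposreal _ He4)) as [d1 H1].
destruct (proj1 (filterlim_locally _ _) Hb (mkposreal _ He4)) as [d2 H2].
exists (Rmin d1 d2); split; [apply Rmin_pos; apply cond_pos|].
intros y Hy.
assert (M1 := Rmin_l d1 d2); assert (M2 := Rmin_r d1 d2).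
assert (B : forall d, y < d -> ball 0 d y).
{ intros d Hyd; change (Rabs (y - 0) < d).
  rewrite Rabs_pos_eq; lra. }
assert (A1 := H1 y (B d1 ltac:(lra)) ltac:(lra)).
assert (A2 := H2 y (B d2 ltac:(lra)) ltac:(lra)).
change (Rabs (Re (f y) - a) < e / 4) in A1.
change (Rabs (Im (f y) - b) < e / 4) in A2.
apply Rle_lt_trans with (2 * (e / 4)); [|lra].
apply Cmod_le_components; left; [exact A1 | exact A2].
Qed.

Lemma half_open_le (tau : Rbar) (t T : R) : 0 <= t <= T -> half_open tau T -> half_open tau t.
Proof.
intros H [_ HT]; split; [lra|].
apply Rbar_le_lt_trans with (2 := HT); simpl; lra.
Qed.

Lemma half_open_extend (tau : Rbar) (t : R) : half_open tau t ->
  exists T, t < T /\ half_open tau T.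
Proof.
intros [H0 H1]; destruct tau as [s| |]; simpl in *.
- exists ((t + s) / 2); repeat split; simpl; lra.
- exists (t + 1); repeat split; simpl; lra.
- contradiction.
Qed.

(** [U t y] is the flow with value [i y] at time [t], and [gamma t] is the limit
    of its starting points as [y] decreases to 0. *)
Section TipCurve.

Context (tau : Rbar) (k : R -> R) (U : R -> R -> R -> C) (gamma : R -> C).
Context (Hk : forall T, half_open tau T ->
  (exists M, 0 < M /\ forall s, 0 <= s <= T -> Rabs (k s) <= M) /\
  continuity (fun s => k (clamp T s))).
Context (HU : forall t y, half_open tau t -> 0 < y -> tip_flow k t y (U t y)).
Context (Hg : forall t, half_open tau t -> lim0 (fun y => U t y 0) (gamma t)).

Section Integral.

Context (beta : R -> C) (L : R -> R -> C) (Lam : R -> C).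
Context (Hb : forall T, half_open tau T ->
  exists K, 0 <= K /\ forall s, 0 <= s <= T -> Cmod (beta s) <= K).
Context (HL : forall t y, half_open tau t -> 0 < y ->
  is_flow_integral beta t (U t y) (L t y)).

Lemma tip_integral_limit_exists (t : R) : half_open tau t ->
  exists l, lim0 (L t) l.
Proof.
intros Ht; apply lim0_Cauchy; intros e He.
destruct (Hk t Ht) as [(M & HM & HkM) Hkc].
destruct (Hb t Ht) as (K & HK & HbK).
destruct (flow_integral_modulus k t M (proj1 Ht) HM HkM K e HK He) as (d & Hd & H).
exists d; split; [exact Hd|]; intros y y' Hy Hy'.
apply H with (beta := beta) (t := t) (t' := t) (y := y) (y' := y')
  (U := U t y) (V := U t y'); auto; try (apply HU || apply HL); auto;
  destruct Ht; lra.
Qed.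

Context (HLam : forall t, half_open tau t -> lim0 (L t) (Lam t)).

Lemma tip_integral_uniformly_continuous (T e : R) : half_open tau T -> 0 < e ->
  exists d, 0 < d /\ forall t t', 0 <= t -> t <= t' -> t' <= T -> t' - t <= d ->
    Cmod (Lam t' - Lam t) <= e.
Proof.
intros HT He.
destruct (Hk T HT) as [(M & HM & HkM) _].
destruct (Hb T HT) as (K & HK & HbK).
destruct (flow_integral_modulus k T M (proj1 HT) HM HkM K e HK He) as (d & Hd & H).
exists d; split; [exact Hd|]; intros t t' H0 H1 H2 H3.
assert (Ht : half_open tau t) by (apply half_open_le with T; auto; lra).
assert (Ht' : half_open tau t') by (apply half_open_le with T; auto; lra).
replace (Lam t' - Lam t)%C with (Lam t' + - (1) * Lam t)%C by ring.
apply lim0_Cmod_le with (f := fun y => (L t' y + - (1) * L t y)%C) (d := d); [exact Hd | |].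
- apply lim0_plus; [now apply HLam|].
  apply lim0_mult; [apply lim0_const | now apply HLam].
- intros y Hy.
  replace (L t' y + - (1) * L t y)%C with (L t' y - L t y)%C by ring.
  apply H with (beta := beta) (t := t) (t' := t') (y := y) (y' := y)
    (U := U t y) (V := U t' y); auto; try (apply HU || apply HL); auto; try lra.
  now apply Hk.
Qed.

Lemma tip_integral_continuous (t e : R) : half_open tau t -> 0 < e ->
  exists d, 0 < d /\ forall a, half_open tau a -> Rabs (a - t) < d ->
    Cmod (Lam a - Lam t) <= e.
Proof.
intros Ht He.
destruct (half_open_extend tau t Ht) as (T & HtT & HT).
destruct (tip_integral_uniformly_continuous T e HT He) as (d & Hd & H).
exists (Rmin d (T - t)); split; [apply Rmin_pos; lra|].
intros a [Ha _] Hat.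
assert (M1 := Rmin_l d (T - t)); assert (M2 := Rmin_r d (T - t)).
apply Rabs_lt_between' in Hat.
destruct Ht; destruct (Rle_lt_dec t a).
- apply H; lra.
- rewrite Cmod_minus_sym; apply H; lra.
Qed.

Lemma tip_integral_start : half_open tau 0 -> Lam 0 = 0.
Proof.
intros H0; apply lim0_unique with (L 0); [now apply HLam|].
apply lim0_ext with (fun _ => RtoC 0); [|apply lim0_const].
intros y Hy; destruct (HL 0 y H0 Hy) as (F & F0 & _ & _ & <-).
now rewrite F0.
Qed.

End Integral.

Lemma tip_start : half_open tau 0 -> gamma 0 = 0.
Proof.
intros H0; apply lim0_unique with (fun y => U 0 y 0); [now apply Hg|].
intros e He; exists e; split; [exact He|]; intros y Hy.
destruct (HU 0 y H0 (proj1 Hy)) as (_ & _ & -> & _).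
replace ((0, y) - 0)%C with (Ci * RtoC y)%C.
- rewrite Cmod_mult, Cmod_Ci, Cmod_R, Rabs_pos_eq; lra.
- unfold Ci, Cmult, Cminus, Cplus, Copp, RtoC; simpl; apply f_equal2; ring.
Qed.

Lemma tip_Im_lower (T M t : R) : half_open tau T -> 0 < M ->
  (forall s, 0 <= s <= T -> Rabs (k s) <= M) -> 0 <= t <= T ->
  tip_rate M T * sqrt t <= Im (gamma t).
Proof.
intros HT HM HkM Ht.
assert (Ht' : half_open tau t) by (apply half_open_le with T; auto; lra).
apply le_epsilon; intros e He.
destruct (Hg t Ht' e He) as (d & Hd & H).
specialize (H (d / 2) ltac:(lra)).
assert (B : tip_rate M T * sqrt (t - 0) <= Im (U t (d / 2) 0)).
{ apply tip_flow_Im_lower with k (d / 2); auto; try lra.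
  - apply HU; [exact Ht' | lra].
  - intros; apply HkM; lra. }
rewrite Rminus_0_r in B.
assert (A := Im_le_Cmod (U t (d / 2) 0 - gamma t)); simpl in A.
unfold Im in *; lra.
Qed.

Lemma tip_Im_pos (t : R) : half_open tau t -> 0 < t -> 0 < Im (gamma t).
Proof.
intros Ht H0.
destruct (Hk t Ht) as [(M & HM & HkM) _].
assert (A := tip_Im_lower t M t Ht HM HkM ltac:(lra)).
assert (B := tip_rate_pos M t ltac:(lra)).
assert (S := sqrt_lt_R0 t H0); nra.
Qed.

Context (E : R -> R -> C) (Lam : R -> C).
Context (HE : forall t y, half_open tau t -> 0 < y ->
  is_flow_integral (fun s => RtoC (k s)) t (U t y) (E t y)).
Context (HLam : forall t, half_open tau t -> lim0 (E t) (Lam t)).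

Let k_bounded (T : R) : half_open tau T ->
  exists K, 0 <= K /\ forall s, 0 <= s <= T -> Cmod (RtoC (k s)) <= K.
Proof.
intros HT; destruct (Hk T HT) as [(M & HM & HkM) _].
exists M; split; [lra|]; intros; rewrite Cmod_R; auto.
Qed.

(** [gamma ^ 2] is strictly differentiable, with derivative [- 4 exp Lam]. *)
Lemma tip_square_derivative (t e : R) : half_open tau t -> 0 < e ->
  exists d, 0 < d /\ forall a b, half_open tau a -> half_open tau b -> a <= b ->
    Rabs (a - t) < d -> Rabs (b - t) < d ->
    Cmod (gamma b * gamma b - gamma a * gamma a + 4 * RtoC (b - a) * cexp (Lam t))
    <= e * (b - a).
Proof.
intros Ht He.
destruct (half_open_extend tau t Ht) as (T & HtT & HT).
destruct (Hk T HT) as [(M & HM & HkM) _].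
destruct (square_gap_modulus k T M (proj1 HT) HM HkM (e / 2)) as (d1 & Hd1 & H1); [lra|].
destruct (exists_small (12 * Cmod (cexp (Lam t))) (e / 2)) as (n & Hn & Hn' & _); [lra|].
destruct (tip_integral_continuous _ _ _ k_bounded HE HLam t n Ht (proj1 Hn))
  as (d2 & Hd2 & H2).
exists (Rmin (d1 / 2) (Rmin d2 (T - t))).
assert (M1 := Rmin_l (d1 / 2) (Rmin d2 (T - t))).
assert (M2 := Rmin_r (d1 / 2) (Rmin d2 (T - t))).
assert (M3 := Rmin_l d2 (T - t)); assert (M4 := Rmin_r d2 (T - t)).
split; [repeat apply Rmin_pos; lra|].
intros a b Ha Hb Hab Hat Hbt.
assert (Ba := proj1 (Rabs_lt_between' _ _ _) Hat).
assert (Bb := proj1 (Rabs_lt_between' _ _ _) Hbt).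
assert (A1 : Cmod (gamma b * gamma b + (- (1) * (gamma a * gamma a)
  + 4 * RtoC (b - a) * cexp (Lam a))) <= e / 2 * (b - a)).
{ apply lim0_Cmod_le with (d := d1)
    (f := fun y => (U b y 0 * U b y 0 + (- (1) * (U a y 0 * U a y 0)
            + 4 * RtoC (b - a) * cexp (E a y)))%C); [exact Hd1 | |].
  - apply lim0_plus; [apply lim0_mult; now apply Hg|].
    apply lim0_plus.
    + apply lim0_mult; [apply lim0_const | apply lim0_mult; now apply Hg].
    + apply lim0_mult; [apply lim0_const | now apply lim0_cexp, HLam].
  - intros y Hy.
    assert (Q := H1 a b y (U a y) (U b y) (E a y) (proj1 Ha) Hab ltac:(lra)
      ltac:(lra) Hy (proj2 (Hk a Ha)) (HU a y Ha (proj1 Hy))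
      (HU b y Hb (proj1 Hy)) (HE a y Ha (proj1 Hy))).
    apply Rle_trans with (2 := Q); right; apply f_equal; unfold square_gap; ring. }
assert (A2 := H2 a Ha ltac:(lra)).
replace (gamma b * gamma b - gamma a * gamma a + 4 * RtoC (b - a) * cexp (Lam t))%C
  with ((gamma b * gamma b + (- (1) * (gamma a * gamma a)
     + 4 * RtoC (b - a) * cexp (Lam a))) -
     4 * RtoC (b - a) * (cexp (Lam t) * (cexp (Lam a - Lam t) - 1)))%C.
2:{ replace (cexp (Lam a)) with (cexp (Lam t) * cexp (Lam a - Lam t))%C; [ring|].
    rewrite <- cexp_plus; apply f_equal; ring. }
apply Rle_trans with (1 := Cmod_triangle _ _).
rewrite Cmod_opp, !Cmod_mult, !Cmod_R, (Rabs_pos_eq 4), (Rabs_pos_eq (b - a)) by lra.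
assert (A3 : Cmod (cexp (Lam t)) * Cmod (cexp (Lam a - Lam t) - 1) <=
  Cmod (cexp (Lam t)) * (3 * n)).
{ apply Rmult_le_compat_l; [apply Cmod_ge_0|].
  apply Rle_trans with (3 * Cmod (Lam a - Lam t)); [apply Cmod_cexp_minus_1|]; lra. }
nra.
Qed.

(** Derivative of [gamma] with respect to [sqrt t].  The quotient
    [sqrt t / gamma t] tends to [1 / (2 i)] at 0. *)
Definition tip_speed (t : R) : C :=
  if Req_EM_T t 0 then (2 * Ci)%C
  else (- (4) * cexp (Lam t) * RtoC (sqrt t) / gamma t)%C.

Let tip_speed_approx_0 (e : R) : half_open tau 0 -> 0 < e ->
  exists d, 0 < d /\ forall a, half_open tau a -> Rabs (a - 0) < d ->
    Cmod (4 * cexp (Lam 0) * RtoC (sqrt a) + 2 * Ci * gamma a) <= e * sqrt a.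
Proof.
intros H0 He.
destruct (tip_square_derivative 0 e H0 He) as (d & Hd & H).
exists d; split; [exact Hd|]; intros a Ha Had.
assert (H' := H 0 a H0 Ha (proj1 Ha) ltac:(rewrite Rminus_0_r, Rabs_R0; lra) Had).
rewrite tip_start in H' by exact H0.
rewrite (tip_integral_start _ _ _ HE HLam H0), cexp_0 in *.
rewrite Rminus_0_r in H'.
assert (Sa := sqrt_pos a).
assert (Sq : sqrt a * sqrt a = a) by (apply sqrt_sqrt, Ha).
assert (Ig : 0 <= Im (gamma a)).
{ destruct (Hk a Ha) as [(M & HM & HkM) _].
  assert (A := tip_Im_lower a M a Ha HM HkM ltac:(destruct Ha; lra)).
  assert (B := tip_rate_pos M a (proj1 Ha)); nra. }
destruct (Rle_lt_or_eq_dec _ _ Sa) as [Sp|Sz].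
- set (w := (gamma a + 2 * Ci * RtoC (sqrt a))%C).
  assert (Hw : 2 * sqrt a <= Cmod w).
  { apply Rle_trans with (2 := Im_le_Cmod w).
    unfold w, Ci, Cplus, Cmult, RtoC, Im in *; simpl in *; lra. }
  assert (Hw0 : w <> 0) by (apply Cmod_gt_0; lra).
  assert (Hi : (Ci * Ci)%C = (- (1))%C).
  { unfold Ci, Cmult, Copp, RtoC; simpl; apply f_equal2; ring. }
  replace (4 * 1 * RtoC (sqrt a) + 2 * Ci * gamma a)%C with
    (2 * Ci * (gamma a * gamma a + 4 * RtoC a) / w)%C.
  + apply Rle_trans with (2 * (e * a) / (2 * sqrt a)).
    * apply Cmod_div_le; [lra | | exact Hw].
      rewrite !Cmod_mult, Cmod_Ci, Cmod_R, (Rabs_pos_eq 2) by lra.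
      assert (Cmod (gamma a * gamma a + 4 * a) <= e * a); [|lra].
      apply Rle_trans with (2 := H'); right; apply f_equal; ring.
    * right; rewrite <- Sq at 1; field; lra.
  + (* [(gamma - 2 i sqrt a) (gamma + 2 i sqrt a) = gamma ^ 2 + 4 a] *)
    replace (RtoC a) with (RtoC (sqrt a) * RtoC (sqrt a))%C
      by (rewrite <- RtoC_mult, Sq; reflexivity).
    replace (gamma a * gamma a + 4 * (RtoC (sqrt a) * RtoC (sqrt a)))%C with
      ((gamma a - 2 * Ci * RtoC (sqrt a)) * w)%C.
    * replace (4 * 1 * RtoC (sqrt a) + 2 * Ci * gamma a)%C with
        (2 * Ci * gamma a - 4 * - (1) * RtoC (sqrt a))%C by ring.
      rewrite <- Hi; field; exact Hw0.
    * unfold w.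
      replace ((gamma a - 2 * Ci * RtoC (sqrt a)) * (gamma a + 2 * Ci * RtoC (sqrt a)))%C
        with (gamma a * gamma a - 4 * (Ci * Ci) * (RtoC (sqrt a) * RtoC (sqrt a)))%C by ring.
      rewrite Hi; ring.
- assert (Ea : a = 0) by (rewrite <- Sq, <- Sz; ring).
  rewrite Ea, tip_start, sqrt_0 by exact H0.
  replace (4 * 1 * 0 + 2 * Ci * 0)%C with (RtoC 0) by ring.
  rewrite Cmod_0; lra.
Qed.

Let tip_speed_approx_pos (t e : R) : half_open tau t -> 0 < t -> 0 < e ->
  exists d, 0 < d /\ forall a, half_open tau a -> Rabs (a - t) < d ->
    Cmod (4 * cexp (Lam t) * RtoC (sqrt a) +
          (- (4) * cexp (Lam t) * RtoC (sqrt t) / gamma t) * gamma a) <= e * sqrt a.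
Proof.
intros Ht H0 He.
assert (Ig := tip_Im_pos t Ht H0).
assert (Hg0 := Im_pos_neq_0 _ Ig).
destruct (tip_square_derivative t 1 Ht Rlt_0_1) as (d1 & Hd1 & H1).
set (P := 4 * Cmod (cexp (Lam t))).
assert (PP : 0 <= P) by (unfold P; generalize (Cmod_ge_0 (cexp (Lam t))); lra).
assert (St := sqrt_lt_R0 t H0).
assert (Sh : 0 < sqrt (t / 2)) by (apply sqrt_lt_R0; lra).
set (B := P * (/ sqrt t + sqrt t / Im (gamma t) * ((1 + P) / Im (gamma t)))).
destruct (exists_small B (e * sqrt (t / 2))) as (d2 & Hd2 & HB & _); [nra|].
exists (Rmin (t / 2) (Rmin d1 d2)).
assert (M1 := Rmin_l (t / 2) (Rmin d1 d2)).
assert (M2 := Rmin_r (t / 2) (Rmin d1 d2)).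
assert (M3 := Rmin_l d1 d2); assert (M4 := Rmin_r d1 d2).
split; [repeat apply Rmin_pos; lra|].
intros a Ha Hat.
assert (Ba := proj1 (Rabs_lt_between' _ _ _) Hat).
assert (Iga := tip_Im_pos a Ha ltac:(lra)).
assert (Sa : 0 < sqrt a) by (apply sqrt_lt_R0; lra).
assert (Sha : sqrt (t / 2) <= sqrt a) by (apply sqrt_le_1_alt; lra).
assert (D1 : Rabs (sqrt a - sqrt t) <= Rabs (a - t) / sqrt t).
{ replace (a - t) with ((sqrt a - sqrt t) * (sqrt a + sqrt t)).
  2:{ rewrite <- (sqrt_sqrt a) at 3 by lra.
      rewrite <- (sqrt_sqrt t) at 3 by lra; ring. }
  rewrite Rabs_mult, (Rabs_pos_eq (sqrt a + sqrt t)) by lra.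
  apply Rmult_le_reg_r with (1 := St).
  unfold Rdiv; rewrite Rmult_assoc, Rinv_l, Rmult_1_r by lra.
  apply Rmult_le_compat_l; [apply Rabs_pos | lra]. }
assert (D2 : Cmod (gamma a * gamma a - gamma t * gamma t) <= (1 + P) * Rabs (a - t)).
{ assert (Tr : forall x y, half_open tau x -> half_open tau y -> x <= y ->
    Rabs (x - t) < d1 -> Rabs (y - t) < d1 ->
    Cmod (gamma y * gamma y - gamma x * gamma x) <= (1 + P) * (y - x)).
  { intros x y Hx Hy Hxy Hxt Hyt.
    assert (Q := H1 x y Hx Hy Hxy Hxt Hyt).
    replace (gamma y * gamma y - gamma x * gamma x)%C with
      ((gamma y * gamma y - gamma x * gamma x + 4 * RtoC (y - x) * cexp (Lam t))
       - 4 * RtoC (y - x) * cexp (Lam t))%C by ring.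
    apply Rle_trans with (1 := Cmod_triangle _ _).
    rewrite Cmod_opp, !Cmod_mult, !Cmod_R, (Rabs_pos_eq 4), (Rabs_pos_eq (y - x)) by lra.
    unfold P; lra. }
  assert (Rabs (t - t) < d1) by (rewrite Rminus_diag, Rabs_R0; lra).
  destruct (Rle_lt_dec t a).
  - rewrite (Rabs_pos_eq (a - t)) by lra; apply Tr; auto; lra.
  - rewrite Cmod_minus_sym, Rabs_minus_sym, (Rabs_pos_eq (t - a)) by lra.
    apply Tr; auto; lra. }
assert (D3 : Cmod (gamma a - gamma t) <= (1 + P) * Rabs (a - t) / Im (gamma t)).
{ assert (Hs : Im (gamma t) <= Cmod (gamma a + gamma t)).
  { apply Rle_trans with (2 := Im_le_Cmod _); simpl; unfold Im in *; lra. }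
  replace (gamma a - gamma t)%C with
    ((gamma a * gamma a - gamma t * gamma t) / (gamma a + gamma t))%C.
  - now apply Cmod_div_le.
  - field; apply Cmod_gt_0; lra. }
replace (4 * cexp (Lam t) * RtoC (sqrt a) +
  - (4) * cexp (Lam t) * RtoC (sqrt t) / gamma t * gamma a)%C with
  (4 * cexp (Lam t) * (RtoC (sqrt a - sqrt t)
    - RtoC (sqrt t) / gamma t * (gamma a - gamma t)))%C.
2:{ unfold Rminus; rewrite RtoC_plus, RtoC_opp; field; exact Hg0. }
rewrite !Cmod_mult, Cmod_R, (Rabs_pos_eq 4) by lra; fold P.
apply Rle_trans with (P * (Rabs (a - t) / sqrt t +
  sqrt t / Im (gamma t) * ((1 + P) * Rabs (a - t) / Im (gamma t)))).
- apply Rmult_le_compat_l; [exact PP|].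
  apply Rle_trans with (1 := Cmod_triangle _ _).
  rewrite Cmod_opp, Cmod_mult, Cmod_R.
  apply Rplus_le_compat; [exact D1|].
  apply Rmult_le_compat; auto using Cmod_ge_0.
  apply Cmod_div_le; [exact Ig | | apply Im_le_Cmod].
  rewrite Cmod_R, Rabs_pos_eq; lra.
- replace (P * (Rabs (a - t) / sqrt t +
    sqrt t / Im (gamma t) * ((1 + P) * Rabs (a - t) / Im (gamma t))))
    with (B * Rabs (a - t)) by (unfold B; field; lra).
  apply Rle_trans with (B * d2).
  + apply Rmult_le_compat_l; [|lra].
    unfold B; apply Rmult_le_pos; [exact PP|].
    apply Rplus_le_le_0_compat; [left; now apply Rinv_0_lt_compat|].
    apply Rmult_le_pos; (apply Rmult_le_pos; [lra | left; now apply Rinv_0_lt_compat]).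
  + apply Rle_trans with (1 := HB).
    apply Rmult_le_compat_l; lra.
Qed.

Lemma tip_speed_approx (t e : R) : half_open tau t -> 0 < e ->
  exists d, 0 < d /\ forall a, half_open tau a -> Rabs (a - t) < d ->
    Cmod (4 * cexp (Lam t) * RtoC (sqrt a) + tip_speed t * gamma a) <= e * sqrt a.
Proof.
intros Ht He; unfold tip_speed.
destruct (Req_EM_T t 0) as [E0|N0].
- rewrite E0 in *; now apply tip_speed_approx_0.
- apply tip_speed_approx_pos; auto; destruct Ht; lra.
Qed.

(** [gamma] is strictly differentiable with respect to [sqrt t]. *)
Lemma tip_sqrt_derivative (t e : R) : half_open tau t -> 0 < e ->
  exists d, 0 < d /\ forall a b, half_open tau a -> half_open tau b -> a <= b ->
    Rabs (a - t) < d -> Rabs (b - t) < d ->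
    Cmod (gamma b - gamma a - tip_speed t * RtoC (sqrt b - sqrt a))
    <= e * (sqrt b - sqrt a).
Proof.
intros Ht He.
destruct (half_open_extend tau t Ht) as (T & HtT & HT).
destruct (Hk T HT) as [(M & HM & HkM) _].
assert (Pc := tip_rate_pos M T (proj1 HT)).
set (c := tip_rate M T) in *.
destruct (tip_square_derivative t (e * c / 2) Ht) as (d1 & Hd1 & H1).
{ apply Rdiv_lt_0_compat; nra. }
destruct (tip_speed_approx t (e * c / 2) Ht) as (d2 & Hd2 & H2).
{ apply Rdiv_lt_0_compat; nra. }
exists (Rmin (T - t) (Rmin d1 d2)).
assert (M1 := Rmin_l (T - t) (Rmin d1 d2)).
assert (M2 := Rmin_r (T - t) (Rmin d1 d2)).
assert (M3 := Rmin_l d1 d2); assert (M4 := Rmin_r d1 d2).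
split; [repeat apply Rmin_pos; lra|].
intros a b Ha Hb Hab Hat Hbt.
assert (Ba := proj1 (Rabs_lt_between' _ _ _) Hat).
assert (Bb := proj1 (Rabs_lt_between' _ _ _) Hbt).
assert (Ha0 := proj1 Ha).
assert (Sa := sqrt_pos a); assert (Sb := sqrt_pos b).
assert (Qa : sqrt a * sqrt a = a) by (apply sqrt_sqrt; lra).
assert (Qb : sqrt b * sqrt b = b) by (apply sqrt_sqrt; lra).
assert (Sab : sqrt a <= sqrt b) by (apply sqrt_le_1_alt; lra).
destruct (Rle_lt_or_eq_dec _ _ Sb) as [Sbp|Sb0].
- assert (Ia : c * sqrt a <= Im (gamma a)) by (apply tip_Im_lower; auto; lra).
  assert (Ib : c * sqrt b <= Im (gamma b)) by (apply tip_Im_lower; auto; lra).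
  assert (Hs : c * (sqrt a + sqrt b) <= Cmod (gamma a + gamma b)).
  { apply Rle_trans with (2 := Im_le_Cmod _); simpl; unfold Im in *; lra. }
  assert (Hs0 : 0 < c * (sqrt a + sqrt b)) by nra.
  set (X := (4 * cexp (Lam t) * RtoC (sqrt a) + tip_speed t * gamma a)%C).
  set (Y := (4 * cexp (Lam t) * RtoC (sqrt b) + tip_speed t * gamma b)%C).
  set (Z := (gamma b * gamma b - gamma a * gamma a
             + 4 * RtoC (b - a) * cexp (Lam t))%C).
  assert (HX : Cmod X <= e * c / 2 * sqrt a) by (apply H2; auto; lra).
  assert (HY : Cmod Y <= e * c / 2 * sqrt b) by (apply H2; auto; lra).
  assert (HZ : Cmod Z <= e * c / 2 * (b - a)) by (apply H1; auto; lra).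
  replace (gamma b - gamma a - tip_speed t * RtoC (sqrt b - sqrt a))%C with
    ((Z - RtoC (sqrt b - sqrt a) * (X + Y)) / (gamma a + gamma b))%C.
  + apply Rle_trans with (e * c * (sqrt b - sqrt a) * (sqrt a + sqrt b) /
      (c * (sqrt a + sqrt b))).
    * apply Cmod_div_le; [exact Hs0 | | exact Hs].
      apply Rle_trans with (1 := Cmod_triangle _ _).
      rewrite Cmod_opp, Cmod_mult, Cmod_R, (Rabs_pos_eq (sqrt b - sqrt a)) by lra.
      assert (HXY := Cmod_triangle X Y).
      replace (b - a) with ((sqrt b - sqrt a) * (sqrt a + sqrt b)) in HZ
        by (transitivity (sqrt b * sqrt b - sqrt a * sqrt a); [ring | lra]).
      assert ((sqrt b - sqrt a) * Cmod (X + Y) <=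
        (sqrt b - sqrt a) * (e * c / 2 * (sqrt a + sqrt b))).
      { apply Rmult_le_compat_l; lra. }
      lra.
    * right; field; lra.
  + assert (Hab' : RtoC (b - a) =
      ((RtoC (sqrt b) - RtoC (sqrt a)) * (RtoC (sqrt a) + RtoC (sqrt b)))%C).
    { rewrite <- RtoC_minus, <- RtoC_plus, <- RtoC_mult; apply f_equal.
      transitivity (sqrt b * sqrt b - sqrt a * sqrt a); [lra | ring]. }
    unfold X, Y, Z; rewrite Hab', RtoC_minus.
    field; apply Cmod_gt_0; lra.
- assert (Eb : b = 0) by (rewrite <- Qb, <- Sb0; ring).
  assert (Ea : a = b) by lra.
  rewrite Ea, !Rminus_diag.
  replace (gamma b - gamma b - tip_speed t * 0)%C with (RtoC 0) by ring.
  rewrite Cmod_0; lra.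
Qed.

Lemma tip_speed_neq_0 (t : R) : half_open tau t -> tip_speed t <> 0.
Proof.
intros Ht; unfold tip_speed; destruct (Req_EM_T t 0) as [E0|N0].
- intros H; apply (f_equal Im) in H.
  unfold Ci, Cmult, RtoC, Im in H; simpl in H; lra.
- assert (H0 : 0 < t) by (destruct Ht; lra).
  assert (S := sqrt_lt_R0 t H0).
  assert (Hg0 : gamma t <> 0) by (apply Im_pos_neq_0, tip_Im_pos; auto).
  apply Cmult_neq_0.
  2:{ apply Cmod_gt_0; rewrite Cmod_inv by exact Hg0.
      now apply Rinv_0_lt_compat, Cmod_gt_0. }
  apply Cmult_neq_0; [apply Cmult_neq_0; [|apply cexp_neq_0]|].
  + intros H; apply (f_equal Re) in H; simpl in H; lra.
  + intros H; apply (f_equal Re) in H; simpl in H; lra.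
Qed.

(** The direction of the curve. *)
Lemma tip_speed_direction (t : R) : half_open tau t -> 0 < t ->
  (tip_speed t / RtoC (Cmod (tip_speed t)))%C =
  cis (PI - argH (gamma t) + Im (Lam t)).
Proof.
intros Ht H0.
assert (Ig := tip_Im_pos t Ht H0).
destruct (argH_spec _ Ig) as [_ Hg'].
assert (S := sqrt_lt_R0 t H0).
assert (Pg : 0 < Cmod (gamma t)) by now apply Cmod_gt_0, Im_pos_neq_0.
set (r := 4 * exp (Re (Lam t)) * sqrt t / Cmod (gamma t)).
assert (Hr : 0 < r).
{ apply Rdiv_lt_0_compat; [|exact Pg].
  generalize (exp_pos (Re (Lam t))); nra. }
assert (Ev : tip_speed t = (RtoC r * cis (PI - argH (gamma t) + Im (Lam t)))%C).
{ unfold tip_speed; destruct (Req_EM_T t 0) as [E0|N0]; [lra|].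
  assert (Hc : cis (argH (gamma t)) <> 0).
  { apply Cmod_gt_0; rewrite Cmod_cis; lra. }
  assert (Hn : RtoC (Cmod (gamma t)) <> 0).
  { intros H; apply (f_equal Re) in H; simpl in H; lra. }
  assert (Ea : (cis (PI - argH (gamma t) + Im (Lam t)) * cis (argH (gamma t)))%C =
    (- cis (Im (Lam t)))%C).
  { set (x := argH (gamma t)); set (z := Im (Lam t)).
    transitivity (cis (PI + z)).
    - replace (PI + z) with ((PI - x + z) + x) by ring.
      unfold cis, Cmult; simpl; rewrite (cos_plus _ x), (sin_plus _ x).
      apply f_equal2; ring.
    - unfold cis, Copp; simpl.
      rewrite (Rplus_comm PI), neg_cos, neg_sin; reflexivity. }
  rewrite Hg' at 1.
  unfold cexp, r, Rdiv.
  rewrite !RtoC_mult, RtoC_inv by lra.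
  replace (cis (Im (Lam t))) with
    (- (cis (PI - argH (gamma t) + Im (Lam t)) * cis (argH (gamma t))))%C
    by (rewrite Ea; ring).
  field; split; assumption. }
rewrite Ev, Cmod_mult, Cmod_cis, Cmod_R, Rabs_pos_eq, Rmult_1_r by lra.
field; intros H; apply (f_equal Re) in H; simpl in H; lra.
Qed.

End TipCurve.

(** * Derivatives and continuity along an interval *)

Lemma is_derive_on_is_derive {V : NormedModule R_AbsRing}
  (I : R -> Prop) (f : R -> V) (t : R) (l : V) :
  locally t I -> is_derive_on I f t l -> is_derive f t l.
Proof.
intros HI [Hl Hd]; split; [exact Hl|].
intros x Hx e.
assert (Hx' : is_filter_lim (within I (locally t)) x).
{ intros P HP; apply filter_imp with (2 := Hx P HP); auto. }
generalize (filter_and _ _ HI (Hd x Hx' e)).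
apply filter_imp; intros y [H1 H2]; now apply H2.
Qed.

Lemma is_derive_on_is_Cderive (I : R -> Prop) (f : R -> C) (t : R) (l : C) :
  locally t I -> is_derive_on (V := C_R_NormedModule) I f t l -> is_Cderive f t l.
Proof.
intros HI H.
assert (D : is_derive (V := C_R_NormedModule) f t l)
  by now apply is_derive_on_is_derive with I.
split.
- apply (filterdiff_comp (U := AbsRing_NormedModule R_AbsRing)
    (V := C_R_NormedModule) (W := R_NormedModule) f (fst (A := R) (B := R))
    (fun y : R => scal y (l : C_R_NormedModule)) (fst (A := R) (B := R)) D).
  apply filterdiff_linear, (is_linear_fst (U := R_NormedModule) (V := R_NormedModule)).
- apply (filterdiff_comp (U := AbsRing_NormedModule R_AbsRing)
    (V := C_R_NormedModule) (W := R_NormedModule) f (snd (A := R) (B := R))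
    (fun y : R => scal y (l : C_R_NormedModule)) (snd (A := R) (B := R)) D).
  apply filterdiff_linear, (is_linear_snd (U := R_NormedModule) (V := R_NormedModule)).
Qed.

Lemma is_derive_on_continuous {V : NormedModule R_AbsRing}
  (I : R -> Prop) (f : R -> V) (t : R) (l : V) :
  is_derive_on I f t l -> filterlim f (within I (locally t)) (locally (f t)).
Proof.
intros H.
apply (filterdiff_continuous_aux (U := AbsRing_NormedModule R_AbsRing) f).
- eexists; exact H.
- intros P HP; apply filter_le_within; exact HP.
Qed.

Lemma within_segment_clamp (f : R -> R) (I : R -> Prop) (T : R) :
  0 <= T -> (forall s, 0 <= s <= T -> I s) ->
  (forall s, 0 <= s <= T -> filterlim f (within I (locally s)) (locally (f s))) ->
  continuity (fun s => f (clamp T s)).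
Proof.
intros HT HI H s; apply continuity_pt_filterlim.
apply filterlim_comp with (2 := H (clamp T s) (clamp_bounds T s HT)).
intros P HP; unfold filtermap.
assert (Hc := proj1 (continuity_pt_filterlim _ _) (clamp_continuity T s) _ HP).
unfold filtermap in Hc.
revert Hc; apply filter_imp; intros r Hr; apply Hr, HI, clamp_bounds, HT.
Qed.

Lemma within_segment_Cclamp (f : R -> C) (I : R -> Prop) (T : R) :
  0 <= T -> (forall s, 0 <= s <= T -> I s) ->
  (forall s, 0 <= s <= T ->
     filterlim f (within I (locally s)) (locally (T := C_UniformSpace) (f s))) ->
  Ccontinuity (fun s => f (clamp T s)).
Proof.
intros HT HI H; split.
- apply (within_segment_clamp (fun s => Re (f s)) I T HT HI).
  intros s Hs; apply filterlim_comp with (1 := H s Hs).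
  destruct (f s) as [a b]; apply (continuous_fst a b).
- apply (within_segment_clamp (fun s => Im (f s)) I T HT HI).
  intros s Hs; apply filterlim_comp with (1 := H s Hs).
  destruct (f s) as [a b]; apply (continuous_snd a b).
Qed.

Lemma is_derive_on_of_estimate (I : R -> Prop) (f : R -> C) (t : R) (l : C) :
  (forall e, 0 < e -> exists d, 0 < d /\ forall s, I s -> Rabs (s - t) < d ->
     Cmod (f s - f t - l * RtoC (s - t)) <= e * Rabs (s - t)) ->
  I t -> is_derive_on (V := C_R_NormedModule) I f t l.
Proof.
intros H It; split.
- apply (is_linear_scal_l (V := C_R_NormedModule) l).
- intros x Hx e.
  assert (PF : ProperFilter (within I (locally t))).
  { split; [|apply within_filter, locally_filter].
    intros P [d Hd]; exists t; apply Hd; [apply ball_center | exact It]. }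
  assert (Ex : x = t).
  { symmetry; apply (is_filter_lim_unique (K := R_AbsRing)
      (V := AbsRing_NormedModule R_AbsRing) (F := within I (locally t))).
    - intros P HP; apply filter_le_within; exact HP.
    - exact Hx. }
  rewrite Ex; clear x Hx Ex.
  destruct (H e (cond_pos e)) as (d & Hd & He).
  exists (mkposreal d Hd); intros s Hs Is.
  assert (Hst : Rabs (s - t) < d) by exact Hs.
  specialize (He s Is Hst).
  rewrite <- Cmod_norm.
  apply Rle_trans with (2 := He); right; apply f_equal.
  rewrite scal_R_Cmult.
  unfold minus, plus, opp; simpl.
  change (f s + - f t + - (RtoC (s + - t) * l) =
    f s - f t - l * RtoC (s - t))%C.
  unfold Rminus; ring.
Qed.

Lemma Ccontinuous_on_of_estimate (I : R -> Prop) (f : R -> C) :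
  (forall t, I t -> forall e, 0 < e -> exists d, 0 < d /\
     forall s, I s -> Rabs (s - t) < d -> Cmod (f s - f t) < e) ->
  continuous_on (T := R_UniformSpace) (U := C_UniformSpace) I f.
Proof.
intros H t It; apply filterlim_locally; intros e.
destruct (H t It e (cond_pos e)) as (d & Hd & Hd').
exists (mkposreal d Hd); intros s Hs Is.
apply C_NormedModule_mixin_compat1, (Hd' s Is Hs).
Qed.

Lemma continuous_on_of_estimate (I : R -> Prop) (f : R -> R) :
  (forall t, I t -> forall e, 0 < e -> exists d, 0 < d /\
     forall s, I s -> Rabs (s - t) < d -> Rabs (f s - f t) < e) ->
  continuous_on (T := R_UniformSpace) (U := R_UniformSpace) I f.
Proof.
intros H t It; apply filterlim_locally; intros e.
destruct (H t It e (cond_pos e)) as (d & Hd & Hd').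
exists (mkposreal d Hd); intros s Hs Is; exact (Hd' s Is Hs).
Qed.

Lemma half_open_locally (T : Rbar) (t : R) : 0 < t -> Rbar_lt t T ->
  locally t (half_open T).
Proof.
intros H0 H1.
assert (H2 : locally t (fun s => Rbar_lt s T)) by now apply open_Rbar_lt.
generalize (filter_and _ _ (open_gt 0 t H0) H2).
apply filter_imp; intros s [A B]; split; [lra | exact B].
Qed.

(** * Length of curves *)

Lemma chain_bounds (t : nat -> R) (n : nat) :
  (forall i, (i <= n)%nat -> t i <= t (S i)) ->
  forall i, (i <= S n)%nat -> t 0%nat <= t i <= t (S n).
Proof.
intros H.
assert (Up : forall i, (i <= S n)%nat -> t 0%nat <= t i).
{ induction i as [|i IH]; intros Hi; [lra|].
  apply Rle_trans with (t i); [apply IH | apply H]; lia. }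
assert (Dn : forall j, (j <= S n)%nat -> t (S n - j)%nat <= t (S n)).
{ induction j as [|j IH]; intros Hj.
  - rewrite Nat.sub_0_r; lra.
  - apply Rle_trans with (t (S n - j)%nat); [|apply IH; lia].
    replace (S n - j)%nat with (S (S n - S j)) by lia.
    apply H; lia. }
intros i Hi; split; [now apply Up|].
replace i with (S n - (S n - i))%nat by lia; apply Dn; lia.
Qed.

Lemma sum_telescope_le (f g phi : nat -> R) (n : nat) :
  (forall i, (i <= n)%nat -> f i <= g i + (phi (S i) - phi i)) ->
  sum_f_R0 f n <= sum_f_R0 g n + (phi (S n) - phi 0%nat).
Proof.
induction n as [|n IH]; intros H; simpl.
- apply H; lia.
- assert (A := H (S n) ltac:(lia)).
  assert (B := IH ltac:(intros; apply H; lia)); lra.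
Qed.

(** Adding the end point [b] to a polygon over [[0, a]]. *)
Lemma curve_length_lower (gamma : R -> C) (a b la lb : R) :
  0 <= a -> a <= b -> is_curve_length gamma 0 a la -> is_curve_length gamma 0 b lb ->
  Cmod (gamma b - gamma a) <= lb - la.
Proof.
intros H0 Hab [_ Ha] [Hb _].
enough (la <= lb - Cmod (gamma b - gamma a)) by lra.
apply Ha; intros l (n & t & T0 & Tn & Tm & ->).
enough (sum_f_R0 (fun i => Cmod (gamma (t (S i)) - gamma (t i))) n
  + Cmod (gamma b - gamma a) <= lb) by lra.
apply Hb; exists (S n), (fun i => if le_lt_dec i (S n) then t i else b).
assert (E : forall i, (i <= S n)%nat ->
  (if le_lt_dec i (S n) then t i else b) = t i).
{ intros i Hi; destruct (le_lt_dec i (S n)); [reflexivity | lia]. }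
split; [rewrite E by lia; exact T0 | split; [|split]].
- destruct (le_lt_dec (S (S n)) (S n)); [lia | reflexivity].
- intros i Hi; rewrite E by lia.
  destruct (le_lt_dec (S i) (S n)); [apply Tm; lia|].
  replace i with (S n) by lia; lra.
- rewrite tech5; apply f_equal2.
  + apply sum_eq; intros i Hi; rewrite !E by lia; reflexivity.
  + rewrite (E (S n)), Tn by lia.
    destruct (le_lt_dec (S (S n)) (S n)); [lia | reflexivity].
Qed.

(** A modulus of continuity [K (phi y - phi x)] bounds the length. *)
Lemma curve_length_upper (gamma : R -> C) (phi : R -> R) (K a b la lb : R) :
  0 <= a -> a <= b -> is_curve_length gamma 0 a la -> is_curve_length gamma 0 b lb ->
  (forall x y, a <= x -> x <= y -> y <= b ->
     Cmod (gamma y - gamma x) <= K * (phi y - phi x)) ->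
  lb - la <= K * (phi b - phi a).
Proof.
intros H0 Hab [Ha _] [_ Hb] HK.
enough (lb <= la + K * (phi b - phi a)) by lra.
apply Hb; intros l (n & t & T0 & Tn & Tm & ->).
assert (Bt := chain_bounds t n Tm); rewrite T0, Tn in Bt.
(* Cut every step at [a]: the lower parts form a polygon over [[0, a]]. *)
assert (S1 := sum_telescope_le (fun i => Cmod (gamma (t (S i)) - gamma (t i)))
  (fun i => Cmod (gamma (Rmin (t (S i)) a) - gamma (Rmin (t i) a)))
  (fun i => K * phi (Rmax (t i) a)) n).
assert (S2 : sum_f_R0 (fun i => Cmod (gamma (t (S i)) - gamma (t i))) n <=
  sum_f_R0 (fun i => Cmod (gamma (Rmin (t (S i)) a) - gamma (Rmin (t i) a))) n +
  (K * phi (Rmax (t (S n)) a) - K * phi (Rmax (t 0%nat) a))).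
{ apply S1; intros i Hi.
  assert (Hm := Tm i Hi).
  assert (B1 := Bt i ltac:(lia)); assert (B2 := Bt (S i) ltac:(lia)).
  destruct (Rle_lt_dec (t (S i)) a) as [C1|C1].
  - rewrite !Rmin_left, !Rmax_right by lra; lra.
  - rewrite (Rmin_right (t (S i))), (Rmax_left (t (S i))) by lra.
    destruct (Rle_lt_dec (t i) a) as [C2|C2].
    + rewrite Rmin_left, Rmax_right by lra.
      apply Rle_trans with (1 := Cmod_minus_triangle _ (gamma a) _).
      assert (Q := HK a (t (S i)) ltac:(lra) ltac:(lra) ltac:(lra)); lra.
    + rewrite Rmin_right, Rmax_left by lra.
      replace (gamma a - gamma a)%C with (RtoC 0) by ring; rewrite Cmod_0.
      assert (Q := HK (t i) (t (S i)) ltac:(lra) ltac:(lra) ltac:(lra)); lra. }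
rewrite T0, Tn, Rmax_left, Rmax_right in S2 by lra.
enough (sum_f_R0 (fun i => Cmod (gamma (Rmin (t (S i)) a) - gamma (Rmin (t i) a))) n
  <= la) by lra.
apply Ha; exists n, (fun i => Rmin (t i) a); repeat split.
- rewrite T0, Rmin_left; lra.
- rewrite Tn, Rmin_right; lra.
- intros i Hi; apply Rle_min_compat_r, Tm, Hi.
Qed.

Lemma curve_length_point (gamma : R -> C) (a l : R) :
  is_curve_length gamma a a l -> l = 0.
Proof.
intros [H1 H2]; apply Rle_antisym.
- apply H2; intros p (n & t & T0 & Tn & Tm & ->).
  assert (B := chain_bounds t n Tm); rewrite T0, Tn in B.
  right; rewrite <- (sum_eq_R0 (fun _ => 0) n) by reflexivity.
  apply sum_eq; intros i Hi.
  replace (t (S i)) with (t i).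
  + replace (gamma (t i) - gamma (t i))%C with (RtoC 0) by ring; apply Cmod_0.
  + generalize (B i ltac:(lia)), (B (S i) ltac:(lia)); lra.
- apply H1; exists 0%nat, (fun _ => a).
  do 2 (split; [reflexivity|]); split; [intros; lra|]; simpl.
  replace (gamma a - gamma a)%C with (RtoC 0) by ring.
  symmetry; apply Cmod_0.
Qed.

(** * Arc-length parametrization *)

(** [v] is the velocity of [gamma] with respect to [sqrt t], [w] its direction,
    [sigma] the length of [gamma] and [tinv] the inverse of [sigma]. *)
Section ArcLength.

Context (tau L : Rbar) (gamma v eta : R -> C) (sigma : R -> R).
Context (Hv : forall t, half_open tau t -> v t <> 0).
Context (Hd : forall t e, half_open tau t -> 0 < e ->
  exists d, 0 < d /\ forall a b, half_open tau a -> half_open tau b -> a <= b ->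
    Rabs (a - t) < d -> Rabs (b - t) < d ->
    Cmod (gamma b - gamma a - v t * RtoC (sqrt b - sqrt a))
    <= e * (sqrt b - sqrt a)).
Context (Hsig : forall t, half_open tau t ->
  is_curve_length gamma 0 t (sigma t) /\ eta (sigma t) = gamma t).

Let w (t : R) : C := (v t / RtoC (Cmod (v t)))%C.

Lemma arc_length_derivative (t e : R) : half_open tau t -> 0 < e ->
  exists d, 0 < d /\ forall a b, half_open tau a -> half_open tau b -> a <= b ->
    Rabs (a - t) < d -> Rabs (b - t) < d ->
    (a < b -> sigma a < sigma b) /\
    Cmod (gamma b - gamma a - w t * RtoC (sigma b - sigma a))
    <= e * (sigma b - sigma a).
Proof.
intros Ht He.
assert (Pp : 0 < Cmod (v t)) by (apply Cmod_gt_0; auto).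
set (p := Cmod (v t)) in *.
set (e' := Rmin (1 / 2) (e / 4)).
assert (E0 : 0 < e') by (apply Rmin_pos; lra).
assert (E1 : e' <= 1 / 2) by apply Rmin_l.
assert (E2 : e' <= e / 4) by apply Rmin_r.
destruct (Hd t (e' * p) Ht ltac:(nra)) as (d & Hd0 & H).
exists d; split; [exact Hd0|]; intros a b Ha Hb Hab Hat Hbt.
assert (S0 : sqrt a <= sqrt b) by (apply sqrt_le_1_alt, Hab).
assert (G := H a b Ha Hb Hab Hat Hbt).
assert (Lo := curve_length_lower gamma a b _ _ (proj1 Ha) Hab
  (proj1 (Hsig a Ha)) (proj1 (Hsig b Hb))).
assert (Up : sigma b - sigma a <= (1 + e') * p * (sqrt b - sqrt a)).
{ apply (curve_length_upper gamma sqrt _ a b _ _ (proj1 Ha) Hab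
    (proj1 (Hsig a Ha)) (proj1 (Hsig b Hb))).
  intros x y Hx Hxy Hy.
  assert (Ix : half_open tau x).
  { destruct Ha; destruct Hb; split; [lra|].
    apply Rbar_le_lt_trans with b; [simpl; lra | assumption]. }
  assert (Iy : half_open tau y).
  { destruct Ha; destruct Hb; split; [lra|].
    apply Rbar_le_lt_trans with b; [simpl; lra | assumption]. }
  assert (Q := H x y Ix Iy Hxy
    ltac:(apply Rabs_lt_between'; apply Rabs_lt_between' in Hat, Hbt; lra)
    ltac:(apply Rabs_lt_between'; apply Rabs_lt_between' in Hat, Hbt; lra)).
  assert (Sxy : sqrt x <= sqrt y) by (apply sqrt_le_1_alt, Hxy).
  replace (gamma y - gamma x)%C with ((gamma y - gamma x - v t * RtoC (sqrt y - sqrt x))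
    + v t * RtoC (sqrt y - sqrt x))%C by ring.
  apply Rle_trans with (1 := Cmod_triangle _ _).
  rewrite Cmod_mult, Cmod_R, Rabs_pos_eq by lra; fold p; lra. }
assert (Lo' : (1 - e') * p * (sqrt b - sqrt a) <= sigma b - sigma a).
{ apply Rle_trans with (2 := Lo).
  assert (Q : Cmod (v t * RtoC (sqrt b - sqrt a)) <= Cmod (gamma b - gamma a)
    + Cmod (gamma b - gamma a - v t * RtoC (sqrt b - sqrt a))).
  { replace (v t * RtoC (sqrt b - sqrt a))%C with ((gamma b - gamma a) -
      (gamma b - gamma a - v t * RtoC (sqrt b - sqrt a)))%C at 1 by ring.
    apply Rle_trans with (1 := Cmod_triangle _ _); rewrite Cmod_opp; lra. }
  rewrite Cmod_mult, Cmod_R, Rabs_pos_eq in Q by lra; fold p in Q; lra. }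
set (D := sqrt b - sqrt a) in *.
assert (PD : 0 <= p * D) by (unfold D; nra).
split.
- intros Hlt.
  assert (0 < D) by (unfold D; generalize (sqrt_lt_1_alt a b (conj (proj1 Ha) Hlt)); lra).
  assert (0 < (1 - e') * p * D) by (repeat apply Rmult_lt_0_compat; lra).
  lra.
- replace (gamma b - gamma a - w t * RtoC (sigma b - sigma a))%C with
    ((gamma b - gamma a - v t * RtoC D) +
     w t * RtoC (p * D - (sigma b - sigma a)))%C.
  + apply Rle_trans with (1 := Cmod_triangle _ _).
    assert (W1 : Cmod (w t) = 1).
    { unfold w; rewrite Cmod_div, Cmod_R, Rabs_pos_eq; fold p.
      - field; lra.
      - lra.
      - intros E; apply (f_equal Re) in E; simpl in E; lra. }
    rewrite Cmod_mult, W1, Cmod_R.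
    assert (Rabs (p * D - (sigma b - sigma a)) <= e' * (p * D)).
    { apply Rabs_le; lra. }
    assert (e' * (p * D) <= e / 4 * (p * D)) by (apply Rmult_le_compat_r; lra).
    assert (p * D / 2 <= sigma b - sigma a).
    { assert (1 / 2 * (p * D) <= (1 - e') * (p * D))
        by (apply Rmult_le_compat_r; lra); lra. }
    nra.
  + unfold w; fold p; rewrite RtoC_minus, RtoC_mult; field.
    intros E; apply (f_equal Re) in E; simpl in E; lra.
Qed.

Lemma arc_length_increasing (a b : R) :
  half_open tau a -> half_open tau b -> a < b -> sigma a < sigma b.
Proof.
intros Ha Hb Hab.
assert (Mono : forall x y, half_open tau x -> half_open tau y -> x <= y ->
  sigma x <= sigma y).
{ intros x y Hx Hy Hxy.
  assert (Lo := curve_length_lower gamma x y _ _ (proj1 Hx) Hxy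
    (proj1 (Hsig x Hx)) (proj1 (Hsig y Hy))).
  generalize (Cmod_ge_0 (gamma y - gamma x)); lra. }
destruct (arc_length_derivative a 1 Ha Rlt_0_1) as (d & Hd0 & H).
set (c := Rmin b (a + d / 2)).
assert (C1 : c <= b) by apply Rmin_l.
assert (C2 : c <= a + d / 2) by apply Rmin_r.
assert (C3 : a < c) by (apply Rmin_glb_lt; lra).
assert (Hc : half_open tau c).
{ destruct Ha; apply half_open_le with b; [lra | exact Hb]. }
apply Rlt_le_trans with (sigma c); [|now apply Mono].
apply (H a c Ha Hc); try lra.
- rewrite Rminus_diag, Rabs_R0; exact Hd0.
- rewrite Rabs_pos_eq; lra.
Qed.

Context (tinv : R -> R).
Context (Htinv : forall s, half_open L s ->
  half_open tau (tinv s) /\ sigma (tinv s) = s).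

Lemma arc_length_inverse_continuous (s e : R) : half_open L s -> 0 < e ->
  exists d, 0 < d /\ forall r, half_open L r -> Rabs (r - s) < d ->
    Rabs (tinv r - tinv s) < e.
Proof.
intros Hs He.
destruct (Htinv s Hs) as [Ht Es].
set (t := tinv s) in *.
destruct (half_open_extend tau t Ht) as (T & HtT & HT).
set (t2 := Rmin T (t + e / 2)).
assert (A1 : t2 <= T) by apply Rmin_l.
assert (A2 : t2 <= t + e / 2) by apply Rmin_r.
assert (A3 : t < t2) by (apply Rmin_glb_lt; lra).
assert (Ht2 : half_open tau t2).
{ destruct Ht; apply half_open_le with T; [lra | exact HT]. }
set (t1 := Rmax 0 (t - e / 2)).
assert (B1 : 0 <= t1) by apply Rmax_l.
assert (B2 : t - e / 2 <= t1) by apply Rmax_r.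
assert (B3 : t1 <= t) by (apply Rmax_lub; destruct Ht; lra).
assert (Ht1 : half_open tau t1) by (apply half_open_le with t; [lra | exact Ht]).
assert (G2 := arc_length_increasing t t2 Ht Ht2 A3).
assert (Mono : forall x y, half_open tau x -> half_open tau y ->
  sigma x < sigma y -> x < y).
{ intros x y Hx Hy Hxy; apply Rnot_le_lt; intros N.
  destruct (Rle_lt_or_eq_dec _ _ N) as [N'|N'].
  - generalize (arc_length_increasing y x Hy Hx N'); lra.
  - rewrite N' in Hxy; lra. }
destruct (Rle_lt_or_eq_dec _ _ B3) as [B4|B4].
- assert (G1 := arc_length_increasing t1 t Ht1 Ht B4).
  exists (Rmin (sigma t2 - sigma t) (sigma t - sigma t1)).
  split; [apply Rmin_pos; lra|]; intros r Hr Hrs.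
  assert (M1 := Rmin_l (sigma t2 - sigma t) (sigma t - sigma t1)).
  assert (M2 := Rmin_r (sigma t2 - sigma t) (sigma t - sigma t1)).
  destruct (Htinv r Hr) as [Htr Er].
  apply Rabs_lt_between' in Hrs.
  apply Rabs_lt_between'.
  assert (t1 < tinv r) by (apply Mono; auto; lra).
  assert (tinv r < t2) by (apply Mono; auto; lra).
  lra.
- exists (sigma t2 - sigma t).
  split; [lra|]; intros r Hr Hrs.
  destruct (Htinv r Hr) as [Htr Er].
  apply Rabs_lt_between' in Hrs.
  apply Rabs_lt_between'.
  assert (tinv r < t2) by (apply Mono; auto; lra).
  assert (t = 0).
  { unfold t1, Rmax in B4; destruct Rle_dec in B4; lra. }
  destruct Htr; lra.
Qed.

Lemma arc_length_strict_derivative (s e : R) : half_open L s -> 0 < e ->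
  exists d, 0 < d /\ forall a b, half_open L a -> half_open L b -> a <= b ->
    Rabs (a - s) < d -> Rabs (b - s) < d ->
    Cmod (eta b - eta a - w (tinv s) * RtoC (b - a)) <= e * (b - a).
Proof.
intros Hs He.
destruct (Htinv s Hs) as [Ht Es].
destruct (arc_length_derivative (tinv s) e Ht He) as (d1 & Hd1 & H).
destruct (arc_length_inverse_continuous s d1 Hs Hd1) as (d & Hd0 & Hc).
exists d; split; [exact Hd0|]; intros a b Ha Hb Hab Has Hbs.
destruct (Htinv a Ha) as [Hta Ea]; destruct (Htinv b Hb) as [Htb Eb].
assert (Ho : tinv a <= tinv b).
{ apply Rnot_lt_le; intros N.
  generalize (arc_length_increasing _ _ Htb Hta N); lra. }
destruct (H (tinv a) (tinv b) Hta Htb Ho (Hc a Ha Has) (Hc b Hb Hbs)) as [_ Q].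
rewrite <- (proj2 (Hsig _ Hta)), <- (proj2 (Hsig _ Htb)), Ea, Eb in Q.
exact Q.
Qed.

Lemma arc_length_is_derive_on (s : R) : half_open L s ->
  is_derive_on (V := C_R_NormedModule) (half_open L) eta s (w (tinv s)).
Proof.
intros Hs; apply is_derive_on_of_estimate; [|exact Hs].
intros e He.
destruct (arc_length_strict_derivative s e Hs He) as (d & Hd0 & H).
exists d; split; [exact Hd0|]; intros r Hr Hrs.
assert (Rabs (s - s) < d) by (rewrite Rminus_diag, Rabs_R0; exact Hd0).
destruct (Rle_lt_dec s r) as [Q|Q].
- rewrite (Rabs_pos_eq (r - s)) by lra; now apply H.
- rewrite Rabs_minus_sym, (Rabs_pos_eq (s - r)) by lra.
  rewrite <- Cmod_opp.
  replace (- (eta r - eta s - w (tinv s) * RtoC (r - s)))%C with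
    (eta s - eta r - w (tinv s) * RtoC (s - r))%C.
  + apply H; auto; lra.
  + unfold Rminus; rewrite !RtoC_plus, !RtoC_opp; ring.
Qed.

Lemma arc_length_C1 : C1_arclength L eta.
Proof.
exists (fun s => w (tinv s)); split.
- intros s Hs; split; [now apply arc_length_is_derive_on|].
  destruct (Htinv s Hs) as [Ht _].
  assert (Pp : 0 < Cmod (v (tinv s))) by (apply Cmod_gt_0; auto).
  unfold w; rewrite Cmod_div, Cmod_R, Rabs_pos_eq.
  + field; lra.
  + lra.
  + intros E; apply (f_equal Re) in E; simpl in E; lra.
- apply Ccontinuous_on_of_estimate; intros s Hs e He.
  (* Compare both derivatives on a short interval next to [r]. *)
  destruct (arc_length_strict_derivative s (e / 4) Hs) as (d & Hd0 & H); [lra|].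
  exists d; split; [exact Hd0|]; intros r Hr Hrs.
  destruct (arc_length_strict_derivative r (e / 4) Hr) as (d' & Hd' & H'); [lra|].
  destruct (half_open_extend L r Hr) as (T & HrT & HT).
  apply Rabs_lt_between' in Hrs.
  set (q := Rmin T (Rmin (r + d' / 2) ((r + (s + d)) / 2))).
  assert (Q1 : q <= T) by apply Rmin_l.
  assert (Q2 : q <= r + d' / 2) by (apply Rle_trans with (1 := Rmin_r _ _), Rmin_l).
  assert (Q3 : q <= (r + (s + d)) / 2)
    by (apply Rle_trans with (1 := Rmin_r _ _), Rmin_r).
  assert (Q4 : r < q) by (repeat apply Rmin_glb_lt; lra).
  assert (Hq : half_open L q).
  { destruct Hr; apply half_open_le with T; [lra | exact HT]. }
  assert (A := H r q Hr Hq ltac:(lra)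
    ltac:(apply Rabs_lt_between'; lra) ltac:(apply Rabs_lt_between'; lra)).
  assert (A' := H' r q Hr Hq ltac:(lra)
    ltac:(apply Rabs_lt_between'; lra) ltac:(apply Rabs_lt_between'; lra)).
  assert (B : Cmod (w (tinv r) - w (tinv s)) * (q - r) <= e / 2 * (q - r)).
  { replace (Cmod (w (tinv r) - w (tinv s)) * (q - r)) with
      (Cmod ((eta q - eta r - w (tinv s) * RtoC (q - r)) -
             (eta q - eta r - w (tinv r) * RtoC (q - r)))).
    - apply Rle_trans with (1 := Cmod_triangle _ _); rewrite Cmod_opp; lra.
    - replace ((eta q - eta r - w (tinv s) * RtoC (q - r)) -
             (eta q - eta r - w (tinv r) * RtoC (q - r)))%C with
        ((w (tinv r) - w (tinv s)) * RtoC (q - r))%C by ring.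
      rewrite Cmod_mult, Cmod_R, Rabs_pos_eq; lra. }
  apply Rmult_le_reg_r in B; lra.
Qed.

Lemma arc_length_continuous (s e : R) : half_open L s -> 0 < e ->
  exists d, 0 < d /\ forall r, half_open L r -> Rabs (r - s) < d ->
    Cmod (eta r - eta s) < e.
Proof.
intros Hs He.
destruct (arc_length_strict_derivative s 1 Hs Rlt_0_1) as (d & Hd0 & H).
set (K := 1 + Cmod (w (tinv s))).
assert (PK : 0 < K) by (generalize (Cmod_ge_0 (w (tinv s))); unfold K; lra).
exists (Rmin d (e / K)); split; [apply Rmin_pos; [lra | now apply Rdiv_lt_0_compat]|].
intros r Hr Hrs.
assert (M1 := Rmin_l d (e / K)); assert (M2 := Rmin_r d (e / K)).
assert (Q : Cmod (eta r - eta s) <= K * Rabs (r - s)).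
{ assert (Tr : forall a b, half_open L a -> half_open L b -> a <= b ->
    Rabs (a - s) < d -> Rabs (b - s) < d -> Cmod (eta b - eta a) <= K * (b - a)).
  { intros a b Ha Hb Hab Has Hbs.
    assert (G := H a b Ha Hb Hab Has Hbs).
    replace (eta b - eta a)%C with ((eta b - eta a - w (tinv s) * RtoC (b - a))
      + w (tinv s) * RtoC (b - a))%C by ring.
    apply Rle_trans with (1 := Cmod_triangle _ _).
    rewrite Cmod_mult, Cmod_R, Rabs_pos_eq by lra; unfold K; lra. }
  assert (Rabs (s - s) < d) by (rewrite Rminus_diag, Rabs_R0; exact Hd0).
  destruct (Rle_lt_dec s r).
  - rewrite (Rabs_pos_eq (r - s)) by lra; apply Tr; auto; lra.
  - rewrite Cmod_minus_sym, Rabs_minus_sym, (Rabs_pos_eq (s - r)) by lra.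
    apply Tr; auto; lra. }
apply Rle_lt_trans with (1 := Q).
apply Rlt_le_trans with (K * (e / K)); [|right; field; lra].
apply Rmult_lt_compat_l; lra.
Qed.

Lemma arc_length_is_derive (s : R) : 0 < s -> Rbar_lt s L ->
  is_derive (V := C_R_NormedModule) eta s (w (tinv s)).
Proof.
intros H0 HsL; apply is_derive_on_is_derive with (half_open L).
- now apply half_open_locally.
- apply arc_length_is_derive_on; split; [lra | exact HsL].
Qed.

End ArcLength.

(** * Arguments *)

Lemma argH_atan (w : C) : 0 < Im w -> argH w = PI / 2 - atan (Re w / Im w).
Proof.
intros H.
destruct (argH_spec w H) as [B E].
assert (P : 0 < Cmod w) by now apply Cmod_gt_0, Im_pos_neq_0.
set (a := argH w) in *; set (m := Cmod w) in *.
assert (E1 : Re w = m * cos a) by (rewrite E; unfold cis; cring).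
assert (E2 : Im w = m * sin a) by (rewrite E; unfold cis; cring).
assert (S : 0 < sin a) by (apply sin_gt_0; lra).
replace (Re w / Im w) with (tan (PI / 2 - a)).
- rewrite atan_tan; lra.
- unfold tan; rewrite cos_shift, sin_shift, E1, E2; field; lra.
Qed.

Lemma atan_lipschitz (a b : R) : Rabs (atan b - atan a) <= Rabs (b - a).
Proof.
assert (H : forall a b, a <= b -> 0 <= atan b - atan a <= b - a).
{ clear a b; intros a b Hab.
  assert (atan a <= atan b).
  { destruct (Rle_lt_or_eq_dec _ _ Hab) as [H| ->]; [|lra].
    left; now apply atan_increasing. }
  assert (A : a - atan a <= b - atan b).
  { apply increasing_of_derive with (f := fun x => x - atan x)
      (df := fun x => 1 - / (1 + x²)); [exact Hab | | |].
    - apply (continuity_minus (fun x => x) atan).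
      + apply derivable_continuous, derivable_id.
      + apply derivable_continuous; intros x; apply derivable_pt_atan.
    - intros x _; apply (is_derive_minus (V := R_NormedModule)).
      + apply (is_derive_id (K := R_AbsRing)).
      + evar_last; [apply is_derive_atan|].
        simpl; unfold Rsqr; f_equal; ring.
    - intros x _.
      assert (0 <= x²) by apply Rle_0_sqr.
      assert (/ (1 + x²) <= / 1) by (apply Rinv_le_contravar; lra).
      lra. }
  lra. }
destruct (Rle_lt_dec a b) as [Q|Q].
- rewrite !Rabs_pos_eq; try (apply H in Q; lra); lra.
- rewrite (Rabs_minus_sym (atan b)), (Rabs_minus_sym b).
  assert (Q' := H b a ltac:(lra)).
  rewrite !Rabs_pos_eq; lra.
Qed.

Lemma argH_continuous (l : C) (e : R) : 0 < Im l -> 0 < e ->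
  exists d, 0 < d /\ forall w, Cmod (w - l) < d -> Rabs (argH w - argH l) < e.
Proof.
intros Hl He.
set (K := (Rabs (Re l) + Im l) * (2 / (Im l * Im l))).
destruct (exists_small K (e / 2)) as (d & Hd & HK & _); [lra|].
exists (Rmin d (Im l / 2)); split; [apply Rmin_pos; lra|].
intros w Hw.
assert (M1 := Rmin_l d (Im l / 2)); assert (M2 := Rmin_r d (Im l / 2)).
assert (A1 : Rabs (Re w - Re l) <= d).
{ apply Rle_trans with (1 := re_le_Cmod (w - l)%C); lra. }
assert (A2 : Rabs (Im w - Im l) <= Rmin d (Im l / 2)).
{ apply Rle_trans with (1 := im_le_Cmod (w - l)%C); lra. }
assert (A3 : Im l / 2 <= Im w).
{ apply Rabs_le_between' in A2; lra. }
rewrite !argH_atan by lra.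
replace (PI / 2 - atan (Re w / Im w) - (PI / 2 - atan (Re l / Im l))) with
  (atan (Re l / Im l) - atan (Re w / Im w)) by ring.
apply Rle_lt_trans with (1 := atan_lipschitz _ _).
replace (Re l / Im l - Re w / Im w) with
  ((Re l * (Im w - Im l) - (Re w - Re l) * Im l) * / (Im w * Im l))
  by (field; lra).
rewrite Rabs_mult.
apply Rle_lt_trans with (K * d); [|lra].
unfold K; replace ((Rabs (Re l) + Im l) * (2 / (Im l * Im l)) * d) with
  (((Rabs (Re l) + Im l) * d) * (/ (Im l / 2 * Im l))) by (field; lra).
apply Rmult_le_compat; auto using Rabs_pos.
- unfold Rminus at 1; apply Rle_trans with (1 := Rabs_triang _ _).
  rewrite Rabs_Ropp, !Rabs_mult, (Rabs_pos_eq (Im l)) by lra.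
  generalize (Rabs_pos (Re l)); intros; nra.
- rewrite Rabs_pos_eq.
  + apply Rinv_le_contravar; nra.
  + left; apply Rinv_0_lt_compat; nra.
Qed.

Lemma argH_comp_continuity (D : R -> C) : Ccontinuity D ->
  (forall s, 0 < Im (D s)) -> continuity (fun s => argH (D s)).
Proof.
intros [D1 D2] H.
apply continuity_ext with (fun s => PI / 2 - atan (Re (D s) / Im (D s))).
- intros s; rewrite argH_atan; auto.
- apply (continuity_minus _ _ (continuity_cst (PI / 2))).
  apply (continuity_comp (fun s => Re (D s) / Im (D s)) atan).
  + apply (continuity_div _ _ D1 D2); intros s; generalize (H s); lra.
  + apply derivable_continuous; intros x; apply derivable_pt_atan.
Qed.

(** Boundary values of the argument. *)
Lemma argH_near_real (x y : R) : x <> 0 -> 0 < y ->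
  Rabs (argH (x, y) - (if Rlt_dec 0 x then 0 else PI)) <= y / Rabs x.
Proof.
intros Hx Hy.
rewrite argH_atan by exact Hy; simpl.
assert (A : forall a, 0 < a -> Rabs (PI / 2 - atan (a / y)) <= y / a).
{ intros a Ha.
  assert (Q : 0 < a / y) by now apply Rdiv_lt_0_compat.
  rewrite <- atan_inv by exact Q.
  replace (/ (a / y)) with (y / a) by (field; lra).
  assert (L := atan_lipschitz 0 (y / a)).
  rewrite atan_0, !Rminus_0_r in L.
  apply Rle_trans with (1 := L); rewrite Rabs_pos_eq; [lra|].
  left; now apply Rdiv_lt_0_compat. }
destruct (Rlt_dec 0 x) as [P|N].
- rewrite (Rabs_pos_eq x), Rminus_0_r by lra; now apply A.
- rewrite (Rabs_left x) by lra.
  replace (PI / 2 - atan (x / y) - PI) with (- (PI / 2 - atan (- x / y))).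
  + rewrite Rabs_Ropp; apply A; lra.
  + replace (- x / y) with (- (x / y)) by (field; lra).
    rewrite atan_opp; lra.
Qed.

Lemma argH_polar (r a : R) : 0 < r -> 0 < a < PI -> argH (r * cis a)%C = a.
Proof.
intros Hr Ha; unfold argH.
rewrite Cmod_mult, Cmod_cis, Cmod_R, Rabs_pos_eq by lra.
replace (Re (r * cis a)%C / (r * 1)) with (cos a).
- apply acos_cos; lra.
- unfold cis, Cmult, RtoC, Re; simpl; field; lra.
Qed.

Lemma cis_plus (a b : R) : cis (a + b) = (cis a * cis b)%C.
Proof.
unfold cis, Cmult; simpl; rewrite cos_plus, sin_plus; apply f_equal2; ring.
Qed.

Lemma cis_polar_unique (p q : R) (a b : R) : 0 < p -> 0 < q ->
  (p * cis a = q * cis b)%C -> p = q /\ cis a = cis b.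
Proof.
intros Hp Hq E.
assert (Epq : p = q).
{ apply (f_equal Cmod) in E.
  rewrite !Cmod_mult, !Cmod_cis, !Cmod_R, !Rabs_pos_eq in E; lra. }
split; [exact Epq|]; rewrite Epq in E.
assert (Hq0 : RtoC q <> 0).
{ intros H; apply (f_equal Re) in H; simpl in H; lra. }
replace (cis a) with (q * cis a / q)%C by (field; exact Hq0).
rewrite E; field; exact Hq0.
Qed.

(** Two continuous determinations of the same angle that agree at 0. *)
Lemma continuous_angle_unique (f g : R -> R) (t : R) :
  0 <= t -> continuity f -> continuity g -> f 0 = g 0 ->
  (forall s, 0 <= s <= t -> cis (f s) = cis (g s)) -> f t = g t.
Proof.
intros Ht Fc Gc E0 E.
set (h := fun s => f s - g s).
assert (Hc : continuity h) by apply (continuity_minus _ _ Fc Gc).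
assert (Hcos : forall s, 0 <= s <= t -> cos (h s) = 1 /\ sin (h s) = 0).
{ intros s Hs; specialize (E s Hs).
  assert (C1 := f_equal fst E); assert (C2 := f_equal snd E); simpl in C1, C2.
  unfold h; rewrite cos_minus, sin_minus, C1, C2; split.
  - generalize (sin2_cos2 (g s)); unfold Rsqr; lra.
  - ring. }
assert (Key : forall k, continuity k -> k 0 = 0 ->
  (forall s, 0 <= s <= t -> cos (k s) = 1 /\ sin (k s) = 0) -> k t <= 0).
{ intros k Kc K0 Kcs; apply Rnot_lt_le; intros N.
  destruct (Rlt_le_dec (k t) PI) as [L|L].
  - generalize (sin_gt_0 _ N L), (proj2 (Kcs t ltac:(lra))); lra.
  - destruct (IVT_gen k 0 t PI Kc) as (s & Hs & Es).
    + rewrite K0, Rmin_left, Rmax_right by (generalize PI_RGT_0; lra).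
      generalize PI_RGT_0; lra.
    + rewrite Rmin_left, Rmax_right in Hs by lra.
      destruct (Kcs s Hs) as [Q _]; rewrite Es, cos_PI in Q; lra. }
assert (A : h t <= 0).
{ apply Key; auto; unfold h; lra. }
assert (B : - h t <= 0).
{ apply (Key (fun s => - h s)).
  - apply (continuity_opp _ Hc).
  - unfold h; lra.
  - intros s Hs; destruct (Hcos s Hs) as [Q1 Q2].
    rewrite cos_neg, sin_neg; lra. }
unfold h in *; lra.
Qed.

(** [- 2 / (Y U)] is the logarithmic derivative of [U - Y] when [Y] is another
    flow with the same driving function. *)
Lemma flow_difference_exp (k : R -> R) (t y : R) (U Y F : R -> C) (beta : R -> C) :
  0 <= t -> tip_flow k t y U -> centered_flow k t Y ->
  (forall s, 0 < s < t -> beta s = (- (2) / Y s)%C) ->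
  F 0 = 0 -> Ccontinuity F ->
  (forall s, 0 < s < t -> is_Cderive F s (beta s / U s)%C) ->
  forall s, 0 <= s <= t -> (U s - Y s)%C = ((U 0 - Y 0) * cexp (F s))%C.
Proof.
intros Ht HU (Yc & Yn & Yd) Hb F0 Fc Fd s Hs.
assert (E : ((U s - Y s) * cexp (- F s))%C = ((U 0 - Y 0) * cexp (- F 0))%C).
{ apply (Cconstant_of_derive (fun s => (U s - Y s) * cexp (- F s))%C 0 s); [lra | |].
  - apply Ccontinuity_mult; [apply Ccontinuity_minus; [apply HU | exact Yc]|].
    now apply Ccontinuity_cexp, Ccontinuity_opp.
  - intros r Hr.
    assert (DU : is_Cderive U r (2 / U r - k r)%C) by (apply HU; lra).
    assert (DY := Yd r ltac:(lra)).
    eapply is_Cderive_eq;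
      [|apply is_Cderive_mult; [apply is_Cderive_minus; eassumption
        |apply is_Cderive_cexp, is_Cderive_opp, Fd; lra]].
    cbv beta; rewrite Hb by lra.
    field; split; [apply Yn | apply (tip_flow_neq_0 k t y U HU)]. }
rewrite F0 in E.
replace (- 0)%C with (RtoC 0) in E by ring.
rewrite cexp_0, Cmult_1_r in E.
rewrite <- E, <- Cmult_assoc, <- cexp_plus.
replace (- F s + F s)%C with (RtoC 0) by ring.
rewrite cexp_0; ring.
Qed.

(** If [U - Y] stays in the upper half-plane, then the increment of its argument
    is that of the branch [argH]. *)
Lemma flow_difference_arg (k : R -> R) (t y : R) (U Y F : R -> C) (beta : R -> C) :
  0 <= t -> tip_flow k t y U -> centered_flow k t Y ->
  (forall s, Im (Y s) <= 0) ->
  (forall s, 0 < s < t -> beta s = (- (2) / Y s)%C) ->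
  F 0 = 0 -> Ccontinuity F ->
  (forall s, 0 < s < t -> is_Cderive F s (beta s / U s)%C) ->
  Im (F t) = argH (U t - Y t) - argH (U 0 - Y 0).
Proof.
intros Ht HU HY HI Hb F0 Fc Fd.
assert (P : forall s, 0 < Im (U s - Y s)%C).
{ intros s; assert (Q : 0 < Im (U s)) by apply HU.
  generalize (HI s); simpl; unfold Im in *; lra. }
assert (Dc : Ccontinuity (fun s => U s - Y s)%C)
  by (apply Ccontinuity_minus; [apply HU | apply HY]).
apply (continuous_angle_unique (fun s => Im (F s))
  (fun s => argH (U s - Y s)%C - argH (U 0 - Y 0)%C) t Ht).
- apply Fc.
- apply (continuity_minus (fun s => argH (U s - Y s)%C) _).
  + now apply (argH_comp_continuity (fun s => U s - Y s)%C).
  + apply (continuity_cst (argH (U 0 - Y 0)%C)).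
- rewrite F0; simpl; ring.
- intros s Hs.
  assert (E := flow_difference_exp k t y U Y F beta Ht HU HY Hb F0 Fc Fd s Hs).
  destruct (argH_spec _ (P s)) as [_ Es]; destruct (argH_spec _ (P 0)) as [_ E0].
  set (a := argH (U s - Y s)%C) in *; set (b := argH (U 0 - Y 0)%C) in *.
  assert (Ps : 0 < Cmod (U s - Y s)) by (apply Cmod_gt_0, Im_pos_neq_0, P).
  assert (P0 : 0 < Cmod (U 0 - Y 0)) by (apply Cmod_gt_0, Im_pos_neq_0, P).
  assert (Q : (RtoC (Cmod (U s - Y s)) * cis a)%C =
    (RtoC (Cmod (U 0 - Y 0) * exp (Re (F s))) * cis (b + Im (F s)))%C).
  { rewrite <- Es, E, E0 at 1.
    rewrite cis_plus, RtoC_mult; unfold cexp; ring. }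
  apply cis_polar_unique in Q; [|exact Ps|].
  2:{ apply Rmult_lt_0_compat; [exact P0 | apply exp_pos]. }
  destruct Q as [_ Q].
  transitivity (cis ((b + Im (F s)) + - b)); [apply f_equal; ring|].
  rewrite cis_plus, <- Q, <- cis_plus; reflexivity.
Qed.

(** * The curve of SLE_0(rho) *)

Section SLE.

Context (rho : R) (z0 : C) (tau : Rbar) (W : R -> R) (z gamma : R -> C).
Context (Hz0 : 0 <= Im z0) (HS : is_SLE0 rho z0 tau W z gamma).

(** [W'_s], as prescribed by the force point. *)
Definition driving_speed (s : R) : R := Re (rho / (W s - z s))%C.

(** The centered force point [z_s - W_s], stopped at time [T]. *)
Definition force_flow (T s : R) : C := (z (clamp T s) - W (clamp T s))%C.

(** Divided by [U_s = g_s(x) - W_s], these are the logarithmic derivatives of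
    [g_s(x) - z_s] and of [g_s(x) - conj(z_s)]. *)
Definition force_kernel (s : R) : C := (- (2) / (z s - W s))%C.
Definition conj_force_kernel (s : R) : C := (- (2) / Cconj (z s - W s))%C.

Lemma force_neq_drive (t : R) : half_open tau t -> (z t - W t)%C <> 0.
Proof.
intros Ht E; apply (proj1 (proj2 (SLE0_force _ _ _ _ _ _ HS) t Ht)).
replace (z t) with ((z t - W t) + W t)%C by ring; rewrite E; ring.
Qed.

Lemma clamp_half_open (T s : R) : half_open tau T -> half_open tau (clamp T s).
Proof.
intros HT; apply half_open_le with T; [apply clamp_bounds, HT | exact HT].
Qed.

Lemma is_derive_drive (t : R) : 0 < t -> half_open tau t ->
  is_derive W t (driving_speed t).
Proof.
intros H0 Ht; apply is_derive_on_is_derive with (half_open tau).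
- apply half_open_locally; [exact H0 | apply Ht].
- exact (SLE0_drive _ _ _ _ _ _ HS t Ht).
Qed.

Lemma drive_clamp_continuity (T : R) : half_open tau T ->
  continuity (fun s => W (clamp T s)).
Proof.
intros HT; apply within_segment_clamp with (half_open tau); [apply HT | |].
- intros s Hs; now apply half_open_le with T.
- intros s Hs; eapply (is_derive_on_continuous (V := R_NormedModule)).
  apply (SLE0_drive _ _ _ _ _ _ HS); now apply half_open_le with T.
Qed.

Lemma force_clamp_continuity (T : R) : half_open tau T ->
  Ccontinuity (fun s => z (clamp T s)).
Proof.
intros HT; apply within_segment_Cclamp with (half_open tau); [apply HT | |].
- intros s Hs; now apply half_open_le with T.
- intros s Hs; eapply (is_derive_on_continuous (V := C_R_NormedModule)).
  apply (SLE0_force _ _ _ _ _ _ HS); now apply half_open_le with T.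
Qed.

Lemma force_flow_centered (T : R) : half_open tau T ->
  centered_flow driving_speed T (force_flow T).
Proof.
intros HT; split; [|split].
- apply Ccontinuity_minus; [now apply force_clamp_continuity|].
  now apply Ccontinuity_RtoC, drive_clamp_continuity.
- intros s; apply force_neq_drive, clamp_half_open, HT.
- intros s Hs.
  assert (Hs' : half_open tau s) by (apply half_open_le with T; [lra | exact HT]).
  apply is_Cderive_ext_loc with (fun s => z s - W s)%C.
  + apply filter_imp with (2 := clamp_near T s Hs).
    intros r E; unfold force_flow; now rewrite E.
  + unfold force_flow; rewrite clamp_id by lra.
    apply is_Cderive_minus.
    * apply is_derive_on_is_Cderive with (half_open tau).
      -- apply half_open_locally; [lra | apply Hs'].
      -- apply (SLE0_force _ _ _ _ _ _ HS), Hs'.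
    * split; [apply is_derive_drive; [lra | exact Hs']
             | apply (is_derive_const (V := R_NormedModule) 0)].
Qed.

Lemma driving_speed_force_flow (T s : R) :
  driving_speed (clamp T s) = Re (- (rho / force_flow T s))%C.
Proof.
unfold driving_speed, force_flow; apply f_equal.
set (a := z (clamp T s)); set (b := RtoC (W (clamp T s))).
replace (b - a)%C with (- (a - b))%C by ring.
destruct (a - b)%C as [p q].
unfold Cdiv, Cmult, Cinv, Copp, RtoC; simpl.
replace (- p * (- p * 1) + - q * (- q * 1)) with (p * (p * 1) + q * (q * 1)) by ring.
unfold Rdiv; apply f_equal2; ring.
Qed.

Lemma driving_speed_continuity (T : R) : half_open tau T ->
  continuity (fun s => driving_speed (clamp T s)).
Proof.
intros HT.
apply continuity_ext with (fun s => Re (- (rho / force_flow T s))%C).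
- intros s; symmetry; apply driving_speed_force_flow.
- apply Ccontinuity_opp, Ccontinuity_div; [apply Ccontinuity_const | |];
    now apply force_flow_centered.
Qed.

Lemma driving_speed_bounds (T : R) : half_open tau T ->
  (exists M, 0 < M /\ forall s, 0 <= s <= T -> Rabs (driving_speed s) <= M) /\
  continuity (fun s => driving_speed (clamp T s)).
Proof.
intros HT; assert (Hc := driving_speed_continuity T HT); split; [|exact Hc].
destruct (continuity_bounded _ T (proj1 HT) Hc) as (M & HM & H).
exists M; split; [exact HM|]; intros s Hs.
rewrite <- (clamp_id T s) by exact Hs; auto.
Qed.

Lemma kernel_continuity (T : R) : half_open tau T ->
  Ccontinuity (fun s => force_kernel (clamp T s)) /\
  Ccontinuity (fun s => conj_force_kernel (clamp T s)).
Proof.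
intros HT; assert (F := force_flow_centered T HT); split.
- apply Ccontinuity_div; [apply Ccontinuity_const | apply F | apply F].
- assert (F' := centered_flow_conj _ _ _ F).
  apply Ccontinuity_div; [apply Ccontinuity_const | apply F' | apply F'].
Qed.

Lemma clamped_kernel_bound (beta : R -> C) (T : R) : 0 <= T ->
  Ccontinuity (fun s => beta (clamp T s)) ->
  exists K, 0 <= K /\ forall s, 0 <= s <= T -> Cmod (beta s) <= K.
Proof.
intros HT Hc.
destruct (Ccontinuity_bounded _ T HT Hc) as (K & HK & H).
exists K; split; [lra|]; intros s Hs.
rewrite <- (clamp_id T s) by exact Hs; auto.
Qed.

(** Solutions that reach [W_t + i y] at time [t] are flows seen from the tip. *)
Lemma loewner_solution_tip_flow (t y : R) (x : C) (u : R -> C) :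
  half_open tau t -> 0 < y ->
  solves_loewner W (segment t) x u -> u t = (W t, y) ->
  tip_flow driving_speed t y (fun s => u (clamp t s) - W (clamp t s))%C.
Proof.
intros Ht Hy [_ Hu] Et.
assert (Hc : centered_flow driving_speed t (fun s => u (clamp t s) - W (clamp t s))%C).
{ split; [|split].
  - apply Ccontinuity_minus; [|now apply Ccontinuity_RtoC, drive_clamp_continuity].
    apply within_segment_Cclamp with (segment t); [apply Ht | intros s Hs; exact Hs |].
    intros s Hs; eapply (is_derive_on_continuous (V := C_R_NormedModule)).
    apply Hu, Hs.
  - intros s E; apply (proj1 (Hu (clamp t s) (clamp_bounds t s (proj1 Ht)))).
    replace (u (clamp t s)) with ((u (clamp t s) - W (clamp t s)) + W (clamp t s))%C
      by ring.
    rewrite E; ring.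
  - intros s Hs.
    assert (Hs' : half_open tau s) by (apply half_open_le with t; [lra | exact Ht]).
    apply is_Cderive_ext_loc with (fun s => u s - W s)%C.
    + apply filter_imp with (2 := clamp_near t s Hs).
      intros r E; now rewrite E.
    + rewrite clamp_id by lra.
      apply is_Cderive_minus.
      * apply is_derive_on_is_Cderive with (segment t).
        -- generalize (filter_and _ _ (open_gt 0 s (proj1 Hs)) (open_lt t s (proj2 Hs))).
           apply filter_imp; intros r Hr; unfold segment; lra.
        -- apply Hu; unfold segment; lra.
      * split; [apply is_derive_drive; [lra | exact Hs']
               | apply (is_derive_const (V := R_NormedModule) 0)]. }
assert (Eend : (u (clamp t t) - W (clamp t t))%C = (0, y)).
{ rewrite clamp_id, Et by (destruct Ht; lra).
  unfold Cminus, Cplus, Copp, RtoC; simpl; apply f_equal2; ring. }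
split; [apply Hc | split; [|split; [exact Eend | apply Hc]]].
intros s.
replace (clamp t s) with (clamp t (clamp t s))
  by (apply clamp_id, clamp_bounds, Ht).
apply (centered_flow_Im_backward _ _ _ Hc (clamp t s)).
- apply clamp_bounds, Ht.
- rewrite Eend; exact Hy.
Qed.

Lemma tip_flows_exist : exists U : R -> R -> R -> C,
  (forall t y, half_open tau t -> 0 < y -> tip_flow driving_speed t y (U t y)) /\
  forall t, half_open tau t -> lim0 (fun y => U t y 0) (gamma t).
Proof.
assert (H : forall t, half_open tau t -> exists V : R -> R -> C,
  (forall y, 0 < y -> tip_flow driving_speed t y (V y)) /\
  lim0 (fun y => V y 0) (gamma t)).
{ intros t Ht.
  destruct (SLE0_trace _ _ _ _ _ _ HS t Ht) as (x & Hx & Hlim).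
  destruct (choice_on (fun y => 0 < y) (fun y u =>
    solves_loewner W (segment t) (x y) u /\ u t = (W t, y)) (fun _ : R => RtoC 0))
    as (u & Hu).
  { intros y Hy; exact (proj2 (Hx y Hy)). }
  exists (fun y s => u y (clamp t s) - W (clamp t s))%C; split.
  - intros y Hy; destruct (Hu y Hy) as [H1 H2].
    now apply loewner_solution_tip_flow with (x y).
  - apply lim0_ext with x.
    + intros y Hy; destruct (Hu y Hy) as [[H1 _] _].
      rewrite clamp_id, H1, (SLE0_start _ _ _ _ _ _ HS) by (destruct Ht; lra); ring.
    + intros e He.
      assert (He2 : 0 < e / 2) by lra.
      destruct (proj1 (filterlim_locally _ _) Hlim (mkposreal _ He2)) as [d Hd].
      exists d; split; [apply cond_pos|]; intros y Hy.
      assert (B : ball 0 d y).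
      { change (Rabs (y - 0) < d); rewrite Rabs_pos_eq; lra. }
      assert (Q := C_NormedModule_mixin_compat2 _ _ _ (Hd y B (proj1 Hy))).
      change (minus (x y) (gamma t)) with (x y - gamma t)%C in Q; simpl in Q.
      apply Rlt_le_trans with (1 := Q).
      assert (sqrt 2 <= 2).
      { rewrite <- (sqrt_square 2) at 2 by lra; apply sqrt_le_1_alt; lra. }
      nra. }
destruct (choice_on (half_open tau) _ (fun _ _ => RtoC 0) H) as (U & HU).
exists U; split.
- intros t y Ht Hy; now apply HU.
- intros t Ht; now apply HU.
Qed.

(** The integrals of [beta / U] over [[0, t]] and their limits as [y] decreases
    to 0, chosen for all [t] and [y]. *)
Lemma tip_exponents_exist (U : R -> R -> R -> C) (beta : R -> C) :
  (forall t y, half_open tau t -> 0 < y -> tip_flow driving_speed t y (U t y)) ->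
  (forall T, half_open tau T -> Ccontinuity (fun s => beta (clamp T s))) ->
  exists (l : R -> R -> C) (Lam : R -> C),
    (forall t y, half_open tau t -> 0 < y -> is_flow_integral beta t (U t y) (l t y)) /\
    (forall t, half_open tau t -> lim0 (l t) (Lam t)).
Proof.
intros HU Hb.
destruct (choice_on (fun p => half_open tau (fst p) /\ 0 < snd p)
  (fun p => is_flow_integral beta (fst p) (U (fst p) (snd p))) (RtoC 0))
  as (l & Hl).
{ intros [t y] [Ht Hy]; simpl in *.
  apply is_flow_integral_exists with driving_speed y; [apply Ht | now apply HU |].
  now apply Hb. }
assert (Hl' : forall t y, half_open tau t -> 0 < y ->
  is_flow_integral beta t (U t y) (l (t, y))).
{ intros t y Ht Hy; exact (Hl (t, y) (conj Ht Hy)). }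
destruct (choice_on (half_open tau) (fun t => lim0 (fun y => l (t, y))) (RtoC 0))
  as (Lam & HLam).
{ intros t Ht.
  apply (tip_integral_limit_exists tau driving_speed U driving_speed_bounds HU
    beta (fun t y => l (t, y))); auto.
  intros T HT; apply clamped_kernel_bound; [apply HT | now apply Hb]. }
exists (fun t y => l (t, y)), Lam; split; auto.
Qed.

Lemma force_Im_nonneg (t : R) : half_open tau t -> 0 <= Im (z t).
Proof.
intros Ht.
assert (F := force_flow_centered t Ht).
assert (Ez : Im (z t) = Im (force_flow t t)).
{ unfold force_flow; rewrite clamp_id by (destruct Ht; lra); simpl; unfold Im; ring. }
assert (E0 : Im (force_flow t 0) = Im z0).
{ unfold force_flow; rewrite clamp_id by (destruct Ht; lra).
  rewrite (proj1 (SLE0_force _ _ _ _ _ _ HS)); simpl; unfold Im; ring. }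
rewrite Ez.
destruct (Rle_lt_or_eq_dec _ _ Hz0) as [P|P].
- left; apply (centered_flow_Im_forward _ _ _ F); [destruct Ht; lra | lra].
- right; symmetry; apply (centered_flow_real _ _ _ F); [destruct Ht; lra | lra].
Qed.

Lemma force_start (t : R) : half_open tau t -> force_flow t 0 = z0.
Proof.
intros Ht; unfold force_flow; rewrite clamp_id by (destruct Ht; lra).
rewrite (proj1 (SLE0_force _ _ _ _ _ _ HS)), (SLE0_start _ _ _ _ _ _ HS); ring.
Qed.

Lemma force_end (t : R) : half_open tau t -> force_flow t t = (z t - W t)%C.
Proof.
intros Ht; unfold force_flow; now rewrite clamp_id by (destruct Ht; lra).
Qed.

Section Exponents.

Context (U : R -> R -> R -> C) (l1 l2 : R -> R -> C) (Lam1 Lam2 : R -> C).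
Context (HU : forall t y, half_open tau t -> 0 < y ->
  tip_flow driving_speed t y (U t y)).
Context (Hg : forall t, half_open tau t -> lim0 (fun y => U t y 0) (gamma t)).
Context (Hl1 : forall t y, half_open tau t -> 0 < y ->
  is_flow_integral force_kernel t (U t y) (l1 t y)).
Context (Hl2 : forall t y, half_open tau t -> 0 < y ->
  is_flow_integral conj_force_kernel t (U t y) (l2 t y)).
Context (HL1 : forall t, half_open tau t -> lim0 (l1 t) (Lam1 t)).
Context (HL2 : forall t, half_open tau t -> lim0 (l2 t) (Lam2 t)).

(** Limit of the integral of [W' / U] over [[0, t]], in terms of the limits
    [Lam1] and [Lam2] of the integrals of both kernels. *)
Definition tip_exponent (t : R) : C := (RtoC (rho / 4) * (Lam1 t + Lam2 t))%C.

(** [W' / U] is a combination of both logarithmic derivatives. *)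
Lemma drive_integral (t y : R) : half_open tau t -> 0 < y ->
  is_flow_integral (fun s => RtoC (driving_speed s)) t (U t y)
    (RtoC (rho / 4) * (l1 t y + l2 t y))%C.
Proof.
intros Ht Hy.
destruct (Hl1 t y Ht Hy) as (F & F0 & Fc & Fd & <-).
destruct (Hl2 t y Ht Hy) as (G & G0 & Gc & Gd & <-).
exists (fun s => RtoC (rho / 4) * (F s + G s))%C; split; [|split; [|split]].
- rewrite F0, G0; ring.
- apply Ccontinuity_mult; [apply Ccontinuity_const | now apply Ccontinuity_plus].
- intros s Hs.
  assert (Hs' : half_open tau s) by (apply half_open_le with t; [lra | exact Ht]).
  eapply is_Cderive_eq;
    [|apply is_Cderive_mult; [apply is_Cderive_const
      |apply is_Cderive_plus; [apply Fd, Hs | apply Gd, Hs]]].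
  cbv beta; unfold force_kernel, conj_force_kernel.
  assert (N := force_neq_drive s Hs').
  assert (Nu : U t y s <> 0) by apply (tip_flow_neq_0 _ _ _ _ (HU t y Ht Hy)).
  replace (RtoC (driving_speed s)) with
    (RtoC (rho / 4) * (- (2) / (z s - W s) + - (2) / Cconj (z s - W s)))%C.
  + field; repeat split; auto.
    intros E; apply N; rewrite <- (Cconj_conj (z s - W s)), E.
    unfold Cconj, RtoC; simpl; apply f_equal2; ring.
  + rewrite <- (clamp_id s s) at 5 by (destruct Hs'; lra).
    rewrite (driving_speed_force_flow s s), (force_end s Hs').
    apply Cnorm2_neq_0 in N.
    destruct (z s - W s)%C as [a b].
    unfold Cdiv, Cmult, Cinv, Cplus, Copp, Cconj, RtoC, Re, Im in *; simpl in *.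
    apply f_equal2; field; repeat split; intros E; apply N; lra.
- reflexivity.
Qed.

Lemma tip_exponent_limit (t : R) : half_open tau t ->
  lim0 (fun y => RtoC (rho / 4) * (l1 t y + l2 t y))%C (tip_exponent t).
Proof.
intros Ht; apply lim0_mult; [apply lim0_const | apply lim0_plus; auto].
Qed.

(** [W_t - z_t = (gamma(t) - z_0) exp(Lam1(t))] *)
Lemma tip_distance_exp (t : R) : half_open tau t ->
  (W t - z t)%C = ((gamma t - z0) * cexp (Lam1 t))%C.
Proof.
intros Ht.
assert (A : lim0 (fun y => (U t y 0 + - z0) * cexp (l1 t y))%C
  ((gamma t + - z0) * cexp (Lam1 t))%C).
{ apply lim0_mult; [apply lim0_plus; [now apply Hg | apply lim0_const]|].
  now apply lim0_cexp, HL1. }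
assert (B : lim0 (fun y => (U t y 0 + - z0) * cexp (l1 t y))%C (W t - z t)%C).
{ apply lim0_ext with (fun y => (0, y) - (z t - W t))%C.
  - intros y Hy.
    destruct (Hl1 t y Ht Hy) as (F & F0 & Fc & Fd & <-).
    assert (E := flow_difference_exp driving_speed t y (U t y) (force_flow t) F
      force_kernel (proj1 Ht) (HU t y Ht Hy) (force_flow_centered t Ht)).
    rewrite <- (force_start t Ht), <- (force_end t Ht).
    destruct (HU t y Ht Hy) as (_ & _ & <- & _).
    apply E; auto; try (destruct Ht; lra).
    intros s Hs; unfold force_flow; rewrite clamp_id by lra; reflexivity.
  - intros e He; exists e; split; [exact He|]; intros y Hy.
    replace ((0, y) - (z t - W t) - (W t - z t))%C with (Ci * RtoC y)%C.
    + rewrite Cmod_mult, Cmod_Ci, Cmod_R, Rabs_pos_eq; lra.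
    + rewrite imaginary_pair; ring. }
rewrite (lim0_unique _ _ _ B A); ring.
Qed.

Lemma conj_exponent_arg (t y : R) : half_open tau t -> 0 < y ->
  Im (l2 t y) = argH ((0, y) - Cconj (z t - W t)) - argH (U t y 0 - Cconj z0).
Proof.
intros Ht Hy.
destruct (Hl2 t y Ht Hy) as (F & F0 & Fc & Fd & <-).
rewrite <- (force_start t Ht), <- (force_end t Ht).
assert (HUt := HU t y Ht Hy).
destruct HUt as (_ & _ & <- & _).
apply (flow_difference_arg driving_speed t y (U t y)
  (fun s => Cconj (force_flow t s)) F conj_force_kernel); auto.
- apply Ht.
- now apply centered_flow_conj, force_flow_centered.
- intros s; unfold force_flow.
  assert (P := force_Im_nonneg _ (clamp_half_open t s Ht)).
  simpl; unfold Im in *; lra.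
- intros s Hs; unfold force_flow; rewrite clamp_id by lra; reflexivity.
Qed.

(** Passage to the limit in [conj_exponent_arg]; [A] is the limit of the
    argument at the tip. *)
Lemma conj_exponent_arg_limit (t A : R) : half_open tau t -> 0 < t ->
  (forall e, 0 < e -> exists d, 0 < d /\ forall y, 0 < y < d ->
     Rabs (argH ((0, y) - Cconj (z t - W t)) - A) < e) ->
  Im (Lam2 t) = A - argH (gamma t - Cconj z0).
Proof.
intros Ht H0 HA.
assert (Ig : 0 < Im (gamma t)).
{ apply (tip_Im_pos tau driving_speed U); auto using driving_speed_bounds. }
assert (Ig' : 0 < Im (gamma t - Cconj z0)%C) by (simpl; unfold Im in *; lra).
apply Rminus_diag_uniq, cond_eq.
intros e He; rewrite Rminus_0_r.
destruct (HA (e / 3)) as (d1 & P1 & H1); [lra|].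
destruct (argH_continuous _ (e / 3) Ig') as (d & Pd & Hd); [lra|].
destruct (Hg t Ht d Pd) as (d2 & P2 & H2).
destruct (HL2 t Ht (e / 3)) as (d3 & P3 & H3); [lra|].
set (y := Rmin d1 (Rmin d2 d3) / 2).
assert (M1 := Rmin_l d1 (Rmin d2 d3)); assert (M2 := Rmin_r d1 (Rmin d2 d3)).
assert (M3 := Rmin_l d2 d3); assert (M4 := Rmin_r d2 d3).
assert (Py : 0 < y).
{ apply Rdiv_lt_0_compat; [repeat apply Rmin_pos; lra | lra]. }
assert (Q1 := H1 y ltac:(unfold y in *; lra)).
assert (Q2 := H2 y ltac:(unfold y in *; lra)).
assert (Q3 := H3 y ltac:(unfold y in *; lra)).
assert (Q2' : Rabs (argH (U t y 0 - Cconj z0) - argH (gamma t - Cconj z0)) < e / 3).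
{ apply Hd.
  replace (U t y 0 - Cconj z0 - (gamma t - Cconj z0))%C with (U t y 0 - gamma t)%C
    by ring.
  exact Q2. }
assert (Q3' := Rle_lt_trans _ _ _ (im_le_Cmod _) Q3).
assert (E := conj_exponent_arg t y Ht Py).
change (Im (l2 t y - Lam2 t)%C) with (Im (l2 t y) - Im (Lam2 t)) in Q3'.
apply Rabs_def2 in Q1, Q2', Q3'.
apply Rabs_def1; lra.
Qed.

Lemma direction_real (t : R) : Im z0 = 0 -> half_open tau t -> 0 < t ->
  PI - argH (gamma t) + Im (tip_exponent t) = field_real rho (Re z0) (gamma t).
Proof.
intros Ez Ht H0.
assert (F := force_flow_centered t Ht).
assert (T0 : 0 <= t <= t) by lra.
assert (R0 : Im (force_flow t 0) = 0) by now rewrite force_start.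
assert (Rt := centered_flow_real _ _ _ F t T0 R0).
assert (St := centered_flow_real_sign _ _ _ F t T0 R0).
rewrite force_start in St by exact Ht.
rewrite force_end in Rt, St by exact Ht.
assert (Nt := force_neq_drive t Ht).
assert (Ec : Cconj z0 = RtoC (Re z0)).
{ destruct z0 as [a b]; unfold Cconj, RtoC, Re, Im in *; simpl in *.
  rewrite Ez; f_equal; ring. }
(* The force point stays real, so that both kernels coincide. *)
assert (E12 : Lam1 t = Lam2 t).
{ apply lim0_unique with (l1 t); [now apply HL1|].
  apply lim0_ext with (l2 t); [|now apply HL2].
  intros y Hy.
  apply is_flow_integral_unique with (b1 := conj_force_kernel) (b2 := force_kernel)
    (t := t) (U := U t y); auto; [apply Ht|].
  intros s Hs; unfold conj_force_kernel, force_kernel.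
  assert (Hs' : half_open tau s) by (apply half_open_le with t; [lra | exact Ht]).
  assert (Fs := force_flow_centered s Hs').
  assert (Rs := centered_flow_real _ _ _ Fs s ltac:(lra)
    ltac:(rewrite force_start by exact Hs'; exact Ez)).
  rewrite force_end in Rs by exact Hs'.
  destruct (z s - W s)%C as [a b]; unfold Cconj, Im in *; simpl in *.
  rewrite Rs, Ropp_0; reflexivity. }
assert (E2 : Im (Lam2 t) = (if Rlt_dec 0 (Re z0) then PI else 0) -
  argH (gamma t - Cconj z0)).
{ apply conj_exponent_arg_limit; auto.
  intros e He.
  set (x := - Re (z t - W t)%C).
  assert (Hx : x <> 0).
  { intros E; apply Nt.
    destruct (z t - W t)%C as [a b]; unfold x, Re, Im, RtoC in *; simpl in *.
    f_equal; lra. }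
  assert (Px : 0 < Rabs x) by now apply Rabs_pos_lt.
  exists (e * Rabs x); split; [nra|]; intros y Hy.
  replace ((0, y) - Cconj (z t - W t))%C with (x, y).
  2:{ destruct (z t - W t)%C as [a b].
      unfold x, Cconj, Cminus, Cplus, Copp, Re, Im in *; simpl in *.
      rewrite Rt; apply f_equal2; ring. }
  replace (if Rlt_dec 0 (Re z0) then PI else 0) with
    (if Rlt_dec 0 x then 0 else PI).
  2:{ destruct (Rlt_dec 0 (Re z0)) as [P|P], (Rlt_dec 0 x) as [Q|Q]; auto.
      - apply St in P; unfold x in Q; lra.
      - exfalso; apply P, St; unfold x in *; lra. }
  apply Rle_lt_trans with (1 := argH_near_real x y Hx (proj1 Hy)).
  apply Rmult_lt_reg_r with (1 := Px).
  unfold Rdiv; rewrite Rmult_assoc, Rinv_l; lra. }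
assert (Ei : Im (tip_exponent t) = rho / 4 * (Im (Lam1 t) + Im (Lam2 t))).
{ unfold tip_exponent; rewrite im_scal_l; reflexivity. }
rewrite Ei, E12, E2, Ec; unfold field_real.
destruct (Rlt_dec 0 (Re z0)); field.
Qed.

(** Continuous determination of [arg(gamma(t) - z_0)]. *)
Definition tip_angle (t : R) : R := - argH (W t - Cconj (z t)) - Im (Lam1 t).

Lemma force_Im_pos (t : R) : 0 < Im z0 -> half_open tau t ->
  0 < Im (W t - Cconj (z t))%C.
Proof.
intros P Ht.
assert (Q := centered_flow_Im_forward _ _ _ (force_flow_centered t Ht) t
  ltac:(destruct Ht; lra) ltac:(rewrite force_start by exact Ht; exact P)).
rewrite force_end in Q by exact Ht.
simpl in *; unfold Im in *; lra.
Qed.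

Lemma tip_neq_force (t : R) : half_open tau t -> (gamma t - z0)%C <> 0.
Proof.
intros Ht E.
assert (H := tip_distance_exp t Ht); rewrite E, Cmult_0_l in H.
apply (force_neq_drive t Ht).
replace (z t - W t)%C with (- (W t - z t))%C by ring; rewrite H; ring.
Qed.

Lemma tip_angle_spec (t : R) : 0 < Im z0 -> half_open tau t ->
  (gamma t - z0)%C = (Cmod (gamma t - z0) * cis (tip_angle t))%C.
Proof.
intros P Ht.
assert (Pq := force_Im_pos t P Ht).
destruct (argH_spec _ Pq) as [_ E].
set (a := argH (W t - Cconj (z t))%C) in *.
set (m := Cmod (W t - Cconj (z t))) in *.
assert (Pm : 0 < m) by (apply Cmod_gt_0, Im_pos_neq_0, Pq).
assert (E1 : (W t - z t)%C = (m * cis (- a))%C).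
{ transitivity (Cconj (W t - Cconj (z t))).
  - rewrite Cminus_conj, Cconj_conj.
    unfold Cconj, RtoC; simpl; rewrite Ropp_0; reflexivity.
  - rewrite E, Cmult_conj; unfold cis, Cconj, RtoC; simpl.
    rewrite cos_neg, sin_neg, Ropp_0; reflexivity. }
rewrite (tip_distance_exp t Ht) in E1.
assert (E2 : (gamma t - z0)%C =
  (RtoC (m * exp (- Re (Lam1 t))) * cis (tip_angle t))%C).
{ unfold tip_angle; fold a.
  replace (- a - Im (Lam1 t)) with (- a + - Im (Lam1 t)) by ring.
  rewrite cis_plus, RtoC_mult.
  transitivity (RtoC m * cis (- a) * cexp (- Lam1 t))%C.
  - rewrite <- E1, <- Cmult_assoc, <- cexp_plus.
    replace (Lam1 t + - Lam1 t)%C with (RtoC 0) by ring.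
    rewrite cexp_0; ring.
  - unfold cexp; simpl; unfold Re, Im; ring. }
rewrite E2 at 2.
rewrite Cmod_mult, Cmod_cis, Cmod_R, Rabs_pos_eq, Rmult_1_r.
- exact E2.
- left; apply Rmult_lt_0_compat; [exact Pm | apply exp_pos].
Qed.

Lemma direction_interior (t : R) : 0 < Im z0 -> half_open tau t -> 0 < t ->
  PI - argH (gamma t) + Im (tip_exponent t) =
  PI - argH (gamma t) - rho / 4 * (tip_angle t + argH (gamma t - Cconj z0)).
Proof.
intros P Ht H0.
assert (Pq := force_Im_pos t P Ht).
assert (E2 : Im (Lam2 t) = argH (W t - Cconj (z t)) - argH (gamma t - Cconj z0)).
{ apply conj_exponent_arg_limit; auto.
  intros e He.
  destruct (argH_continuous _ e Pq He) as (d & Pd & Hd).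
  exists d; split; [exact Pd|]; intros y Hy; apply Hd.
  replace ((0, y) - Cconj (z t - W t) - (W t - Cconj (z t)))%C with (Ci * RtoC y)%C.
  - rewrite Cmod_mult, Cmod_Ci, Cmod_R, Rabs_pos_eq; lra.
  - unfold Ci, Cconj, Cmult, Cminus, Cplus, Copp, RtoC; simpl; apply f_equal2; ring. }
assert (Ei : Im (tip_exponent t) = rho / 4 * (Im (Lam1 t) + Im (Lam2 t))).
{ unfold tip_exponent; rewrite im_scal_l; reflexivity. }
rewrite Ei, E2; unfold tip_angle; ring.
Qed.

Lemma tip_angle_start (r theta : R) : 0 < r -> 0 < theta < PI ->
  z0 = (r * cis theta)%C -> half_open tau 0 -> tip_angle 0 = theta - PI.
Proof.
intros Hr Hth E H0.
assert (L0 : Lam1 0 = 0).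
{ apply (tip_integral_start tau U force_kernel l1 Lam1 Hl1 HL1 H0). }
unfold tip_angle; rewrite L0.
rewrite (SLE0_start _ _ _ _ _ _ HS), (proj1 (SLE0_force _ _ _ _ _ _ HS)).
replace (0 - Cconj z0)%C with (r * cis (PI - theta))%C.
- rewrite argH_polar; simpl; lra.
- rewrite E; unfold cis, Cconj, Cmult, Cminus, Cplus, Copp, RtoC; simpl.
  rewrite Rtrigo_facts.cos_pi_minus, Rtrigo_facts.sin_pi_minus; apply f_equal2; ring.
Qed.

Lemma tip_angle_continuous (t e : R) : 0 < Im z0 -> half_open tau t -> 0 < e ->
  exists d, 0 < d /\ forall a, half_open tau a -> Rabs (a - t) < d ->
    Rabs (tip_angle a - tip_angle t) < e.
Proof.
intros P Ht He.
destruct (half_open_extend tau t Ht) as (T & HtT & HT).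
destruct (tip_integral_continuous tau driving_speed U driving_speed_bounds HU
  force_kernel l1 Lam1 ltac:(intros S HS'; apply clamped_kernel_bound;
    [apply HS' | now apply kernel_continuity]) Hl1 HL1 t (e / 3) Ht ltac:(lra))
  as (d1 & P1 & H1).
set (D := fun s => (W (clamp T s) - Cconj (z (clamp T s)))%C).
assert (Dc : continuity (fun s => argH (D s))).
{ apply argH_comp_continuity.
  - apply Ccontinuity_minus.
    + now apply Ccontinuity_RtoC, drive_clamp_continuity.
    + now apply Ccontinuity_conj, force_clamp_continuity.
  - intros s; apply force_Im_pos; [exact P | now apply clamp_half_open]. }
destruct (proj1 (filterlim_locally _ _) (proj1 (continuity_pt_filterlim _ _) (Dc t))
  (mkposreal (e / 3) ltac:(lra))) as [d2 H2].
exists (Rmin d1 (Rmin d2 (T - t))).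
assert (P2 := cond_pos d2).
assert (M1 := Rmin_l d1 (Rmin d2 (T - t))); assert (M2 := Rmin_r d1 (Rmin d2 (T - t))).
assert (M3 := Rmin_l d2 (T - t)); assert (M4 := Rmin_r d2 (T - t)).
split; [repeat apply Rmin_pos; lra|].
intros a Ha Hat.
assert (Q1 := H1 a Ha ltac:(lra)).
assert (Q2 : Rabs (argH (D a) - argH (D t)) < e / 3).
{ apply (H2 a); change (Rabs (a - t) < d2); lra. }
unfold D in Q2; rewrite !clamp_id in Q2.
2:{ destruct Ht; lra. }
2:{ apply Rabs_lt_between' in Hat; destruct Ha; lra. }
assert (Q1' := Rle_trans _ _ _ (im_le_Cmod _) Q1).
change (Im (Lam1 a - Lam1 t)%C) with (Im (Lam1 a) - Im (Lam1 t)) in Q1'.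
unfold tip_angle.
apply Rabs_def2 in Q2; apply Rabs_le_between in Q1'.
apply Rabs_def1; lra.
Qed.

End Exponents.

End SLE.

(** The curve has a nonzero velocity [v] with respect to [sqrt t], whose
    direction is given by the field; [alpha] is a continuous determination of
    [arg(gamma - z0)] when [z0] is an interior point. *)
Lemma SLE0_curve_velocity (rho : R) (z0 : C) (tau : Rbar) (W : R -> R)
  (z gamma : R -> C) :
  0 <= Im z0 -> is_SLE0 rho z0 tau W z gamma ->
  exists (v : R -> C) (alpha : R -> R),
  (forall t, half_open tau t -> v t <> 0) /\
  (forall t e, half_open tau t -> 0 < e ->
     exists d, 0 < d /\ forall a b, half_open tau a -> half_open tau b -> a <= b ->
       Rabs (a - t) < d -> Rabs (b - t) < d ->
       Cmod (gamma b - gamma a - v t * RtoC (sqrt b - sqrt a))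
       <= e * (sqrt b - sqrt a)) /\
  (half_open tau 0 -> gamma 0 = 0) /\
  (forall t, half_open tau t -> 0 < t -> 0 < Im (gamma t)) /\
  (Im z0 = 0 -> forall t, half_open tau t -> 0 < t ->
     (v t / RtoC (Cmod (v t)))%C = cis (field_real rho (Re z0) (gamma t))) /\
  (0 < Im z0 ->
     (forall t e, half_open tau t -> 0 < e ->
        exists d, 0 < d /\ forall a, half_open tau a -> Rabs (a - t) < d ->
          Rabs (alpha a - alpha t) < e) /\
     (forall r theta, 0 < r -> 0 < theta < PI -> z0 = (r * cis theta)%C ->
        half_open tau 0 -> alpha 0 = theta - PI) /\
     (forall t, half_open tau t -> 0 < Cmod (gamma t - z0) /\
        (gamma t - z0)%C = (Cmod (gamma t - z0) * cis (alpha t))%C) /\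
     (forall t, half_open tau t -> 0 < t ->
        (v t / RtoC (Cmod (v t)))%C =
        cis (PI - argH (gamma t) - rho / 4 * (alpha t + argH (gamma t - Cconj z0))))).
Proof.
intros Hz0 HS.
assert (Hk := driving_speed_bounds rho z0 tau W z gamma HS).
destruct (tip_flows_exist rho z0 tau W z gamma HS) as (U & HU & Hg).
destruct (tip_exponents_exist rho z0 tau W z gamma HS U (force_kernel W z) HU)
  as (l1 & Lam1 & Hl1 & HL1).
{ intros T HT; now apply (kernel_continuity rho z0 tau W z gamma HS). }
destruct (tip_exponents_exist rho z0 tau W z gamma HS U (conj_force_kernel W z) HU)
  as (l2 & Lam2 & Hl2 & HL2).
{ intros T HT; now apply (kernel_continuity rho z0 tau W z gamma HS). }
assert (HE := drive_integral rho z0 tau W z gamma HS U l1 l2 HU Hl1 Hl2).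
assert (HLam := tip_exponent_limit rho tau l1 l2 Lam1 Lam2 HL1 HL2).
set (Lam := tip_exponent rho Lam1 Lam2) in *.
exists (tip_speed gamma Lam), (tip_angle W z Lam1).
split; [|split; [|split; [|split; [|split]]]].
- intros t Ht; now apply (tip_speed_neq_0 tau _ U gamma Hk HU Hg).
- intros t e Ht He.
  exact (tip_sqrt_derivative tau _ U gamma Hk HU Hg _ Lam HE HLam t e Ht He).
- exact (tip_start tau _ U gamma HU Hg).
- exact (tip_Im_pos tau _ U gamma Hk HU Hg).
- intros Ez t Ht H0.
  rewrite (tip_speed_direction tau _ U gamma Hk HU Hg Lam t Ht H0).
  apply f_equal.
  now apply (direction_real rho z0 tau W z gamma Hz0 HS U l1 l2).
- intros P; split; [|split; [|split]].
  + intros t e Ht He.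
    exact (tip_angle_continuous rho z0 tau W z gamma HS U l1 Lam1 HU Hl1 HL1 t e P Ht He).
  + intros r theta Hr Hth E H0.
    exact (tip_angle_start rho z0 tau W z gamma HS U l1 Lam1 Hl1 HL1 r theta Hr Hth E H0).
  + intros t Ht; split.
    * apply Cmod_gt_0.
      exact (tip_neq_force rho z0 tau W z gamma HS U l1 Lam1 HU Hg Hl1 HL1 t Ht).
    * exact (tip_angle_spec rho z0 tau W z gamma HS U l1 Lam1 HU Hg Hl1 HL1 t P Ht).
  + intros t Ht H0.
    rewrite (tip_speed_direction tau _ U gamma Hk HU Hg Lam t Ht H0).
    apply f_equal.
    exact (direction_interior rho z0 tau W z gamma Hz0 HS U l2 Lam1 Lam2 HU Hg Hl2 HL2
      t P Ht H0).
Qed.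

Theorem proposition7 :
  forall (rho : R) (z0 : C) (tau : Rbar) (W : R -> R) (z gamma : R -> C)
    (L : Rbar) (eta : R -> C),
  0 <= Im z0 ->
  z0 <> RtoC 0 ->
  is_SLE0 rho z0 tau W z gamma ->
  is_arclength_reparam tau gamma L eta ->
  (Im z0 = 0 -> flow_line (field_real rho (Re z0)) L eta) /\
  (forall r theta : R,
     0 < r -> 0 < theta < PI -> z0 = (r * cis theta)%C ->
     (exists e : R -> log_surface z0, is_log_lift L eta r (theta - PI) e) /\
     (forall e : R -> log_surface z0,
        is_log_lift L eta r (theta - PI) e ->
        log_flow_line (field_interior rho) L e)).
Proof.
intros rho z0 tau W z gamma L eta Hz0 _ HS (sigma & Hsig & HL).
destruct (SLE0_curve_velocity rho z0 tau W z gamma Hz0 HS)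
  as (v & alpha & Hv & Hd & Hg0 & Hgp & Hreal & Hint).
destruct (choice_on (half_open L) (fun s t => half_open tau t /\ sigma t = s) 0)
  as (tinv & Htinv).
{ intros s Hs; now apply HL. }
assert (Heta : forall s, half_open L s -> eta s = gamma (tinv s)).
{ intros s Hs; destruct (Htinv s Hs) as [Ht Es].
  rewrite <- (proj2 (Hsig _ Ht)), Es; reflexivity. }
assert (Sig0 : half_open tau 0 -> sigma 0 = 0).
{ intros H0; exact (curve_length_point _ _ _ (proj1 (Hsig 0 H0))). }
assert (Pos : forall s, 0 < s -> half_open L s -> 0 < tinv s).
{ intros s H0 Hs; destruct (Htinv s Hs) as [Ht Es].
  destruct (Rle_lt_or_eq_dec _ _ (proj1 Ht)) as [P|E]; [exact P|].
  rewrite <- E in Es, Ht; rewrite Sig0 in Es by exact Ht; lra. }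
assert (Inv0 : half_open L 0 -> tinv 0 = 0).
{ intros Hs; destruct (Htinv 0 Hs) as [Ht Es].
  destruct (Rle_lt_or_eq_dec _ _ (proj1 Ht)) as [P|E]; [|now symmetry].
  assert (H0 : half_open tau 0)
    by (apply half_open_le with (tinv 0); [lra | exact Ht]).
  assert (I := arc_length_increasing tau gamma v eta sigma Hv Hd Hsig
    0 (tinv 0) H0 Ht P).
  rewrite Sig0 in I by exact H0; lra. }
split.
- intros Ez; split.
  + exact (arc_length_C1 tau L gamma v eta sigma Hv Hd Hsig tinv Htinv).
  + intros s H0 HsL.
    assert (Hs : half_open L s) by (split; [lra | exact HsL]).
    destruct (Htinv s Hs) as [Ht _].
    assert (Pt := Pos s H0 Hs).
    rewrite (Heta s Hs); split; [now apply Hgp|].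
    rewrite <- (Hreal Ez (tinv s) Ht Pt).
    exact (arc_length_is_derive tau L gamma v eta sigma Hv Hd Hsig tinv Htinv s H0 HsL).
- intros r theta Hr Hth Ez.
  assert (Pz : 0 < Im z0).
  { rewrite Ez; rewrite im_scal_l; simpl.
    apply Rmult_lt_0_compat; [exact Hr | apply sin_gt_0; lra]. }
  destruct (Hint Pz) as (Hac & Ha0 & Hpol & Hdir); clear Hint.
  assert (Hac' : forall s e, half_open L s -> 0 < e ->
    exists d, 0 < d /\ forall q, half_open L q -> Rabs (q - s) < d ->
      Rabs (alpha (tinv q) - alpha (tinv s)) < e).
  { intros s e Hs He; destruct (Htinv s Hs) as [Ht _].
    destruct (Hac (tinv s) e Ht He) as (d1 & P1 & H1).
    destruct (arc_length_inverse_continuous tau L gamma v eta sigma Hv Hd Hsig tinv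
      Htinv s d1 Hs P1) as (d & P & H).
    exists d; split; [exact P|]; intros q Hq Hqs.
    apply H1; [now apply Htinv | now apply H]. }
  assert (Hstart : half_open L 0 -> alpha (tinv 0) = theta - PI).
  { intros H0; rewrite Inv0 by exact H0.
    apply (Ha0 r theta); auto.
    rewrite <- (Inv0 H0); now apply Htinv. }
  split.
  + (* The lift has polar coordinates [|eta - z0|] and [alpha]. *)
    destruct (choice_on (fun _ : R => True) (fun s (p : log_surface z0) =>
      (half_open L s -> rad p = Cmod (eta s - z0) /\ ang p = alpha (tinv s)) /\
      (~ half_open L s -> rad p = r /\ ang p = theta - PI))
      (LogPoint r (theta - PI) Hr)) as (e & He).
    { intros s _; destruct (excluded_middle_informative (half_open L s)) as [Hs|Hs].
      - destruct (Htinv s Hs) as [Ht _].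
        assert (P : 0 < Cmod (eta s - z0)) by (rewrite (Heta s Hs); now apply Hpol).
        exists (LogPoint _ (alpha (tinv s)) P); split; [|tauto].
        intros _; split; reflexivity.
      - exists (LogPoint _ (theta - PI) Hr); split; [tauto|].
        intros _; split; reflexivity. }
    assert (He1 : forall s, half_open L s ->
      rad (e s) = Cmod (eta s - z0) /\ ang (e s) = alpha (tinv s)).
    { intros s Hs; now apply He. }
    exists e; split; [split|split; [|]].
    * apply continuous_on_of_estimate; intros s Hs q Hq.
      destruct (arc_length_continuous tau L gamma v eta sigma Hv Hd Hsig tinv Htinv
        s q Hs Hq) as (d & P & H).
      exists d; split; [exact P|]; intros p Hp Hps.
      rewrite (proj1 (He1 s Hs)), (proj1 (He1 p Hp)).
      apply Rle_lt_trans with (2 := H p Hp Hps).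
      replace (eta p - eta s)%C with ((eta p - z0) - (eta s - z0))%C by ring.
      generalize (Cmod_triangle ((eta p - z0) - (eta s - z0)) (eta s - z0)).
      generalize (Cmod_triangle ((eta s - z0) - (eta p - z0)) (eta p - z0)).
      rewrite (Cmod_minus_sym (eta s - z0)).
      replace ((eta s - z0) - (eta p - z0) + (eta p - z0))%C with (eta s - z0)%C by ring.
      replace ((eta p - z0) - (eta s - z0) + (eta s - z0))%C with (eta p - z0)%C by ring.
      intros A B; apply Rabs_le; lra.
    * apply continuous_on_of_estimate; intros s Hs q Hq.
      destruct (Hac' s q Hs Hq) as (d & P & H).
      exists d; split; [exact P|]; intros p Hp Hps.
      rewrite (proj2 (He1 s Hs)), (proj2 (He1 p Hp)); now apply H.
    * intros s Hs; unfold log_proj.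
      destruct (He1 s Hs) as [-> ->].
      rewrite (Heta s Hs), <- (proj2 (Hpol _ (proj1 (Htinv s Hs)))); ring.
    * destruct (excluded_middle_informative (half_open L 0)) as [H0|H0].
      -- destruct (He1 0 H0) as [-> ->]; split; [|now apply Hstart].
         rewrite (Heta 0 H0), (Inv0 H0), Hg0.
         2:{ rewrite <- (Inv0 H0); now apply Htinv. }
         rewrite Cmod_minus_sym.
         replace (z0 - 0)%C with z0 by ring.
         rewrite Ez, Cmod_mult, Cmod_cis, Cmod_R, Rabs_pos_eq; lra.
      -- now apply He.
  + intros e (Hec & Hproj & Hr0 & Ht0).
    (* The angle of any lift is the determination [alpha]. *)
    assert (Hang : forall s, half_open L s -> ang (e s) = alpha (tinv s)).
    { intros s Hs.
      assert (Hsub : forall q, 0 <= q <= s -> half_open L q).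
      { intros q Hq; now apply half_open_le with s. }
      assert (H0 : half_open L 0) by (apply Hsub; destruct Hs; lra).
      assert (Hs0 := proj1 Hs).
      rewrite <- (clamp_id s s) by lra.
      apply (continuous_angle_unique (fun q => ang (e (clamp s q)))
        (fun q => alpha (tinv (clamp s q))) s Hs0).
      - apply (within_segment_clamp (fun q => ang (e q)) (half_open L)); auto.
        intros q Hq; apply (proj2 Hec), Hsub, Hq.
      - apply (within_segment_clamp (fun q => alpha (tinv q)) (half_open L)); auto.
        intros q Hq.
        assert (Hcont : continuous_on (T := R_UniformSpace) (U := R_UniformSpace)
          (half_open L) (fun q => alpha (tinv q))).
        { apply continuous_on_of_estimate; intros p Hp x Hx; now apply Hac'. }
        apply Hcont, Hsub, Hq.
      - rewrite clamp_id, Ht0 by lra; symmetry; now apply Hstart.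
      - intros q Hq; rewrite clamp_id by lra.
        assert (Hq' := Hsub q Hq).
        destruct (Hpol _ (proj1 (Htinv q Hq'))) as [P E].
        apply (cis_polar_unique _ _ _ _ (rad_pos z0 (e q)) P).
        rewrite <- E, <- (Heta q Hq'), <- (Hproj q Hq').
        unfold log_proj; ring. }
    assert (Hsig' : forall t, half_open tau t ->
      is_curve_length gamma 0 t (sigma t) /\ log_proj (e (sigma t)) = gamma t).
    { intros t Ht; destruct (Hsig t Ht) as [H1 H2]; split; [exact H1|].
      rewrite Hproj; [exact H2|]; apply HL; exists t; auto. }
    split; [exact Hec | split].
    * exact (arc_length_C1 tau L gamma v (fun s => log_proj (e s)) sigma Hv Hd Hsig'
        tinv Htinv).
    * intros s H0 HsL.
      assert (Hs : half_open L s) by (split; [lra | exact HsL]).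
      destruct (Htinv s Hs) as [Ht _].
      assert (Pt := Pos s H0 Hs).
      unfold field_interior; rewrite (Hproj s Hs), (Heta s Hs), (Hang s Hs).
      split; [now apply Hgp|].
      rewrite <- (Hdir (tinv s) Ht Pt).
      exact (arc_length_is_derive tau L gamma v (fun s => log_proj (e s)) sigma Hv Hd
        Hsig' tinv Htinv s H0 HsL).
Qed.
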